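(* Consider the gradient flow $u_t = G(\mathcal{L}u + f(u))$, $(x,t)\in\Omega\times[0,T]$, where $G$ is a negative operator, $\mathcal{L}$ is a positive definite sectorial operator, and $f=F'$ is Lipschitz continuous with Lipschitz constant $C_L$, with energy $E(u)=\int_\Omega\big(\tfrac12|\mathcal{L}_{1/2}u|^2+F(u)\big)\,dx$. Let $\beta\ge C_L$, $L=\beta I+\mathcal{L}$ and $g(u)=\beta u-f(u)$. Consider an $s$-stage explicit ETDRK scheme with stabilizer $\beta$, $$v_1=u_n,\qquad v_i=\chi_i(\tau GL)u_n-\tau\sum_{j=1}^{i-1}a_{ij}(\tau GL)\,G g(v_j)\quad (i=2,\dots,s),\qquad u_{n+1}=\chi(\tau GL)u_n-\tau\sum_{j=1}^{s}b_j(\tau GL)\,G g(v_j),$$ whose coefficient functions satisfy $\sum_{j=1}^s b_j(z)=\frac{\chi(z)-1}{z}$ and $\sum_{j=1}^{i-1} a_{ij}(z)=\frac{\chi_i(z)-1}{z}$ for $i=2,\dots,s$. Let $$P(z)=\begin{pmatrix} a_{21}(z)&&&&\\ a_{31}(z)&a_{32}(z)&&&\\ \vdots&\vdots&\ddots&&\\ a_{s1}(z)&a_{s2}(z)&\cdots&a_{s,s-1}(z)&\\ b_1(z)&b_2(z)&\cdots&b_{s-1}(z)&b_s(z)\end{pmatrix}$$ and $$\Delta(z)=zE_L+P(z)^{-1}E_L-\frac z2 I,$$ where $I$ is the $s\times s$ identity and $E_L=(1_{i\ge j})_{s\times s}$. If $\Delta(z)$ is positive-definite for all negative $z\in\mathbb{R}$,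 then the scheme unconditionally decreases the energy: for every time step $\tau>0$ and every $n$, $E(u_{n+1})\le E(u_n)$.
   Context: Setting: $\mathcal{H}$ is a Hilbert space of real functions on a bounded domain $\Omega\subset\mathbb{R}^d$ ($d=1,2,3$), with inner product $(u,v)=\int_\Omega uv\,dx$ and norm $\|\cdot\|$. $G$ negative means self-adjoint negative definite (invertible) on $\mathcal{H}$; $\mathcal{L}$ positive definite means self-adjoint positive definite, with square root $\mathcal{L}_{1/2}$, so that $\int_\Omega|\mathcal{L}_{1/2}u|^2dx=(\mathcal{L}u,u)$. $F$ is such that $F'=f$, and $f$ acts pointwise on functions. Lipschitz continuity of $f$ means $\|f(u)-f(v)\|\le C_L\|u-v\|$ for all $u,v\in\mathcal{H}$. The gradient flow can be rewritten as $u_t=G(Lu-g(u))$. In the scheme, $u_n$ denotes the numerical solution at step $n$, $\tau>0$ is the time step, $\chi(z)=e^z$, $\chi_i(z)=\chi(c_iz)=e^{c_iz}$ with nodes $c_i$ ($c_1=0$), and $a_{ij}(z)$, $b_j(z)$ are real coefficient functions, applied to $z=\tau GL$ by functional calculus. The two sum conditions on the coefficients (preservation of equilibria) are standing assumptions on ETDRK schemes. A real square matrix $\Delta$ (not necessarily symmetric) is called positive-definite if all eigenvalues of $(\Delta+\Delta^T)/2$ are positive. All functions are assumed regular enough that the expressions involved are well defined. *)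

(* Defs.v *)
From HB Require Import structures.
From mathcomp Require Import all_boot all_order all_algebra.
From mathcomp Require Import all_classical all_reals all_analysis.

Set Implicit Arguments.
Unset Strict Implicit.
Unset Printing Implicit Defensive.

Import Order.TTheory GRing.Theory Num.Theory.
Import numFieldNormedType.Exports.

Local Open Scope classical_set_scope.
Local Open Scope ring_scope.

(* 'rV[R]_d with its Borel sigma-algebra. *)
Definition borel_space (R : realType) (d : nat) :=
  g_sigma_algebraType [set A : set 'rV[R]_d | open A].

(* Lebesgue measure on the Borel sets of R^d, characterised (uniquely) by the
   volume of boxes; the library only has the measure for d = 1. *)
Definition is_lebesgue (R : realType) (d : nat)
    (lam : {measure set (borel_space R d) -> \bar R}) : Prop :=
  forall a b : 'rV[R]_d, (forall i, a 0 i <= b 0 i) ->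
    lam [set x : 'rV[R]_d | forall i, a 0 i <= x 0 i <= b 0 i] =
    (\prod_(i < d) (b 0 i - a 0 i))%:E.

Definition bounded_domain (R : realType) (d : nat) (Omega : set 'rV[R]_d) :
    Prop :=
  [/\ Omega !=set0, open Omega, connected Omega & bounded_set Omega].

Section FunctionSpace.
Context (R : realType) (d : nat).
Variables (lam : {measure set (borel_space R d) -> \bar R})
  (Omega : set 'rV[R]_d).

Definition L2norm (h : 'rV[R]_d -> R) : R :=
  Num.sqrt (\int[lam]_(x in Omega) (h x ^+ 2)).

(* A Hilbert space of real functions on Omega, i.e. (an isometric copy of) a
   closed subspace of L^2(Omega). An element u of the carrier stands for a class
   of functions modulo equality almost everywhere, and [ev u] is a
   representative of that class. *)
Record function_space := FunctionSpace {
  carrier :> lmodType R ;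
  ev : carrier -> 'rV[R]_d -> R ;
  ev_measurable : forall u,
    measurable_fun (Omega : set (borel_space R d)) (ev u) ;
  ev_square_integrable : forall u,
    lam.-integrable Omega (fun x => (ev u x ^+ 2)%:E) ;
  ev_linear : forall (a : R) (u v : carrier),
    {ae lam, forall x, Omega x -> ev (a *: u + v) x = a * ev u x + ev v x} ;
  ev_injective : forall u : carrier,
    {ae lam, forall x, Omega x -> ev u x = 0} -> u = 0 ;
  space_complete : forall w : nat -> carrier,
    (forall e : R, 0 < e -> exists N : nat, forall m n : nat,
       (N <= m)%N -> (N <= n)%N -> L2norm (ev (w m - w n)) < e) ->
    exists l : carrier, forall e : R, 0 < e -> exists N : nat,
      forall n : nat, (N <= n)%N -> L2norm (ev (w n - l)) < e
}.

End FunctionSpace.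

Section Operators.
Context (R : realType) (d : nat)
  (lam : {measure set (borel_space R d) -> \bar R}) (Omega : set 'rV[R]_d)
  (H : function_space lam Omega).
Implicit Types (u v w : H).

Definition ip u v : R := \int[lam]_(x in Omega) (ev u x * ev v x).

Definition hnorm u : R := Num.sqrt (ip u u).

(* Partially defined operators in H; the values outside [dom A] are junk. *)
Record operator := Operator { dom : set H ; app :> H -> H }.
Implicit Types (A : operator).

Definition linear_operator A : Prop :=
  dom A 0 /\ forall (a : R) u v, dom A u -> dom A v ->
    dom A (a *: u + v) /\ A (a *: u + v) = a *: A u + A v.

Definition densely_defined A : Prop :=
  forall u (e : R), 0 < e -> exists2 v, dom A v & hnorm (u - v) < e.

(* The last clause says that A coincides, domain included, with its adjoint. *)
Definition self_adjoint A : Prop :=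
  [/\ linear_operator A, densely_defined A &
      forall v w, (forall u, dom A u -> ip (A u) v = ip u w) <->
                  (dom A v /\ A v = w)].

Definition positive_definite A : Prop :=
  self_adjoint A /\ forall u, dom A u -> u <> 0 -> 0 < ip (A u) u.

Definition boundedly_invertible A : Prop :=
  (forall w, exists2 u, dom A u & A u = w) /\
  exists C : R, forall u, dom A u -> hnorm u <= C * hnorm (A u).

Definition negative_definite A : Prop :=
  [/\ self_adjoint A, (forall u, dom A u -> u <> 0 -> ip (A u) u < 0) &
      boundedly_invertible A].

(* The complement of the closed sector with vertex a0 and slope k belongs to the
   resolvent set, and |(l - A)^-1| <= M / |l - a0| there. This is written in the
   complexification of H: l = (a0 + x) + i y acts on the pair (u, v) = u + i v. *)
Definition sectorial A : Prop :=
  [/\ linear_operator A, densely_defined A &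
  exists a0 k M : R, [/\ 0 < k, 0 <= M &
  forall x y : R, k * x < `|y| ->
    (forall p q, exists u v, [/\ dom A u, dom A v,
       (a0 + x) *: u - y *: v - A u = p &
       (a0 + x) *: v + y *: u - A v = q]) /\
    (forall u v, dom A u -> dom A v ->
       hnorm u ^+ 2 + hnorm v ^+ 2 <=
       M ^+ 2 / (x ^+ 2 + y ^+ 2) *
       (hnorm ((a0 + x) *: u - y *: v - A u) ^+ 2 +
        hnorm ((a0 + x) *: v + y *: u - A v) ^+ 2))]].

(* S is the nonnegative self-adjoint operator with S^2 = A, domains included. *)
Definition is_sqrt_of S A : Prop :=
  [/\ self_adjoint S, (forall u, dom S u -> 0 <= ip (S u) u) &
      forall u w, [/\ dom S u, dom S (S u) & S (S u) = w] <->
                  (dom A u /\ A u = w)].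

Definition op_shift (beta : R) A : operator :=
  Operator (dom A) (fun u => beta *: u + A u).

Definition op_comp A (B : operator) : operator :=
  Operator [set u | dom B u /\ dom A (B u)] (fun u => A (B u)).

Definition op_scale (a : R) A : operator :=
  Operator (dom A) (fun u => a *: A u).

(* A signed set function nu is a finite signed measure exactly when it is the
   difference of two finite measures; the integral of h against nu does not
   depend on the decomposition. *)
Definition decomposes (nu : set (measurableTypeR R) -> R)
    (m1 m2 : {finite_measure set (measurableTypeR R) -> \bar R}) : Prop :=
  forall B : set (measurableTypeR R), measurable B ->
    (nu B)%:E = (m1 B - m2 B)%E.

Definition signed_integral (nu : set (measurableTypeR R) -> R) (h : R -> R)
    (I : R) : Prop :=
  exists m1 m2 : {finite_measure set (measurableTypeR R) -> \bar R},
    [/\ decomposes nu m1 m2,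
        m1.-integrable setT (EFin \o h), m2.-integrable setT (EFin \o h) &
        I = \int[m1]_x h x - \int[m2]_x h x].

(* A (not necessarily orthogonal) projection-valued measure on the real line. *)
Definition projection_measure (P : set (measurableTypeR R) -> H -> H) : Prop :=
  [/\ forall B, measurable B -> linear (P B),
      exists M : R, forall B, measurable B ->
        forall u, hnorm (P B u) <= M * hnorm u,
      forall u, P setT u = u,
      forall B C, measurable B -> measurable C ->
        forall u, P (B `&` C) u = P B (P C u) &
      forall u v, exists m1 m2, decomposes (fun B => ip (P B u) v) m1 m2].

(* w is the integral of h(z) P(dz) u, in the weak sense. *)
Definition spectral_integral (P : set (measurableTypeR R) -> H -> H)
    (h : R -> R) u w : Prop :=
  forall v, signed_integral (fun B => ip (P B u) v) h (ip w v).

(* A = int z P(dz), domains included: A is a scalar-type spectral operator in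
   the sense of Dunford, with real spectrum, and P is its resolution of the
   identity. If A is self-adjoint, this is its spectral decomposition. *)
Definition spectral_resolution A P : Prop :=
  projection_measure P /\
  forall u w, (dom A u /\ A u = w) <-> spectral_integral P id u w.

(* h(A) = int h(z) P(dz), on the domain where the integral exists in H. *)
Definition functional_calculus P (h : R -> R) : operator :=
  Operator [set u | exists w, spectral_integral P h u w]
           (fun u => xget 0 [set w | spectral_integral P h u w]).

(* Nf is the operator u |-> f(u), where f acts pointwise. *)
Definition acts_pointwise (f : R -> R) (Nf : H -> H) : Prop :=
  forall u, {ae lam, forall x, Omega x -> ev (Nf u) x = f (ev u x)}.

Definition energy (sqrtL : operator) (F : R -> R) u : R :=
  \int[lam]_(x in Omega) (2^-1 * ev (sqrtL u) x ^+ 2 + F (ev u x)).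

End Operators.

Section Scheme.
Context (R : realType).

(* All indices of stages and coefficients start at 1, as in v_1, ..., v_s;
   only the values c i (1 <= i <= s), a i j (1 <= j < i <= s) and
   b j (1 <= j <= s) are used. *)

Definition preserves_equilibria (s : nat) (c : nat -> R)
    (a : nat -> nat -> R -> R) (b : nat -> R -> R) : Prop :=
  forall z : R, z < 0 ->
    \sum_(1 <= j < s.+1) b j z = (expR z - 1) / z /\
    forall i, (2 <= i <= s)%N ->
      \sum_(1 <= j < i) a i j z = (expR (c i * z) - 1) / z.

(* Row i of the matrix (i : 'I_s is zero-based) holds the coefficients
   a_(i+2, j), and the last row those of b. *)
Definition Pmx (s : nat) (a : nat -> nat -> R -> R) (b : nat -> R -> R)
    (z : R) : 'M[R]_s :=
  \matrix_(i, j) if i.+1 == s then b j.+1 z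
                 else if (j <= i)%N then a i.+2 j.+1 z else 0.

Definition ELmx (s : nat) : 'M[R]_s := \matrix_(i, j) (j <= i)%N%:R.

Definition Deltamx (s : nat) (a : nat -> nat -> R -> R) (b : nat -> R -> R)
    (z : R) : 'M[R]_s :=
  z *: ELmx s + invmx (Pmx s a b z) *m ELmx s - (z / 2)%:M.

Definition positive_definite_mx (s : nat) (D : 'M[R]_s) : Prop :=
  forall r : R, eigenvalue (2^-1 *: (D + D^T)) r -> 0 < r.

Context (d : nat) (lam : {measure set (borel_space R d) -> \bar R})
  (Omega : set 'rV[R]_d) (H : function_space lam Omega).
Variables (G sqrtL : operator H) (g : H -> H) (tau : R).
Variables (s : nat) (c : nat -> R) (a : nat -> nat -> R -> R) (b : nat -> R -> R).
(* P is the resolution of the identity of tau G L, so that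
   functional_calculus P h is h(tau G L). *)
Variable P : set (measurableTypeR R) -> H -> H.
Local Notation calc := (functional_calculus P).

(* The operators are applied inside their domains, and the energy is finite at
   un, at the stages v i and at un1. *)
Definition etdrk_well_defined (un : H) (v : nat -> H) (un1 : H) : Prop :=
  [/\ forall j, (1 <= j <= s)%N -> dom G (g (v j)),
      forall i, (2 <= i <= s)%N -> dom (calc (fun z => expR (c i * z))) un /\
        forall j, (1 <= j < i)%N -> dom (calc (a i j)) (G (g (v j))),
      dom (calc expR) un,
      forall j, (1 <= j <= s)%N -> dom (calc (b j)) (G (g (v j))) &
      [/\ dom sqrtL un, forall i, (1 <= i <= s)%N -> dom sqrtL (v i) &
          dom sqrtL un1]].

Definition etdrk_step (un : H) (v : nat -> H) (un1 : H) : Prop :=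
  [/\ v 1%N = un,
      forall i, (2 <= i <= s)%N ->
        v i = calc (fun z => expR (c i * z)) un
              - tau *: \sum_(1 <= j < i) calc (a i j) (G (g (v j))) &
      un1 = calc expR un
            - tau *: \sum_(1 <= j < s.+1) calc (b j) (G (g (v j)))].

End Scheme.

(* Main.v *)
Require Import Defs.
From HB Require Import structures.
From mathcomp Require Import all_boot all_order all_algebra.
From mathcomp Require Import all_classical all_reals all_analysis.
From mathcomp Require Import measurable_realfun.
From mathcomp Require Import ring lra.

Set Implicit Arguments.
Unset Strict Implicit.
Unset Printing Implicit Defensive.

Import Order.TTheory GRing.Theory Num.Theory.
Import numFieldNormedType.Exports.

Local Open Scope classical_set_scope.
Local Open Scope ring_scope.

(** Put [L = beta + LL] and [K = (- G)^-1], a bounded operator. For the inner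
    product [<x, y> = (K x, y)] the generator [A = tau G L] is symmetric, and
    [<A x, y> = - tau q(x, y)] with the energy form
    [q(x, y) = beta (x, y) + (S x, S y)], [S] being the square root of [LL].

    Let [w_0 = u_n], [w_1], ..., [w_s = u_(n+1)] be the stages. The energy change
    of the step is the sum of the changes from [w_i] to [w_(i+1)]. Because [f] is
    Lipschitz and [beta >= C_L], [energy_increment] bounds each of these, with
    [d_i = w_(i+1) - w_i], by
      [q(w_(i+1), d_i) - q(d_i, d_i) / 2 - (g(w_i), d_i)].
    Let [r_i = G (g(w_i))]; then [(g(w_i), d_i) = - <r_i, d_i>], and the sum of the
    bounds is [- 1/tau] times the sum of
      [<A w_(i+1) - A d_i / 2 - tau r_i, d_i>].
    The consistency of the coefficients says that equilibria are preserved; it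
    turns the scheme into [w_i - w_0 = sum_j p_ij(A) rho_j], where the vectors
    [rho_j = A w_0 - tau r_j] are the residuals [tau G (L u_n - g(w_j))]. In terms
    of the residuals the first entry above is
      [A (w_(i+1) - w_0) + rho_i - A d_i / 2],
    so the sum is a quadratic form in the residuals whose coefficients are
    functions of [A]. At a point [z] of the spectrum, with scalars [t_j] for the
    residuals, [y = P(z) t] and [d] the successive differences of [y], the form is
    the scalar product of [z E_L d + t - (z/2) d] with [d]. Since [E_L d = P(z) t],
    this is [d^T Delta(z) d], which is nonnegative for [z < 0]
    ([stage_pointwise_ge0]). A matrix of functions that is pointwise positive
    semidefinite defines a nonnegative form on tuples of vectors through the
    functional calculus: one completes squares with functions of [A]
    ([calculus_coercive_ge0], [calculus_semidefinite_ge0], [stage_form_ge0]).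

    Two points need care. First, the functional calculus comes from a projection
    measure [P] with integral [A], and its projections might a priori be oblique.
    They are symmetric for [<x, y>]: the ranges of an interval and of a set at a
    positive distance from it are orthogonal, because moving powers of [A - m]
    from one side to the other gains an arbitrarily small factor
    ([proj_separated_orthogonal]), and intervals generate the Borel sets
    ([all_proj_symmetric]). As [A] is negative, [P] lives on the negative axis
    ([proj_nonneg_eq0]). Second, the coefficients and [A] are unbounded. The
    argument is therefore made after projecting onto a part [B] of the negative
    axis on which [z] and all the coefficients are bounded
    ([truncated_stages_ge0]); there only bounded functions of [A] occur. Such
    parts exhaust the negative axis, and the projections of vectors in the domain
    of [S] converge weakly in the energy form ([energy_form_cvg]), so the
    inequality passes to the limit. *)

(** * Integration and the Hilbert space *)

(** The monotonicity of almost-everywhere statements, in a form that applies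
    when the points are typed as vectors and the measure lives on the Borel
    space of these vectors: unification does not see through the latter. *)
Lemma ae_mono d (T : measurableType d) (R : realType)
    (mu : {measure set T -> \bar R}) (A B : T -> Prop) :
  (forall x, A x -> B x) -> {ae mu, forall x, A x} -> {ae mu, forall x, B x}.
Proof. by move=> AB; apply: filterS. Qed.

Lemma ae_and d (T : measurableType d) (R : realType)
    (mu : {measure set T -> \bar R}) (A B : T -> Prop) :
  {ae mu, forall x, A x} -> {ae mu, forall x, B x} ->
  {ae mu, forall x, A x /\ B x}.
Proof. by apply: filterS2. Qed.

Lemma ae_eq_Rintegral d (T : measurableType d) (R : realType)
    (mu : {measure set T -> \bar R}) (D : set T) (f g : T -> R) :
    measurable D -> measurable_fun D f -> measurable_fun D g ->
    {ae mu, forall x, D x -> f x = g x} ->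
  \int[mu]_(x in D) f x = \int[mu]_(x in D) g x.
Proof.
move=> mD mf mg fg; rewrite /Rintegral; congr fine.
apply: ae_eq_integral => //.
- by apply/measurable_EFinP; exact: mf.
- by apply/measurable_EFinP; exact: mg.
- by move: fg; apply: filterS => t ft Dt; rewrite ft.
Qed.

Section RealIntegrable.
Context d (T : measurableType d) (R : realType)
  (mu : {measure set T -> \bar R}) (D : set T) (mD : measurable D).
Implicit Types f g : T -> R.

Local Notation rint f := (mu.-integrable D (EFin \o f)).

Lemma rintegrableZ k f : rint f -> rint (fun x => k * f x).
Proof. by move=> fi; exact: (integrableZl mD k fi). Qed.

Lemma rintegrableD f g : rint f -> rint g -> rint (fun x => f x + g x).
Proof. by move=> fi gi; exact: (integrableD mD fi gi). Qed.

Lemma le_rintegrable f g : measurable_fun D f ->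
  (forall x, D x -> `|f x| <= g x) -> rint g -> rint f.
Proof.
move=> mf fg gi; apply: le_integrable gi => //.
  by apply/measurable_EFinP; exact: mf.
move=> t Dt; rewrite lee_fin; apply: le_trans (fg t Dt) _.
exact: ler_norm.
Qed.

Lemma rintegrable_measurable f : rint f -> measurable_fun D f.
Proof. by move=> /measurable_int/measurable_EFinP. Qed.

Lemma ae_eq_rintegrable f g : measurable_fun D g ->
  {ae mu, forall x, D x -> f x = g x} -> rint f -> rint g.
Proof.
move=> mg fg /integrableP[mf fi]; apply/integrableP; split.
  by apply/measurable_EFinP; exact: mg.
have -> : (\int[mu]_(x in D) `|(EFin \o g) x| =
          \int[mu]_(x in D) `|(EFin \o f) x|)%E; last exact: fi.
apply: ae_eq_integral => //.
- by apply: measurableT_comp => //; apply/measurable_EFinP; exact: mg.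
- exact: measurableT_comp.
- by move: fg; apply: filterS => t ft Dt /=; rewrite ft.
Qed.

End RealIntegrable.

Section InnerProduct.
Context (R : realType) (d : nat)
  (lam : {measure set (borel_space R d) -> \bar R}) (Omega : set 'rV[R]_d)
  (mO : measurable (Omega : set (borel_space R d)))
  (H : function_space lam Omega).
Implicit Types (x y z : H) (a : R).

Local Notation ip := (@ip R d lam Omega H).
Local Notation hnorm := (@hnorm R d lam Omega H).

Let mev x : measurable_fun (Omega : set (borel_space R d)) (ev x).
Proof. exact: ev_measurable. Qed.

Lemma ip_integrable x y :
  lam.-integrable Omega (EFin \o (fun t => ev x t * ev y t)).
Proof.
have h1 := ev_square_integrable x; have h2 := ev_square_integrable y.
apply: (le_rintegrable mO _ _ (rintegrableD mO h1 h2)).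
  by apply: measurable_funM; exact: mev.
by move=> t Ot; rewrite ler_norml; apply/andP; split; nra.
Qed.

Lemma ip_linear a x y z : ip (a *: x + y) z = a * ip x z + ip y z.
Proof.
rewrite /Defs.ip -RintegralZl //; last exact: ip_integrable.
rewrite -RintegralD //; last 2 first.
- by apply: rintegrableZ => //; exact: ip_integrable.
- exact: ip_integrable.
apply: ae_eq_Rintegral => //.
- by apply: measurable_funM; exact: mev.
- apply: measurable_funD; last by apply: measurable_funM; exact: mev.
  by apply: measurable_funM => //; apply: measurable_funM; exact: mev.
- apply: (ae_mono (mu := lam) _ (ev_linear a x y)) => t ht Ot.
  by rewrite ht // mulrDl mulrA.
Qed.

Lemma ipC x y : ip x y = ip y x.
Proof. by rewrite /Defs.ip; under eq_Rintegral do rewrite mulrC. Qed.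

Lemma ip_ge0 x : 0 <= ip x x.
Proof. by apply: Rintegral_ge0 => t _; rewrite -expr2 sqr_ge0. Qed.

Lemma ip_eq0 x : ip x x = 0 -> x = 0.
Proof.
move=> x0; apply: ev_injective.
have hi := ip_integrable x x.
have fn : (\int[lam]_(t in Omega) (ev x t * ev x t)%:E)%E \is a fin_num.
  exact: integrable_fin_num.
have := fineK fn; rewrite [fine _]x0 => /esym i0.
have : (\int[lam]_(t in Omega) `|(ev x t * ev x t)%:E|)%E = 0%E.
  rewrite -[RHS]i0; apply: eq_integral => t _ /=.
  by rewrite ger0_norm // -expr2 sqr_ge0.
move/(ae_eq_integral_abs lam mO (measurable_int _ hi)).
apply: (ae_mono (mu := lam)) => t h Ot; have := h Ot => -[] /eqP.
by rewrite mulf_eq0 orbb => /eqP.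
Qed.

Lemma ipDl x y z : ip (x + y) z = ip x z + ip y z.
Proof. by have := ip_linear 1 x y z; rewrite scale1r mul1r. Qed.

Lemma ip0l z : ip 0 z = 0.
Proof.
by have := ipDl 0 0 z; rewrite addr0 -{1}[ip 0 z]addr0 => /addrI/esym.
Qed.

Lemma ipZl a x z : ip (a *: x) z = a * ip x z.
Proof. by have := ip_linear a x 0 z; rewrite addr0 ip0l addr0. Qed.

Lemma ipNl x z : ip (- x) z = - ip x z.
Proof. by rewrite -scaleN1r ipZl mulN1r. Qed.

Lemma ipBl x y z : ip (x - y) z = ip x z - ip y z.
Proof. by rewrite ipDl ipNl. Qed.

Lemma ip0r z : ip z 0 = 0. Proof. by rewrite ipC ip0l. Qed.

Lemma ipDr x y z : ip z (x + y) = ip z x + ip z y.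
Proof. by rewrite !(ipC z) ipDl. Qed.

Lemma ipZr a x z : ip z (a *: x) = a * ip z x.
Proof. by rewrite !(ipC z) ipZl. Qed.

Lemma ipNr x z : ip z (- x) = - ip z x.
Proof. by rewrite !(ipC z) ipNl. Qed.

Lemma ipBr x y z : ip z (x - y) = ip z x - ip z y.
Proof. by rewrite ipDr ipNr. Qed.

Lemma ip_suml (I : Type) (r : seq I) (Q : pred I) (F : I -> H) z :
  ip (\sum_(i <- r | Q i) F i) z = \sum_(i <- r | Q i) ip (F i) z.
Proof. by apply: (big_morph (ip^~ z)) => [x y|]; rewrite ?ipDl ?ip0l. Qed.

Lemma ip_sumr (I : Type) (r : seq I) (Q : pred I) (F : I -> H) z :
  ip z (\sum_(i <- r | Q i) F i) = \sum_(i <- r | Q i) ip z (F i).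
Proof. by apply: (big_morph (ip z)) => [x y|]; rewrite ?ipDr ?ip0r. Qed.

Lemma ip_inj x y : (forall z, ip x z = ip y z) -> x = y.
Proof.
move=> xy; apply/eqP; rewrite -subr_eq0; apply/eqP/ip_eq0.
by rewrite ipBl xy subrr.
Qed.

Lemma hnorm_ge0 x : 0 <= hnorm x. Proof. exact: sqrtr_ge0. Qed.

Lemma hnorm_sqr x : hnorm x ^+ 2 = ip x x.
Proof. by rewrite sqr_sqrtr // ip_ge0. Qed.

Lemma hnorm0 : hnorm 0 = 0.
Proof. by rewrite /Defs.hnorm ip0l sqrtr0. Qed.

Lemma hnorm_eq0 x : hnorm x = 0 -> x = 0.
Proof. by move=> x0; apply: ip_eq0; rewrite -hnorm_sqr x0 expr0n. Qed.

Lemma hnormZ a x : hnorm (a *: x) = `|a| * hnorm x.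
Proof.
by rewrite /Defs.hnorm ipZl ipZr mulrA -expr2 sqrtrM ?sqr_ge0 // sqrtr_sqr.
Qed.

Lemma hnormN x : hnorm (- x) = hnorm x.
Proof. by rewrite -scaleN1r hnormZ normrN1 mul1r. Qed.

Lemma hnorm_distC x y : hnorm (x - y) = hnorm (y - x).
Proof. by rewrite -hnormN opprB. Qed.

Lemma cauchy_schwarz x y : `|ip x y| <= hnorm x * hnorm y.
Proof.
have [y0|y0] := eqVneq (ip y y) 0.
  by rewrite (ip_eq0 y0) ip0r normr0 mulr_ge0 ?hnorm_ge0.
have yy : 0 < ip y y by rewrite lt_neqAle eq_sym y0 ip_ge0.
have := ip_ge0 (ip y y *: x - ip x y *: y).
rewrite ipBl !ipBr !ipZl !ipZr (ipC y x) => h.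
have h2 : 0 <= ip y y * (ip x x * ip y y - ip x y ^+ 2) by lra.
rewrite pmulr_rge0 // subr_ge0 in h2.
rewrite -(@ler_pXn2r _ 2) ?nnegrE ?mulr_ge0 ?hnorm_ge0 //.
by rewrite exprMn !hnorm_sqr real_normK // num_real.
Qed.

Lemma ip_le x y : ip x y <= hnorm x * hnorm y.
Proof. exact: le_trans (ler_norm _) (cauchy_schwarz x y). Qed.

Lemma hnormD x y : hnorm (x + y) <= hnorm x + hnorm y.
Proof.
rewrite -(@ler_pXn2r _ 2) ?nnegrE ?addr_ge0 ?hnorm_ge0 //.
rewrite sqrrD !hnorm_sqr ipDl !ipDr (ipC y x).
by have := ip_le x y; lra.
Qed.

Lemma hnormB x y : hnorm (x - y) <= hnorm x + hnorm y.
Proof. by rewrite -(hnormN y) hnormD. Qed.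

Lemma hnorm_triangle z x y : hnorm (x - y) <= hnorm (x - z) + hnorm (z - y).
Proof. by have := hnormD (x - z) (z - y); rewrite addrA subrK. Qed.

Lemma hnorm_eps_eq x y (C : R) :
  (forall e, 0 < e -> hnorm (x - y) <= C * e) -> x = y.
Proof.
move=> h; apply/eqP; rewrite -subr_eq0; apply/eqP/hnorm_eq0.
apply/eqP; rewrite eq_le hnorm_ge0 andbT.
apply/ler_addgt0Pr => e e0; rewrite add0r.
have C0 : 0 <= C.
  by have := le_trans (hnorm_ge0 _) (h 1 ltr01); rewrite mulr1.
have C1 : 0 < C + 1 by rewrite ltr_wpDl.
apply: le_trans (h (e / (C + 1)) _) _; first exact: divr_gt0.
rewrite mulrCA ler_piMr ?(ltW e0) //.
by rewrite ler_pdivrMr // mul1r lerDl.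
Qed.

Lemma hilbert_complete (w : nat -> H) :
  (forall e : R, 0 < e -> exists N : nat, forall m n : nat,
     (N <= m)%N -> (N <= n)%N -> hnorm (w m - w n) < e) ->
  exists l : H, forall e : R, 0 < e -> exists N : nat,
    forall n : nat, (N <= n)%N -> hnorm (w n - l) < e.
Proof.
have E x : L2norm lam Omega (ev x) = hnorm x.
  by rewrite /L2norm /Defs.hnorm /Defs.ip; under eq_Rintegral do rewrite expr2.
move=> h; have [|l hl] := @space_complete _ _ _ _ H w.
  move=> e e0; have [N hN] := h e e0; exists N => m n Nm Nn.
  by rewrite E; exact: hN.
exists l => e e0; have [N hN] := hl e e0; exists N => n Nn.
by rewrite -E; exact: hN.
Qed.

End InnerProduct.

Lemma open_borel (R : realType) (d : nat) (Omega : set 'rV[R]_d) :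
  open Omega -> measurable (Omega : set (borel_space R d)).
Proof. by move=> oO; apply: sub_sigma_algebra. Qed.

(** * Bounded functions and differences of finite measures *)

Section BoundedFunctions.
Context d (T : measurableType d) (R : realType).
Implicit Types (h k : T -> R) (B : set T).

Definition bounded_measurable h : Prop :=
  measurable_fun setT h /\ exists C : R, forall z, `|h z| <= C.

Local Notation bm := bounded_measurable.

Lemma bm_cst (a : R) : bm (fun=> a).
Proof. by split; [exact: measurable_cst | exists `|a|]. Qed.

Lemma bm_add h k : bm h -> bm k -> bm (fun z => h z + k z).
Proof.
move=> [mh [C hC]] [mk [D kD]]; split; first exact: measurable_funD.
by exists (C + D) => z; rewrite (le_trans (ler_normD _ _)) // lerD.
Qed.

Lemma bm_mul h k : bm h -> bm k -> bm (fun z => h z * k z).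
Proof.
move=> [mh [C hC]] [mk [D kD]]; split; first exact: measurable_funM.
by exists (C * D) => z; rewrite normrM ler_pM.
Qed.

Lemma bm_scale a h : bm h -> bm (fun z => a * h z).
Proof. by move=> hh; apply: bm_mul => //; exact: bm_cst. Qed.

Lemma bm_opp h : bm h -> bm (fun z => - h z).
Proof.
by move=> /(bm_scale (-1)); under eq_fun do rewrite mulN1r.
Qed.

Lemma bm_sub h k : bm h -> bm k -> bm (fun z => h z - k z).
Proof. by move=> hh hk; apply: bm_add => //; exact: bm_opp. Qed.

Lemma bm_indic B : measurable B -> bm (\1_B : T -> R).
Proof.
move=> mB; split; first exact: measurable_indic.
by exists 1 => z; rewrite indicE; case: (_ \in _); rewrite ?normr1 ?normr0.
Qed.

Lemma bm_indic_bounded B h (c : R) : measurable B ->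
  measurable_fun setT h -> 0 <= c ->
  (forall z, B z -> `|h z| <= c) -> bm (fun z => \1_B z * h z).
Proof.
move=> mB mh c0 hc; split; first by apply: measurable_funM.
exists c => z; rewrite indicE; case: (boolP (z \in B)); rewrite ?inE => zB.
  by rewrite mul1r hc.
by rewrite mul0r normr0.
Qed.

Lemma bm_indicM B h : measurable B -> bm h -> bm (fun z => \1_B z * h z).
Proof. by move=> mB hh; apply: bm_mul => //; exact: bm_indic. Qed.

Lemma bm_sum (I : Type) (r : seq I) (F : I -> T -> R) :
  (forall i, bm (F i)) -> bm (fun z => \sum_(i <- r) F i z).
Proof.
move=> hF; elim: r => [|i r ih].
  by under eq_fun do rewrite big_nil; exact: bm_cst.
by under eq_fun do rewrite big_cons; exact: bm_add.
Qed.

Lemma bm_integrable (m : {finite_measure set T -> \bar R}) h :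
  bm h -> m.-integrable setT (EFin \o h).
Proof.
move=> [mh [C hC]]; apply: measurable_bounded_integrable => //.
  by rewrite -ge0_fin_numE // fin_num_measure.
exists C; split; first exact: num_real.
by move=> x Cx z _; exact: le_trans (hC z) (ltW Cx).
Qed.

(** A bounded function is within [e] of a simple function: cut its range into
    finitely many cells of length [e]. *)
Lemma simple_approx h (e : R) : bm h -> 0 < e ->
  exists n (t : nat -> R) (C : nat -> set T),
    (forall j, measurable (C j)) /\
    forall z, `|h z - \sum_(j < n) t j * \1_(C j) z| <= e.
Proof.
move=> [mh [M hM]] e0.
pose y z := (h z + M) / e.
have y0 z : 0 <= y z.
  rewrite divr_ge0 ?(ltW e0) //; have := hM z.
  by rewrite ler_norml => /andP[]; lra.
have my : measurable_fun setT y.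
  by apply: measurable_funM => //; apply: measurable_funD.
pose C j := [set z | j%:R <= y z < j.+1%:R].
exists (Num.truncn (2 * M / e)).+1, (fun j => - M + j%:R * e), C; split.
  move=> j; have -> : C j = y @^-1` `[j%:R, j.+1%:R[.
    by apply/seteqP; split=> z; rewrite /C /= in_itv.
  by rewrite -[X in measurable X]setTI; exact: my.
move=> z; pose i := Num.truncn (y z).
have iy : i%:R <= y z < i.+1%:R by exact: truncn_itv.
have lti : (i < (Num.truncn (2 * M / e)).+1)%N.
  rewrite ltnS truncn_ge_nat; last first.
    by rewrite divr_ge0 ?(ltW e0) // mulr_ge0 // (le_trans _ (hM z)).
  apply: le_trans (proj1 (andP iy)) _; rewrite ler_pM2r ?invr_gt0 //.
  by have := hM z; rewrite ler_norml => /andP[]; lra.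
rewrite (bigD1 (Ordinal lti)) //= big1 ?addr0; last first.
  move=> j ji; rewrite indicE memNset ?mulr0 // => Ckz.
  move/negP: ji; apply; apply/eqP/val_inj => /=.
  by rewrite -(truncn_def Ckz).
rewrite indicE mem_set // mulr1.
have yE : h z = y z * e - M by rewrite /y divfK ?gt_eqF // addrK.
rewrite yE; move: iy => /andP[i1]; rewrite -natr1 => i2.
rewrite ler_norml; apply/andP; split; nra.
Qed.

(** On a set where [m1] dominates [m2], integrating the nonnegative functions
    [c + h] and [c - h] against both measures bounds the integral of [h] against
    [m1 - m2]. *)
Lemma dominated_dint_bound (m1 m2 : {finite_measure set T -> \bar R}) D h
    (c : R) : measurable D ->
  (forall A, measurable A -> A `<=` D -> (m2 A <= m1 A)%E) ->
  bm h -> (forall z, `|h z| <= c) ->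
  `|\int[m1]_(x in D) h x - \int[m2]_(x in D) h x| <=
    c * (fine (m1 D) - fine (m2 D)).
Proof.
move=> mD m12 hh hc.
have iD (m : {finite_measure set T -> \bar R}) f :
    bm f -> m.-integrable D (EFin \o f).
  by move=> bf; apply: (@integrableS _ _ _ _ setT) => //; exact: bm_integrable.
have rD (m : {measure set T -> \bar R}) f :
    (\int[mrestr m mD]_(x in D) f x = \int[m]_(x in D) f x)%E.
  by apply: eq_measure_integral => A mA /setIidl AD; rewrite -[in RHS]AD.
have mono f : bm f -> (forall z, 0 <= f z) ->
    \int[m2]_(x in D) f x <= \int[m1]_(x in D) f x.
  move=> bf f0; rewrite /Rintegral fine_le ?integrable_fin_num //.
  - exact: iD.
  - exact: iD.
  rewrite -(rD m1) -(rD m2); apply: ge0_le_measure_integral => //.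
  - by move=> S mS; rewrite /mrestr m12 //; exact: measurableI.
  - by apply/measurable_EFinP; exact: (proj1 bf).
have bc : bm (fun=> c) by exact: bm_cst.
have h1 : 0 <= \int[m1]_(x in D) (c + h x) - \int[m2]_(x in D) (c + h x).
  rewrite subr_ge0; apply: mono; first exact: bm_add.
  by move=> z; have := hc z; rewrite ler_norml => /andP[]; lra.
have h2 : 0 <= \int[m1]_(x in D) (c - h x) - \int[m2]_(x in D) (c - h x).
  rewrite subr_ge0; apply: mono; first exact: bm_sub.
  by move=> z; have := hc z; rewrite ler_norml => /andP[]; lra.
rewrite (RintegralD mD (iD m1 _ bc) (iD m1 _ hh)) in h1.
rewrite (RintegralD mD (iD m2 _ bc) (iD m2 _ hh)) !Rintegral_cst // in h1.
rewrite (RintegralB mD (iD m1 _ bc) (iD m1 _ hh)) in h2.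
rewrite (RintegralB mD (iD m2 _ bc) (iD m2 _ hh)) !Rintegral_cst // in h2.
by rewrite ler_norml; apply/andP; split; lra.
Qed.

Section FiniteSigned.
Variables m1 m2 : {finite_measure set T -> \bar R}.

Definition dint h : R := \int[m1]_x h x - \int[m2]_x h x.

Lemma dintD h k : bm h -> bm k -> dint (fun z => h z + k z) = dint h + dint k.
Proof. by move=> hh hk; rewrite /dint !RintegralD ?bm_integrable //; ring. Qed.

Lemma dintZ a h : bm h -> dint (fun z => a * h z) = a * dint h.
Proof. by move=> hh; rewrite /dint !RintegralZl ?bm_integrable //; ring. Qed.

Lemma dint_indic B : measurable B -> dint (\1_B) = fine (m1 B) - fine (m2 B).
Proof.
by move=> mB; rewrite /dint /Rintegral !integral_indic // !setIT.
Qed.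

(** The Hahn decomposition cuts the space into two sets on each of which one of
    the measures dominates the other. *)
Lemma dint_bound (K c : R) h :
  (forall B, measurable B -> `|fine (m1 B) - fine (m2 B)| <= K) ->
  0 <= c -> bm h -> (forall z, `|h z| <= c) -> `|dint h| <= 2 * c * K.
Proof.
move=> hK c0 hh hc.
pose nu : {charge set T -> \bar R} :=
  cadd (charge_of_finite_measure m1) (copp (charge_of_finite_measure m2)).
have nuE A : nu A = (m1 A - m2 A)%E by [].
have [Q [N [[mQ hQ] [mN hN] QNT QN0]]] := Hahn_decomposition nu.
have fin (m : {finite_measure set T -> \bar R}) A :
    measurable A -> m A \is a fin_num by exact: fin_num_measure.
have b1 : `|\int[m1]_(x in Q) h x - \int[m2]_(x in Q) h x| <= c * K.
  apply: le_trans (dominated_dint_bound mQ _ hh hc) _.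
    by move=> A mA AQ; have := hQ A mA AQ; rewrite nuE sube_ge0 // fin.
  by rewrite ler_wpM2l // (le_trans _ (hK Q mQ)) // ler_norm.
have b2 : `|\int[m1]_(x in N) h x - \int[m2]_(x in N) h x| <= c * K.
  rewrite distrC; apply: le_trans (dominated_dint_bound mN _ hh hc) _.
    by move=> A mA AN; have := hN A mA AN; rewrite nuE sube_le0 // fin.
  by rewrite ler_wpM2l // (le_trans _ (hK N mN)) // distrC ler_norm.
have dec (m : {finite_measure set T -> \bar R}) :
    \int[m]_x h x = \int[m]_(x in Q) h x + \int[m]_(x in N) h x.
  rewrite -QNT Rintegral_setU // ?QNT; first exact: bm_integrable.
  by apply/disj_setPS; rewrite QN0.
rewrite /dint !dec; move: b1 b2.
rewrite !ler_norml => /andP[? ?] /andP[? ?]; apply/andP; split; lra.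
Qed.

End FiniteSigned.

End BoundedFunctions.

Section RestrictedMeasure.
Context d (T : measurableType d) (R : realType).
Implicit Types (f : T -> R).

Lemma integral_mrestr (m : {measure set T -> \bar R}) (B : set T)
    (mB : measurable B) f : measurable_fun setT f ->
  (\int[mrestr m mB]_x (f x)%:E = \int[m]_(x in B) (f x)%:E)%E.
Proof.
move=> mf; rewrite -(setUv B) integral_setU_EFin //.
- rewrite [X in (_ + X)%E](_ : _ = 0%E).
    rewrite adde0; apply: eq_measure_integral => A mA /setIidl AB.
    by rewrite -[in RHS]AB.
  rewrite -[RHS](@integral_measure_zero _ T R (~` B) (fun x => (f x)%:E)).
  apply: eq_measure_integral => A mA AB; rewrite /= /mrestr.
  have -> : A `&` B = set0 by apply/disjoints_subset.
  by rewrite measure0.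
- exact: measurableC.
- by rewrite setUv.
- by apply/disj_setPS; rewrite setICr.
Qed.

(** If the difference of two measures vanishes off [B], so does the difference
    of their integrals. *)
Lemma dint_restrict (m1 m2 : {finite_measure set T -> \bar R}) (B : set T) f :
  measurable B ->
  (forall A, measurable A -> A `<=` ~` B -> m1 A = m2 A) ->
  m1.-integrable setT (EFin \o f) -> m2.-integrable setT (EFin \o f) ->
  dint m1 m2 f = dint m1 m2 (fun z => \1_B z * f z).
Proof.
move=> mB m12 i1 i2.
have dec (m : {finite_measure set T -> \bar R}) :
    m.-integrable setT (EFin \o f) ->
    \int[m]_x f x = \int[m]_x (\1_B x * f x) + \int[m]_(x in ~` B) f x.
  move=> im; rewrite -[in LHS](setUv B) Rintegral_setU //.
  - congr (_ + _); rewrite Rintegral_mkcond; apply: eq_Rintegral => z _.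
    by rewrite /patch indicE; case: (_ \in B); rewrite ?mul1r ?mul0r.
  - exact: measurableC.
  - by rewrite setUv.
  - by apply/disj_setPS; rewrite setICr.
rewrite /dint (dec m1 i1) (dec m2 i2).
have -> : \int[m1]_(x in ~` B) f x = \int[m2]_(x in ~` B) f x.
  congr fine; apply: eq_measure_integral => A mA AB; exact: m12.
ring.
Qed.

End RestrictedMeasure.

Section SignedIntegral.
Context (R : realType).
Local Notation T := (measurableTypeR R).
Implicit Types (nu : set T -> R) (m n : {finite_measure set T -> \bar R}).

Lemma decomposes_val nu m1 m2 B : decomposes nu m1 m2 -> measurable B ->
  nu B = fine (m1 B) - fine (m2 B).
Proof.
move=> dec mB; rewrite -fineB ?fin_num_measure //.
by rewrite -(dec B mB).
Qed.

(** If [m1 - m2 = n1 - n2] as set functions then [m1 + n2 = n1 + m2] as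
    measures, and the integral is additive in the measure. *)
Lemma dint_indep nu m1 m2 n1 n2 (h : R -> R) :
  decomposes nu m1 m2 -> decomposes nu n1 n2 ->
  m1.-integrable setT (EFin \o h) -> m2.-integrable setT (EFin \o h) ->
  n1.-integrable setT (EFin \o h) -> n2.-integrable setT (EFin \o h) ->
  dint m1 m2 h = dint n1 n2 h.
Proof.
move=> dm dn i1 i2 j1 j2.
have mh : measurable_fun setT (EFin \o h) by exact: measurable_int i1.
have E : (\int[measure_add m1 n2]_x (EFin \o h) x =
          \int[measure_add n1 m2]_x (EFin \o h) x)%E.
  apply: eq_measure_integral => A mA _.
  rewrite [LHS]measure_addE [RHS]measure_addE.
  have E1 := decomposes_val dm mA; have E2 := decomposes_val dn mA.
  have f1 := fin_num_measure m1 A mA; have f2 := fin_num_measure m2 A mA.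
  have g1 := fin_num_measure n1 A mA; have g2 := fin_num_measure n2 A mA.
  have fK (a b c e : \bar R) : a \is a fin_num -> b \is a fin_num ->
      c \is a fin_num -> e \is a fin_num ->
      fine a - fine b = fine c - fine e -> (a + e = c + b)%E.
    move=> /fineK <- /fineK <- /fineK <- /fineK <- /= abce.
    by rewrite -!EFinD; congr EFin; lra.
  by apply: fK => //; rewrite -E1.
rewrite !integral_measure_add // in E.
have fK (a b c e : \bar R) : a \is a fin_num -> b \is a fin_num ->
    c \is a fin_num -> e \is a fin_num ->
    (a + e = c + b)%E -> fine a - fine b = fine c - fine e.
  move=> /fineK <- /fineK <- /fineK <- /fineK <- /=.
  by rewrite -!EFinD => -[]; lra.
by apply: fK E; exact: integrable_fin_num.
Qed.

End SignedIntegral.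

(** * Algebra of a functional calculus *)

Section LinearCalculus.
Context d (T : measurableType d) (R : realType) (V : lmodType R)
  (C : (T -> R) -> V -> V).
Implicit Types (h k : T -> R) (u v : V).

Local Notation bm := (@bounded_measurable _ T R).

Context (CD : forall h k u, bm h -> bm k ->
     C (fun z => h z + k z) u = C h u + C k u)
  (CZ : forall a h u, bm h -> C (fun z => a * h z) u = a *: C h u)
  (Clin : forall h a u v, bm h -> C h (a *: u + v) = a *: C h u + C h v).

Lemma calculus_sub h k u : bm h -> bm k ->
  C (fun z => h z - k z) u = C h u - C k u.
Proof.
move=> bh bk; have := CD u bh (bm_scale (-1) bk); rewrite CZ // scaleN1r => <-.
by have -> // : (fun z => h z - k z) = (fun z => h z + -1 * k z)
  by apply/funext => z; rewrite mulN1r.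
Qed.

Lemma calculus_zero u : C (fun=> 0) u = 0.
Proof.
have := CZ 0 u (@bm_cst _ T R 0); rewrite scale0r => <-.
by have -> // : (fun=> 0 : R) = (fun z : T => 0 * 0) by apply/funext => z; rewrite mul0r.
Qed.

Lemma calculus_sum n (h : 'I_n -> T -> R) u : (forall i, bm (h i)) ->
  C (fun z => \sum_(i < n) h i z) u = \sum_(i < n) C (h i) u.
Proof.
elim: n h => [|n ih] h bh.
  rewrite big_ord0 -[RHS](calculus_zero u).
  have -> // : (fun z => \sum_(i < 0) h i z) = (fun=> 0).
  by apply/funext => z; rewrite big_ord0.
rewrite big_ord_recr /= -ih // -CD //; last exact: bm_sum.
have -> // : (fun z => \sum_(i < n.+1) h i z) =
  (fun z => \sum_(i < n) h (widen_ord (leqnSn n) i) z + h ord_max z).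
by apply/funext => z; rewrite big_ord_recr.
Qed.

Lemma calculus_addr h u v : bm h -> C h (u + v) = C h u + C h v.
Proof. by move=> bh; have := Clin 1 u v bh; rewrite !scale1r. Qed.

Lemma calculus_zeror h : bm h -> C h 0 = 0.
Proof.
move=> bh; have := calculus_addr 0 0 bh; rewrite addr0 -{1}[C h 0]addr0.
by move/addrI.
Qed.

Lemma calculus_scaler h a u : bm h -> C h (a *: u) = a *: C h u.
Proof.
by move=> bh; have := Clin a u 0 bh; rewrite !addr0 calculus_zeror // addr0.
Qed.

Lemma calculus_subr h u v : bm h -> C h (u - v) = C h u - C h v.
Proof.
by move=> bh; rewrite -scaleN1r calculus_addr // calculus_scaler // scaleN1r.
Qed.

Lemma calculus_sumr h n (x : 'I_n -> V) : bm h ->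
  C h (\sum_(i < n) x i) = \sum_(i < n) C h (x i).
Proof.
move=> bh; apply: (big_morph (C h)) => [u v|]; first exact: calculus_addr.
exact: calculus_zeror.
Qed.

End LinearCalculus.

Lemma measurable_invr (R : realType) : measurable_fun setT (fun x : R => x^-1).
Proof.
rewrite -(setUv [set (0 : R)]); apply/measurable_funU => //.
  exact: measurableC.
split; first exact: measurable_fun_set1.
apply: open_continuous_measurable_fun.
  by rewrite openC; exact: closed_eq.
by move=> x; rewrite inE /= => /eqP x0; exact: inv_continuous.
Qed.

Lemma geometric_bound_eq0 (R : realType) (a D q : R) : 0 <= q -> q < 1 ->
  (forall n, `|a| <= D * q ^+ n) -> a = 0.
Proof.
move=> q0 q1 h; apply/eqP; rewrite -normr_le0.
have cg : (fun n => D * q ^+ n) @ \oo --> (0 : R).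
  by have := @cvg_geometric R D q; rewrite ger0_norm //; apply.
rewrite -(cvg_lim _ cg) //; apply: limr_ge; first by apply/cvg_ex; exists 0.
by near=> n; exact: h.
Unshelve. all: by end_near.
Qed.

(** * Matrices: the condition on Delta as a pointwise inequality *)

Section RealSymmetricMatrix.
Context (R : realType) (n : nat).
Implicit Types (M : 'M[R]_n) (x y : 'rV[R]_n).

Local Notation bil M x y := ((x *m M *m y^T) 0 0).

Lemma bilDl M x1 x2 y : bil M (x1 + x2) y = bil M x1 y + bil M x2 y.
Proof. by rewrite !mulmxDl mxE. Qed.

Lemma bilDr M x y1 y2 : bil M x (y1 + y2) = bil M x y1 + bil M x y2.
Proof. by rewrite linearD /= mulmxDr mxE. Qed.

Lemma bilZl M a x y : bil M (a *: x) y = a * bil M x y.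
Proof. by rewrite -!scalemxAl mxE. Qed.

Lemma bilZr M a x y : bil M x (a *: y) = a * bil M x y.
Proof. by rewrite linearZ /= -scalemxAr mxE. Qed.

Lemma bilC M x y : M^T = M -> bil M x y = bil M y x.
Proof.
move=> Ms; transitivity (((x *m M *m y^T)^T) 0 0); first by rewrite [RHS]mxE.
by rewrite !trmx_mul trmxK Ms mulmxA.
Qed.

Lemma bil_sub_scalar M (r : R) x y :
  bil (M - r%:M) x y = bil M x y - r * (x *m y^T) 0 0.
Proof.
by rewrite mulmxBr mulmxBl mul_mx_scalar -scalemxAl !mxE.
Qed.

Lemma sqr_normE x : (x *m x^T) 0 0 = \sum_j x 0 j ^+ 2.
Proof. by rewrite mxE; apply: eq_bigr => j _; rewrite mxE expr2. Qed.

Lemma sqr_norm_ge0 x : 0 <= (x *m x^T) 0 0.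
Proof. by rewrite sqr_normE sumr_ge0 // => j _; rewrite sqr_ge0. Qed.

Lemma sqr_norm_eq0 x : (x *m x^T) 0 0 = 0 -> x = 0.
Proof.
rewrite sqr_normE => /eqP; rewrite psumr_eq0; last by move=> j _; rewrite sqr_ge0.
move=> /allP h; apply/rowP => j; rewrite mxE; apply/eqP.
by have := h j (mem_index_enum _); rewrite sqrf_eq0.
Qed.

Lemma sum_continuous (T : topologicalType) (I : Type) (r : seq I)
    (F : I -> T -> R) : (forall i, continuous (F i)) ->
  continuous (fun t => \sum_(i <- r) F i t).
Proof.
move=> cF; elim: r => [|i r ih] t.
  by under eq_fun do rewrite big_nil; exact: cst_continuous.
under eq_fun do rewrite big_cons.
by apply: cvgD; [exact: cF | exact: ih].
Qed.

Lemma quadratic_form_continuous M : continuous (fun x => bil M x x).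
Proof.
have -> : (fun x => bil M x x) =
    (fun x => \sum_j \sum_i x 0 i * M i j * x 0 j).
  apply/funext => x; rewrite mxE; apply: eq_bigr => j _.
  by rewrite !mxE mulr_suml.
apply: sum_continuous => j; apply: sum_continuous => i x.
pose c k := @coord_continuous R 1 n 0 k x.
exact: (cvgM (cvgM (c i) (cvg_cst (M i j))) (c j)).
Qed.

Lemma unit_sphere_compact : compact [set x : 'rV[R]_n | (x *m x^T) 0 0 = 1].
Proof.
apply: bounded_closed_compact.
  exists 1; split; first exact: num_real.
  move=> r r1 x /= x1; rewrite [leLHS]/Num.norm /= mx_normrE.
  apply/bigmax_leP; split=> [|[i j] _ /=]; first exact: le_trans (ltW r1).
  rewrite (ord1 i); apply: le_trans (ltW r1).
  rewrite -(@ler_pXn2r _ 2) ?nnegrE // expr1n real_normK ?num_real //.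
  rewrite -x1 sqr_normE (bigD1 j) //= lerDl sumr_ge0 // => k _.
  by rewrite sqr_ge0.
have -> : [set x : 'rV[R]_n | (x *m x^T) 0 0 = 1] =
    (fun x => bil 1%:M x x) @^-1` [set 1].
  by apply/seteqP; split=> x /=; rewrite mulmx1.
apply: closed_comp; last exact: closed_eq.
by move=> x _; exact: quadratic_form_continuous.
Qed.

(** The minimum of the quadratic form on the unit sphere is an eigenvalue: a
    nonnegative form which vanishes at a vector has this vector in its kernel. *)
Lemma pos_eigenvalues_form_ge0 M : M^T = M ->
  (forall r, eigenvalue M r -> 0 < r) -> forall x, 0 <= bil M x x.
Proof.
move=> Ms hM x.
have [->|x0] := eqVneq x 0; first by rewrite !mul0mx mxE.
pose nx := (x *m x^T) 0 0.
have nx0 : 0 < nx.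
  by rewrite lt_neqAle sqr_norm_ge0 andbT eq_sym; apply: contra_neq x0 => /sqr_norm_eq0.
have unit_scale y : 0 < (y *m y^T) 0 0 ->
    let a := (Num.sqrt ((y *m y^T) 0 0))^-1 in
    ((a *: y) *m (a *: y)^T) 0 0 = 1 /\ a * a * (y *m y^T) 0 0 = 1.
  move=> y0 a; have aa : a * a * (y *m y^T) 0 0 = 1.
    by rewrite /a -invfM -expr2 sqr_sqrtr ?(ltW y0) // mulVf // gt_eqF.
  split=> //.
  rewrite -[RHS]aa linearZ /= -scalemxAl -scalemxAr.
  by rewrite scalerA mxE.
have S0 : [set y : 'rV[R]_n | (y *m y^T) 0 0 = 1] !=set0.
  by have [h _] := unit_scale x nx0; eexists; exact: h.
have [|c cS cmin] := compact_EVT_min S0 unit_sphere_compact (f := fun y => bil M y y).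
  by apply: continuous_subspaceT; exact: quadratic_form_continuous.
rewrite inE /= in cS.
pose r := bil M c c; pose N := M - r%:M.
have Nge y : 0 <= bil N y y.
  have [->|y0] := eqVneq y 0; first by rewrite !mul0mx mxE.
  have ny0 : 0 < (y *m y^T) 0 0.
    by rewrite lt_neqAle sqr_norm_ge0 andbT eq_sym; apply: contra_neq y0 => /sqr_norm_eq0.
  have [h1 h2] := unit_scale y ny0.
  set a := (Num.sqrt _)^-1 in h1 h2.
  have := cmin (a *: y); rewrite inE => /(_ h1); rewrite bilZl bilZr -/r => h3.
  have aa0 : 0 < a * a.
    by rewrite -(pmulr_lgt0 _ ny0) h2 ltr01.
  rewrite -(pmulr_rge0 _ aa0) bil_sub_scalar.
  have -> : a * a * (bil M y y - r * (y *m y^T) 0 0) =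
      a * (a * bil M y y) - r * (a * a * (y *m y^T) 0 0) by ring.
  by rewrite h2 mulr1 subr_ge0.
have Ns : N^T = N by rewrite linearB /= Ms tr_scalar_mx.
have Nc : bil N c c = 0 by rewrite bil_sub_scalar cS mulr1 subrr.
have cN : c *m N = 0.
  apply: sqr_norm_eq0; set y := c *m N.
  have yy t : 0 <= 2 * t * (y *m y^T) 0 0 + t ^+ 2 * bil N y y.
    have := Nge (c + t *: y); rewrite bilDl !bilDr !bilZl !bilZr Nc.
    by rewrite (bilC y c Ns) -/y; lra.
  apply/eqP; rewrite eq_le sqr_norm_ge0 andbT leNgt; apply/negP => p.
  set q := (y *m y^T) 0 0 in p yy; set k := bil N y y in yy.
  have k0 : 0 <= k by exact: Nge.
  have := yy (- (q / (k + 1))).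
  have k1 : 0 < k + 1 by lra.
  have e0 : 0 < q / (k + 1) by exact: divr_gt0.
  have : k * (q / (k + 1)) <= q.
    by rewrite mulrCA ler_piMr ?(ltW p) // ler_pdivrMr // mul1r lerDl.
  by move: e0; set e := q / _; nra.
have r0 : 0 < r.
  apply: hM; apply/eigenvalueP; exists c; last first.
    by apply: contra_eq_neq cS => ->; rewrite mul0mx mxE eq_sym oner_eq0.
  by apply/eqP; rewrite -subr_eq0 -mul_mx_scalar -mulmxBr cN.
have := Nge x; rewrite bil_sub_scalar; have := mulr_ge0 (ltW r0) (sqr_norm_ge0 x).
by lra.
Qed.

End RealSymmetricMatrix.

Lemma positive_definite_mx_ge0 (R : realType) (n : nat) (D : 'M[R]_n)
    (x : 'rV[R]_n) :
  positive_definite_mx D -> 0 <= (x *m D *m x^T) 0 0.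
Proof.
move=> hD; set M := 2^-1 *: (D + D^T).
have Ms : M^T = M by rewrite linearZ linearD /= trmxK addrC.
have := pos_eigenvalues_form_ge0 Ms hD x.
rewrite /M -scalemxAr -scalemxAl mxE mulmxDr mulmxDl mxE.
have -> : (x *m D^T *m x^T) 0 0 = (x *m D *m x^T) 0 0.
  transitivity (((x *m D *m x^T)^T) 0 0); last by rewrite [LHS]mxE.
  by rewrite !trmx_mul trmxK mulmxA.
lra.
Qed.

Section StageCoefficients.
Context (R : realType) (s : nat) (a : nat -> nat -> R -> R) (b : nat -> R -> R).

(** Stages are counted from zero and the step itself is the last one, so that the
    stages and the step obey one formula; row [i] of the coefficient matrix then
    belongs to stage [i.+1], and stage zero has no coefficients. *)
Definition stage_coef (i j : nat) (z : R) : R :=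
  if i == 0%N then 0
  else if i == s then b j.+1 z
  else if (j < i)%N then a i.+1 j.+1 z else 0.

Lemma PmxE z (i j : 'I_s) : Pmx s a b z i j = stage_coef i.+1 j z.
Proof. by rewrite mxE /stage_coef /= ltnS. Qed.

Lemma ELmx_telescope (y : nat -> R) (i : 'I_s) : y 0%N = 0 ->
  (ELmx R s *m \col_j (y j.+1 - y j)) i 0 = y i.+1.
Proof.
move=> y0; rewrite mxE.
transitivity (\sum_(0 <= j < i.+1) (y j.+1 - y j)); last first.
  by rewrite telescope_sumr // y0 subr0.
rewrite big_mkord (big_ord_widen _ (fun j => y j.+1 - y j) (ltn_ord i)).
rewrite [RHS]big_mkcond /=; apply: eq_bigr => j _; rewrite !mxE ltnS.
by case: (j <= i)%N; rewrite ?mul1r ?mul0r.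
Qed.

(** Let [d] be the vector of differences of consecutive entries of [y = P t].
    Then [E_L d = P t], hence [P^-1 E_L d = t], and the right-hand side is the
    quadratic form of the matrix Delta at [d]. *)
Lemma stage_pointwise_ge0 z (t : nat -> R) :
  Pmx s a b z \in unitmx -> positive_definite_mx (Deltamx s a b z) ->
  let y i := \sum_(j < s) stage_coef i j z * t j in
  0 <= \sum_(i < s) (z * y i.+1 + t i - z / 2 * (y i.+1 - y i)) *
                    (y i.+1 - y i).
Proof.
move=> Pu pD; pose y (i : nat) := \sum_(j < s) stage_coef i j z * t j.
suff : 0 <= \sum_(i < s) (z * y i.+1 + t i - z / 2 * (y i.+1 - y i)) *
                         (y i.+1 - y i) by [].
pose T : 'cV[R]_s := \col_j t j; pose D : 'cV[R]_s := \col_j (y j.+1 - y j).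
have y0 : y 0%N = 0 by rewrite /y big1 // => j _; rewrite /stage_coef mul0r.
have ED : ELmx R s *m D = Pmx s a b z *m T.
  apply/colP => i; rewrite ELmx_telescope // mxE; apply: eq_bigr => j _.
  by rewrite PmxE mxE.
have := positive_definite_mx_ge0 D^T pD.
rewrite trmxK -mulmxA.
have -> : Deltamx s a b z *m D = z *: (Pmx s a b z *m T) + T - (z / 2) *: D.
  rewrite /Deltamx mulmxBl mulmxDl -scalemxAl -mulmxA ED mul_scalar_mx.
  by rewrite mulKmx.
rewrite mxE; congr (0 <= _); apply: eq_bigr => i _.
rewrite mulrC -ED; rewrite -/D; move: (ELmx_telescope i y0); rewrite -/D.
move=> E; rewrite [in LHS]mxE [in LHS]mxE [in X in X + _]mxE E.
by rewrite !mxE.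
Qed.

End StageCoefficients.

(** * From pointwise to operator positivity *)

Section DualForm.
Context (R : realType) (d : nat)
  (lam : {measure set (borel_space R d) -> \bar R}) (Omega : set 'rV[R]_d)
  (mO : measurable (Omega : set (borel_space R d)))
  (H : function_space lam Omega).

Local Notation ip := (@ip R d lam Omega H).
Local Notation hnorm := (@hnorm R d lam Omega H).

Context (K : H -> H) (CK : R)
  (Ksym : forall x y, ip (K x) y = ip x (K y))
  (Kpos : forall x, x <> 0 -> 0 < ip (K x) x)
  (Kbd : forall x, hnorm (K x) <= CK * hnorm x).
Implicit Types (x y z : H).

Lemma KDl x y z : ip (K (x + y)) z = ip (K x) z + ip (K y) z.
Proof. by rewrite !Ksym (ipDl mO). Qed.

Lemma KBl x y z : ip (K (x - y)) z = ip (K x) z - ip (K y) z.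
Proof. by rewrite !Ksym (ipBl mO). Qed.

Lemma KZl a x z : ip (K (a *: x)) z = a * ip (K x) z.
Proof. by rewrite !Ksym (ipZl mO). Qed.

Lemma KC x y : ip (K x) y = ip (K y) x.
Proof. by rewrite Ksym ipC. Qed.

Lemma K_cauchy x y : `|ip (K x) y| <= CK * hnorm x * hnorm y.
Proof.
apply: le_trans (cauchy_schwarz mO _ _) _.
by rewrite ler_wpM2r ?hnorm_ge0.
Qed.

Lemma K_inj x y : (forall z, ip (K x) z = ip (K y) z) -> x = y.
Proof.
move=> xy; apply/eqP; rewrite -subr_eq0; apply/negPn/negP => /eqP ne.
by have := Kpos ne; rewrite KBl xy subrr ltxx.
Qed.

End DualForm.

Section CoerciveForm.
Context (R : realType) (d : nat)
  (lam : {measure set (borel_space R d) -> \bar R}) (Omega : set 'rV[R]_d)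
  (mO : measurable (Omega : set (borel_space R d)))
  (H : function_space lam Omega).

Local Notation ip := (@ip R d lam Omega H).
Local Notation bm := (@bounded_measurable _ (measurableTypeR R) R).

Context (K : H -> H)
  (Ksym : forall x y, ip (K x) y = ip x (K y))
  (Kpos : forall x, x <> 0 -> 0 < ip (K x) x).
Context (C : (R -> R) -> H -> H)
  (Csym : forall h x y, bm h -> ip (K (C h x)) y = ip (K x) (C h y))
  (CM : forall h k u, bm h -> bm k ->
     C k (C h u) = C (fun z => k z * h z) u)
  (CB : forall h k u, bm h -> bm k ->
     C (fun z => h z - k z) u = C h u - C k u).

Lemma K_sumr n (F : 'I_n -> H) x :
  ip (K x) (\sum_(i < n) F i) = \sum_(i < n) ip (K x) (F i).
Proof. by rewrite ip_sumr. Qed.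

(** A matrix of functions, bounded below by [e > 0] as a quadratic form at every
    point of the spectrum, gives a nonnegative form on tuples of vectors. The
    proof completes the square in the last vector by means of the calculus
    itself; what is left is the Schur complement, with the same lower bound. *)
Lemma calculus_coercive_ge0 n (e : R) (F : nat -> nat -> R -> R) (X : nat -> H) :
  0 < e -> (forall i j, bm (F i j)) -> (forall i j z, F i j z = F j i z) ->
  (forall z (t : nat -> R), e * \sum_(i < n) t i ^+ 2 <=
     \sum_(i < n) \sum_(j < n) F i j z * t i * t j) ->
  0 <= \sum_(i < n) \sum_(j < n) ip (K (C (F i j) (X i))) (X j).
Proof.
move=> e0; elim: n F => [|n ih] F bF sF cF; first by rewrite big_ord0.
pose p := F n n.
have split2 (a : nat -> nat -> R) :
    \sum_(i < n.+1) \sum_(j < n.+1) a i j =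
    \sum_(i < n) \sum_(j < n) a i j +
    (\sum_(i < n) a i n + \sum_(j < n) a n j + a n n).
  rewrite big_ord_recr /=; under eq_bigr do rewrite big_ord_recr /=.
  by rewrite big_split /= big_ord_recr /= !addrA.
have pe z : e <= p z.
  have := cF z (fun i => if i == n then 1 else 0).
  rewrite (split2 (fun i j => F i j z * (if i == n then 1 else 0) *
                                (if j == n then 1 else 0))).
  rewrite big_ord_recr /= eqxx expr1n !big1 ?add0r ?mulr1 //.
  - by move=> j _; rewrite (ltn_eqF (ltn_ord j)) mulr0.
  - by move=> j _; rewrite (ltn_eqF (ltn_ord j)) mulr0 mul0r.
  - by move=> j _; rewrite big1 // => k _; rewrite (ltn_eqF (ltn_ord k)) mulr0.
  - by move=> j _; rewrite (ltn_eqF (ltn_ord j)) expr0n.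
have p0 z : 0 < p z by exact: lt_le_trans (pe z).
have bp : bm p by exact: bF.
pose sp z := Num.sqrt (p z).
have sp0 z : 0 < sp z by rewrite sqrtr_gt0.
have spE z : sp z * sp z = p z by rewrite -expr2 sqr_sqrtr // ltW.
have bsp : bm sp.
  have [mp [c hc]] := bp; split.
    by apply: measurableT_comp => //; apply: continuous_measurable_fun; exact: sqrt_continuous.
  exists (Num.sqrt c) => z; rewrite ger0_norm ?sqrtr_ge0 // ler_wsqrtr //.
  exact: le_trans (ler_norm _) (hc z).
have bisp : bm (fun z => (sp z)^-1).
  split; first exact: measurableT_comp (@measurable_invr R) (proj1 bsp).
  exists (Num.sqrt e)^-1 => z; rewrite ger0_norm ?invr_ge0 ?sqrtr_ge0 //.
  by rewrite lef_pV2 ?posrE ?sqrtr_gt0 // ler_wsqrtr.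
pose G i z := F i n z * (sp z)^-1.
have bG i : bm (G i) by apply: bm_mul.
have spG i : (fun z => G i z * sp z) = F i n.
  by apply/funext => z; rewrite /G divfK // gt_eqF.
pose S i j z := F i j z - G i z * G j z.
have bS i j : bm (S i j) by apply: bm_sub => //; apply: bm_mul.
have Sge : 0 <= \sum_(i < n) \sum_(j < n) ip (K (C (S i j) (X i))) (X j).
  apply: ih => //; first by move=> i j z; rewrite /S sF (mulrC (G i z)).
  move=> z t.
  pose r := \sum_(i < n) F i n z * t i.
  have [q qE] : exists q, p z * q = r.
    by exists (r / p z); rewrite mulrCA mulfV ?mulr1 // gt_eqF.
  have := cF z (fun i => if i == n then - q else t i).
  rewrite (split2 (fun i j => F i j z * (if i == n then - q else t i) *
                                (if j == n then - q else t j))).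
  rewrite eqxx big_ord_recr /= eqxx.
  have -> : \sum_(i < n) (if nat_of_ord i == n then - q else t i) ^+ 2 =
      \sum_(i < n) t i ^+ 2.
    by apply: eq_bigr => i _; rewrite (ltn_eqF (ltn_ord i)).
  have -> : \sum_(i < n) \sum_(j < n)
      F i j z * (if nat_of_ord i == n then - q else t i) *
                (if nat_of_ord j == n then - q else t j) =
      \sum_(i < n) \sum_(j < n) F i j z * t i * t j.
    apply: eq_bigr => i _; apply: eq_bigr => j _.
    by rewrite (ltn_eqF (ltn_ord i)) (ltn_eqF (ltn_ord j)).
  have -> : \sum_(i < n)
      F i n z * (if nat_of_ord i == n then - q else t i) * - q =
      - (r * q).
    rewrite -mulrN /r mulr_suml; apply: eq_bigr => i _.
    by rewrite (ltn_eqF (ltn_ord i)).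
  have -> : \sum_(j < n)
      F n j z * - q * (if nat_of_ord j == n then - q else t j) =
      - (r * q).
    rewrite -mulrN /r mulr_suml; apply: eq_bigr => i _.
    by rewrite (ltn_eqF (ltn_ord i)) sF mulrAC.
  have -> : F n n z * - q * - q = r * q.
    by rewrite -/(p z) -qE; ring.
  have -> : \sum_(i < n) \sum_(j < n) S i j z * t i * t j =
      \sum_(i < n) \sum_(j < n) F i j z * t i * t j - r * q.
    have -> : r * q = \sum_(i < n) \sum_(j < n) G i z * G j z * t i * t j.
      have -> : r * q = (r / sp z) * (r / sp z).
        by rewrite -qE -spE; field; rewrite gt_eqF.
      rewrite {1}/r !mulr_suml; apply: eq_bigr => i _.
      rewrite ?mulr_suml mulr_sumr; apply: eq_bigr => j _.
      by rewrite /G; ring.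
    rewrite -sumrB; apply: eq_bigr => i _; rewrite -sumrB; apply: eq_bigr => j _.
    by rewrite /S; ring.
  have : 0 <= e * (- q) ^+ 2 by rewrite mulr_ge0 ?sqr_ge0 // ltW.
  by rewrite mulrDr; lra.
pose y := C sp (X n) + \sum_(i < n) C (G i) (X i).
have yy : 0 <= ip (K y) y.
  have [->|/eqP y0] := eqVneq y 0; first by rewrite (ip0r mO).
  exact: ltW (Kpos y0).
have prodE h k u w : bm h -> bm k ->
    ip (K (C h u)) (C k w) = ip (K (C (fun z => k z * h z) u)) w.
  move=> bh bk; transitivity (ip (K (C k (C h u))) w).
    exact: esym (Csym _ _ bk).
  by rewrite (CM _ bh bk).
have yE : ip (K y) y = ip (K (C p (X n))) (X n) +
    2 * \sum_(i < n) ip (K (C (F i n) (X i))) (X n) +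
    \sum_(i < n) \sum_(j < n) ip (K (C (fun z => G i z * G j z) (X i))) (X j).
  rewrite /y (KDl mO Ksym) !(ipDr mO) prodE //.
  have -> : (fun z => sp z * sp z) = p by apply/funext.
  rewrite -!addrA; congr (_ + _).
  have cross : ip (K (C sp (X n))) (\sum_(i < n) C (G i) (X i)) =
      \sum_(i < n) ip (K (C (F i n) (X i))) (X n).
    rewrite K_sumr; apply: eq_bigr => i _; rewrite prodE // spG.
    by rewrite Csym // (KC Ksym).
  rewrite (KC Ksym (\sum_(i < n) _)) cross mulr2n mulrDl mul1r -addrA.
  congr (_ + (_ + _)); rewrite K_sumr exchange_big /=; apply: eq_bigr => j _.
  rewrite Ksym (ip_suml mO); apply: eq_bigr => i _.
  rewrite -Ksym (prodE _ _ _ _ (bG i) (bG j)).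
  have -> // : (fun z => G j z * G i z) = (fun z => G i z * G j z).
  by apply/funext => z; rewrite mulrC.
rewrite (split2 (fun i j => ip (K (C (F i j) (X i))) (X j))).
have -> : \sum_(j < n) ip (K (C (F n j) (X n))) (X j) =
    \sum_(i < n) ip (K (C (F i n) (X i))) (X n).
  apply: eq_bigr => j _; rewrite Csym // (KC Ksym).
  by have -> : F n j = F j n by apply/funext => z.
have SE : \sum_(i < n) \sum_(j < n) ip (K (C (S i j) (X i))) (X j) =
    \sum_(i < n) \sum_(j < n) ip (K (C (F i j) (X i))) (X j) -
    \sum_(i < n) \sum_(j < n) ip (K (C (fun z => G i z * G j z) (X i))) (X j).
  rewrite -sumrB; apply: eq_bigr => i _; rewrite -sumrB; apply: eq_bigr => j _.
  rewrite -(KBl mO Ksym); congr (ip (K _) _).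
  by rewrite /S CB //; exact: bm_mul.
move: yy Sge; rewrite yE SE -/p; lra.
Qed.

End CoerciveForm.

Section CalculusAlgebra.
Context (R : realType) (d : nat)
  (lam : {measure set (borel_space R d) -> \bar R}) (Omega : set 'rV[R]_d)
  (mO : measurable (Omega : set (borel_space R d)))
  (H : function_space lam Omega).

Local Notation ip := (@ip R d lam Omega H).
Local Notation bm := (@bounded_measurable _ (measurableTypeR R) R).

Context (K : H -> H)
  (Ksym : forall x y, ip (K x) y = ip x (K y))
  (Kpos : forall x, x <> 0 -> 0 < ip (K x) x).
Context (C : (R -> R) -> H -> H)
  (Csym : forall h x y, bm h -> ip (K (C h x)) y = ip (K x) (C h y))
  (CM : forall h k u, bm h -> bm k ->
     C k (C h u) = C (fun z => k z * h z) u)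
  (CD : forall h k u, bm h -> bm k ->
     C (fun z => h z + k z) u = C h u + C k u)
  (CZ : forall a h u, bm h -> C (fun z => a * h z) u = a *: C h u)
  (Clin : forall h a u v, bm h -> C h (a *: u + v) = a *: C h u + C h v).

Let CB h k u : bm h -> bm k -> C (fun z => h z - k z) u = C h u - C k u.
Proof. exact: (calculus_sub CD CZ). Qed.

(** Adding a small multiple of the identity matrix reduces to the coercive
    case. *)
Lemma calculus_semidefinite_ge0 n (F : nat -> nat -> R -> R) (X : nat -> H) :
  (forall i j, bm (F i j)) ->
  (forall z (t : nat -> R),
     0 <= \sum_(i < n) \sum_(j < n) F i j z * t i * t j) ->
  0 <= \sum_(i < n) \sum_(j < n) ip (K (C (F i j) (X i))) (X j).
Proof.
move=> bF pF.
set Q := \sum_(i < n) \sum_(j < n) _.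
pose T := \sum_(i < n) ip (K (C (fun=> 1) (X i))) (X i).
have b1 : bm (fun=> 1) by exact: bm_cst.
pose one (i j : nat) (z : R) : R := (i == j)%:R.
have b1ij i j : bm (one i j) by exact: bm_cst.
suff h e : 0 < e -> 0 <= Q + e * T.
  have T1 : 0 < `|T| + 1 by rewrite ltr_wpDl.
  rewrite leNgt; apply/negP => Q0.
  have e0 : 0 < - Q / (2 * (`|T| + 1)) by rewrite divr_gt0 ?oppr_gt0 ?mulr_gt0.
  have := h _ e0; set e := - Q / _ in e0 *.
  have eT : e * T <= - Q / 2.
    have -> : - Q / 2 = e * (`|T| + 1) by rewrite /e; field; rewrite gt_eqF.
    by rewrite ler_wpM2l ?(ltW e0) // (le_trans (ler_norm _)) // lerDl.
  by lra.
move=> e0.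
pose S i j (z : R) := 2^-1 * (F i j z + F j i z) + e * one i j z.
have bS i j : bm (S i j).
  by apply: bm_add; apply: bm_scale => //; apply: bm_add.
have := @calculus_coercive_ge0 _ _ _ _ mO _ _ Ksym Kpos C Csym CM CB
  n e S X e0 bS.
have Ssym i j z : S i j z = S j i z.
  by rewrite /S /one eq_sym; congr (_ * _ + _); rewrite addrC.
have Spos z (t : nat -> R) : e * \sum_(i < n) t i ^+ 2 <=
    \sum_(i < n) \sum_(j < n) S i j z * t i * t j.
  have -> : \sum_(i < n) \sum_(j < n) S i j z * t i * t j =
      \sum_(i < n) \sum_(j < n) F i j z * t i * t j + e * \sum_(i < n) t i ^+ 2.
    have E1 : \sum_(i < n) \sum_(j < n) F i j z * t i * t j =
        \sum_(i < n) \sum_(j < n) F j i z * t i * t j.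
      rewrite exchange_big /=; apply: eq_bigr => i _; apply: eq_bigr => j _.
      by rewrite mulrAC.
    have -> : \sum_(i < n) \sum_(j < n) F i j z * t i * t j =
        2^-1 * (\sum_(i < n) \sum_(j < n) F i j z * t i * t j +
                \sum_(i < n) \sum_(j < n) F j i z * t i * t j).
      by rewrite -E1; field.
    rewrite -big_split !mulr_sumr -big_split; apply: eq_bigr => i _ /=.
    have -> : e * t i ^+ 2 = \sum_(j < n) e * one i j z * t i * t j.
      rewrite (bigD1 i) //= big1 ?addr0.
        by rewrite /one eqxx mulr1 -mulrA.
      move=> j ji; rewrite /one; have -> : (nat_of_ord i == j) = false.
        by apply/negbTE; rewrite eq_sym; exact: ji.
      by rewrite mulr0 !mul0r.
    rewrite -big_split mulr_sumr -big_split; apply: eq_bigr => j _ /=.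
    by rewrite /S; ring.
  by rewrite lerDr.
move=> /(_ Ssym Spos).
suff -> : \sum_(i < n) \sum_(j < n) ip (K (C (S i j) (X i))) (X j) = Q + e * T.
  by [].
have E1 : Q = \sum_(i < n) \sum_(j < n) ip (K (C (F j i) (X i))) (X j).
  rewrite /Q exchange_big /=; apply: eq_bigr => i _; apply: eq_bigr => j _.
  by rewrite Csym // (KC Ksym).
have -> : Q = 2^-1 * (Q + Q) by field.
rewrite {2}E1 /Q /T -big_split !mulr_sumr -big_split; apply: eq_bigr => i _ /=.
have -> : e * ip (K (C (fun=> 1) (X i))) (X i) =
    \sum_(j < n) e * ip (K (C (one i j) (X i))) (X j).
  have o1 : one i i = (fun=> 1) by apply/funext => z; rewrite /one eqxx.
  rewrite (bigD1 i) //= big1 ?addr0; first by rewrite o1.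
  move=> j ji; have -> : one i j = (fun=> 0).
    apply/funext => z; rewrite /one; have -> // : (nat_of_ord i == j) = false.
    by apply/negbTE; rewrite eq_sym; exact: ji.
  by rewrite (calculus_zero CZ) Ksym (ip0l mO) mulr0.
rewrite -big_split mulr_sumr -big_split; apply: eq_bigr => j _ /=.
rewrite /S CD; last 2 first.
- by apply: bm_scale; apply: bm_add.
- exact: bm_scale.
rewrite (CZ 2^-1) ?(CZ e) ?CD //; last exact: bm_add.
by rewrite !(KDl mO Ksym, KZl mO Ksym).
Qed.

(** The sum of the stage contributions to the energy, cut off to a part of the
    spectrum by [e]. The differences of consecutive stages are combinations of
    the vectors [rho j] with coefficients [p i.+1 j - p i j], so the sum is a
    quadratic form in these vectors, with coefficients that are functions of the
    operator; its positivity is a pointwise condition. Written in the [rho j] the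
    form involves no inverse of the matrix of functions [p]. *)
Lemma stage_form_ge0 s (e zz : R -> R) (p : nat -> nat -> R -> R) (tau : R)
    (w r : nat -> H) :
  let rho j := C zz (w 0) - tau *: C e (r j) in
  let delta i := w i.+1 - w i in
  bm e -> bm zz -> (forall i j, bm (p i j)) ->
  (forall z, e z * e z = e z) -> (forall z, zz z * e z = zz z) ->
  (forall i, (i <= s)%N ->
     C e (w i) - C e (w 0) = \sum_(j < s) C (p i j) (rho j)) ->
  (forall z (t : nat -> R),
     let y i := \sum_(j < s) p i j z * t j in
     0 <= \sum_(i < s) (zz z * y i.+1 + e z * t i - zz z / 2 * (y i.+1 - y i)) *
                       (y i.+1 - y i)) ->
  0 <= \sum_(i < s) (ip (K (C zz (w i.+1))) (delta i)
                     - 2^-1 * ip (K (C zz (delta i))) (delta i)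
                     - tau * ip (K (C e (r i))) (delta i)).
Proof.
move=> rho delta be bz bp ee ze wE pos.
have deltaE0 i : delta i = w i.+1 - w i by [].
have rhoE j : rho j = C zz (w 0) - tau *: C e (r j) by [].
clearbody delta rho.
pose D i j z := p i.+1 j z - p i j z.
have bD i j : bm (D i j) by apply: bm_sub.
pose one (i j : nat) : R := (i == j)%:R.
pose N i k z := zz z * p i.+1 k z + one i k * e z - 2^-1 * (zz z * D i k z).
have bN i k : bm (N i k).
  apply: bm_sub; last by apply: bm_scale; apply: bm_mul.
  by apply: bm_add; [apply: bm_mul | apply: bm_scale].
have Ce x : C e (C e x) = C e x.
  by rewrite CM //; have -> : (fun z => e z * e z) = e by apply/funext.
have Cz x : C zz (C e x) = C zz x.
  by rewrite CM //; have -> : (fun z => zz z * e z) = zz by apply/funext.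
have Cez x : C e (C zz x) = C zz x.
  rewrite CM //; have -> // : (fun z => e z * zz z) = zz.
  by apply/funext => z; rewrite mulrC.
have Cerho j : C e (rho j) = rho j.
  by rewrite rhoE (calculus_subr Clin) // (calculus_scaler Clin) // Ce Cez.
have deltaE i : (i < s)%N -> C e (delta i) = \sum_(j < s) C (D i j) (rho j).
  move=> si; rewrite deltaE0 (calculus_subr Clin) //.
  have -> : C e (w i.+1) - C e (w i) =
      (C e (w i.+1) - C e (w 0)) - (C e (w i) - C e (w 0)).
    by rewrite opprB addrA subrK.
  rewrite !wE //; last exact: ltnW.
  rewrite -sumrB; apply: eq_bigr => j _.
  by rewrite -(calculus_sub CD CZ).
have NE i : (i < s)%N ->
    C zz (w i.+1) - 2^-1 *: C zz (delta i) - tau *: C e (r i) =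
    \sum_(k < s) C (N i k) (rho k).
  move=> si.
  have -> : \sum_(k < s) C (N i k) (rho k) =
      C zz (\sum_(k < s) C (p i.+1 k) (rho k)) + \sum_(k < s) one i k *: C e (rho k)
      - 2^-1 *: C zz (\sum_(k < s) C (D i k) (rho k)).
    rewrite !(calculus_sumr Clin) // scaler_sumr -big_split -sumrB.
    apply: eq_bigr => k _ /=.
    have bzp : bm (fun z => zz z * p i.+1 k z) by apply: bm_mul.
    have bzD : bm (fun z => zz z * D i k z) by apply: bm_mul.
    have boe : bm (fun z => one i k * e z) by apply: bm_scale.
    rewrite /N (calculus_sub CD CZ _ (bm_add bzp boe) (bm_scale _ bzD)).
    by rewrite (CD _ bzp boe) (CZ _ _ be) (CZ _ _ bzD) !CM.
  rewrite -wE // -deltaE // (calculus_subr Clin) // !Cz.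
  have -> : \sum_(k < s) one i k *: C e (rho k) = rho i.
    rewrite (bigD1 (Ordinal si)) //= big1 ?addr0.
      by rewrite /one eqxx scale1r Cerho.
    move=> k ki; rewrite /one; have -> : (i == nat_of_ord k) = false.
      by apply/negbTE; rewrite eq_sym; exact: ki.
    by rewrite scale0r.
  by rewrite rhoE addrA subrK addrAC.
have -> : \sum_(i < s) (ip (K (C zz (w i.+1))) (delta i)
    - 2^-1 * ip (K (C zz (delta i))) (delta i) - tau * ip (K (C e (r i))) (delta i)) =
    \sum_(k < s) \sum_(j < s)
      ip (K (C (fun z => \sum_(i < s) D i j z * N i k z) (rho k))) (rho j).
  transitivity (\sum_(i < s) \sum_(k < s) \sum_(j < s)
      ip (K (C (fun z => D i j z * N i k z) (rho k))) (rho j)).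
    apply: eq_bigr => i _.
    have -> : ip (K (C zz (w i.+1))) (delta i) -
      2^-1 * ip (K (C zz (delta i))) (delta i) - tau * ip (K (C e (r i))) (delta i) =
      ip (K (C e (C zz (w i.+1) - 2^-1 *: C zz (delta i) - tau *: C e (r i)))) (delta i).
      rewrite !(calculus_subr Clin) // !(calculus_scaler Clin) // !Cez Ce.
      by rewrite !(KBl mO Ksym, KZl mO Ksym).
    rewrite Csym // deltaE // NE // Ksym (ip_suml mO); apply: eq_bigr => k _.
    rewrite -Ksym (ip_sumr mO); apply: eq_bigr => j _.
    by rewrite -Csym // CM.
  rewrite exchange_big; apply: eq_bigr => k _ /=.
  rewrite exchange_big; apply: eq_bigr => j _ /=.
  rewrite (calculus_sum CD CZ); last by move=> i; apply: bm_mul.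
  by rewrite Ksym (ip_suml mO); apply: eq_bigr => i _; rewrite Ksym.
apply: (calculus_semidefinite_ge0 (F := fun k j z => \sum_(i < s) D i j z * N i k z)).
  by move=> k j; apply: bm_sum => i; apply: bm_mul.
move=> z t.
have -> : \sum_(k < s) \sum_(j < s) (\sum_(i < s) D i j z * N i k z) * t k * t j =
    \sum_(i < s) (\sum_(k < s) N i k z * t k) * (\sum_(j < s) D i j z * t j).
  transitivity (\sum_(k < s) \sum_(j < s) \sum_(i < s) (N i k z * t k) * (D i j z * t j)).
    apply: eq_bigr => k _; apply: eq_bigr => j _; rewrite !mulr_suml.
    by apply: eq_bigr => i _; ring.
  rewrite exchange_big /=.
  under eq_bigr do rewrite exchange_big /=.
  rewrite exchange_big /=; apply: eq_bigr => i _.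
  rewrite mulr_sumr; apply: eq_bigr => j _.
  by rewrite mulr_suml.
have /= := pos z t.
suff E (i : 'I_s) : (\sum_(k < s) N i k z * t k) * (\sum_(j < s) D i j z * t j) =
    (zz z * \sum_(j < s) p i.+1 j z * t j + e z * t i -
     zz z / 2 * (\sum_(j < s) p i.+1 j z * t j - \sum_(j < s) p i j z * t j)) *
    (\sum_(j < s) p i.+1 j z * t j - \sum_(j < s) p i j z * t j).
  by rewrite (eq_bigr _ (fun i _ => E i)).
have DE : \sum_(j < s) D i j z * t j =
    \sum_(j < s) p i.+1 j z * t j - \sum_(j < s) p i j z * t j.
  by rewrite -sumrB; apply: eq_bigr => j _; rewrite /D mulrBl.
rewrite -DE; congr (_ * _).
have -> : e z * t i = \sum_(k < s) one i k * e z * t k.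
  rewrite (bigD1 i) //= big1 ?addr0; first by rewrite /one eqxx mul1r.
  move=> k ki; rewrite /one; have -> : (nat_of_ord i == k) = false.
    by apply/negbTE; rewrite eq_sym; exact: ki.
  by rewrite !mul0r.
rewrite !mulr_sumr -big_split -sumrB; apply: eq_bigr => k _ /=.
by rewrite /N; ring.
Qed.

End CalculusAlgebra.

(** * The calculus of a projection measure *)

Lemma spectral_integral_dom (R : realType) (d : nat)
    (lam : {measure set (borel_space R d) -> \bar R}) (Omega : set 'rV[R]_d)
    (H : function_space lam Omega) (P : set (measurableTypeR R) -> H -> H)
    (h : R -> R) (x : H) :
  dom (functional_calculus P h) x ->
  spectral_integral P h x (functional_calculus P h x).
Proof. by move=> dx; exact: (@xgetPex _ 0 [set w | spectral_integral P h x w]). Qed.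

Lemma spectral_integral_measurable (R : realType) (d : nat)
    (lam : {measure set (borel_space R d) -> \bar R}) (Omega : set 'rV[R]_d)
    (H : function_space lam Omega) (P : set (measurableTypeR R) -> H -> H)
    (h : R -> R) (x w : H) :
  spectral_integral P h x w ->
  measurable_fun setT (h : measurableTypeR R -> R).
Proof.
move=> /(_ 0) [m1 [m2 [_ i1 _ _]]].
exact: (rintegrable_measurable (T := measurableTypeR R) i1).
Qed.

Section SpectralCalculus.
Context (R : realType) (d : nat)
  (lam : {measure set (borel_space R d) -> \bar R}) (Omega : set 'rV[R]_d)
  (mO : measurable (Omega : set (borel_space R d)))
  (H : function_space lam Omega).
Context (P : set (measurableTypeR R) -> H -> H) (hP : projection_measure P).
Context (M : R) (M0 : 0 <= M)
  (hM : forall B, measurable B -> forall u, hnorm (P B u) <= M * hnorm u).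
Implicit Types (u v w x y : H) (h k : R -> R) (B C : set (measurableTypeR R)).

Local Notation ip := (@ip R d lam Omega H).
Local Notation hnorm := (@hnorm R d lam Omega H).
Local Notation bm := (@bounded_measurable _ (measurableTypeR R) R).
Local Notation spec u v := (fun B => ip (P B u) v).

(** The integral of a bounded function against the signed measure
    [B |-> (P B u, v)]. *)
Definition spectral_form u v h : R :=
  xget 0 [set I | signed_integral (spec u v) h I].

Lemma spectral_formE u v h (m1 m2 : {finite_measure set _ -> \bar R}) :
  bm h -> decomposes (spec u v) m1 m2 -> spectral_form u v h = dint m1 m2 h.
Proof.
move=> hh dm; rewrite /spectral_form; case: xgetP => [I ->|/(_ (dint m1 m2 h))].
  move=> [n1 [n2 [dn i1 i2 ->]]].
  by apply: (dint_indep dn dm) => //; exact: bm_integrable.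
by case; exists m1, m2; split => //; exact: bm_integrable.
Qed.

Lemma spectral_dec u v : exists m1 m2, decomposes (spec u v) m1 m2.
Proof. by case: hP. Qed.

Lemma signed_integral_form u v h I : bm h ->
  signed_integral (spec u v) h I <-> I = spectral_form u v h.
Proof.
move=> hh; split=> [[n1 [n2 [dn i1 i2 ->]]]|->].
  by rewrite (spectral_formE hh dn).
have [m1 [m2 dm]] := spectral_dec u v.
rewrite (spectral_formE hh dm); exists m1, m2.
by split => //; exact: bm_integrable.
Qed.

Lemma spectral_formD u v h k : bm h -> bm k ->
  spectral_form u v (fun z => h z + k z) =
  spectral_form u v h + spectral_form u v k.
Proof.
move=> hh hk; have [m1 [m2 dm]] := spectral_dec u v.
by rewrite !(spectral_formE _ dm) //; [exact: dintD | exact: bm_add].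
Qed.

Lemma spectral_formZ u v a h : bm h ->
  spectral_form u v (fun z => a * h z) = a * spectral_form u v h.
Proof.
move=> hh; have [m1 [m2 dm]] := spectral_dec u v.
by rewrite !(spectral_formE _ dm) //; [exact: dintZ | exact: bm_scale].
Qed.

Lemma spectral_form_indic u v B : measurable B ->
  spectral_form u v (\1_B) = ip (P B u) v.
Proof.
move=> mB; have [m1 [m2 dm]] := spectral_dec u v.
rewrite (spectral_formE _ dm); last exact: bm_indic.
by rewrite dint_indic // (decomposes_val dm).
Qed.

Lemma spectral_form_bound u v h (c : R) : 0 <= c -> bm h ->
  (forall z, `|h z| <= c) ->
  `|spectral_form u v h| <= 2 * M * c * hnorm u * hnorm v.
Proof.
move=> c0 hh hc; have [m1 [m2 dm]] := spectral_dec u v.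
rewrite (spectral_formE hh dm).
have := @dint_bound _ _ _ m1 m2 (M * hnorm u * hnorm v) c h _ c0 hh hc.
have -> : 2 * c * (M * hnorm u * hnorm v) = 2 * M * c * hnorm u * hnorm v.
  by ring.
apply=> B mB; rewrite -(decomposes_val dm mB).
apply: le_trans (cauchy_schwarz mO _ _) _.
by rewrite ler_wpM2r ?hnorm_ge0 // hM.
Qed.

Lemma spectral_form_sum u v n (t : nat -> R)
    (C : nat -> set (measurableTypeR R)) : (forall j, measurable (C j)) ->
  spectral_form u v (fun z => \sum_(j < n) t j * \1_(C j) z) =
  ip (\sum_(j < n) t j *: P (C j) u) v.
Proof.
move=> mC; elim: n => [|n ih].
  rewrite big_ord0 (ip0l mO); under eq_fun do rewrite big_ord0.
  have -> : (fun=> 0 : R) = (fun z : R => 0 * (fun=> 0) z) :> (R -> R).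
    by apply/funext => z; rewrite mul0r.
  by rewrite spectral_formZ ?mul0r //; exact: bm_cst.
under eq_fun do rewrite big_ord_recr /=.
rewrite big_ord_recr /= (ipDl mO) (ipZl mO) -ih.
rewrite -spectral_form_indic // -spectral_formZ; last exact: bm_indic.
rewrite -spectral_formD //; last by apply: bm_scale; exact: bm_indic.
by apply: bm_sum => j; apply: bm_scale; exact: bm_indic.
Qed.

Lemma bm_simple n (t : nat -> R) (C : nat -> set (measurableTypeR R)) :
  (forall j, measurable (C j)) ->
  bm (fun z => \sum_(j < n) t j * \1_(C j) z).
Proof.
by move=> mC; apply: bm_sum => j; apply: bm_scale; exact: bm_indic.
Qed.

Lemma spectral_formB u v h k : bm h -> bm k ->
  spectral_form u v (fun z => h z - k z) =
  spectral_form u v h - spectral_form u v k.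
Proof.
move=> hh hk; rewrite spectral_formD //; last exact: bm_opp.
have -> : (fun z => - k z) = (fun z => -1 * k z).
  by apply/funext => z; rewrite mulN1r.
by rewrite spectral_formZ // mulN1r.
Qed.

(** Simple functions within [1/(n+1)] of [h] give vectors which form a Cauchy
    sequence by the bound on the spectral form; the limit represents [h]. *)
Lemma spectral_form_represented h u : bm h ->
  exists w, forall v, ip w v = spectral_form u v h.
Proof.
move=> hh.
have e0 (i : nat) : 0 < (i.+1%:R^-1 : R) by rewrite invr_gt0.
have S (i : nat) : exists q : nat * (nat -> R) * (nat -> set (measurableTypeR R)),
    (forall j, measurable (q.2 j)) /\
    forall z, `|h z - \sum_(j < q.1.1) q.1.2 j * \1_(q.2 j) z| <= i.+1%:R^-1.
  have [n [t [C [mC hC]]]] := @simple_approx _ (measurableTypeR R) R h _ hh (e0 i).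
  by exists (n, t, C).
have [q hq] := choice S.
pose s i (z : R) : R := \sum_(j < (q i).1.1) (q i).1.2 j * \1_((q i).2 j) z.
have bs i : bm (s i) by apply: bm_simple; case: (hq i).
pose w i := \sum_(j < (q i).1.1) (q i).1.2 j *: P ((q i).2 j) u.
have wE i v : ip (w i) v = spectral_form u v (s i).
  by rewrite spectral_form_sum //; case: (hq i).
pose K := 2 * M * hnorm u.
have K0 : 0 <= K by rewrite /K !mulr_ge0 ?hnorm_ge0.
have cauchy i j : hnorm (w i - w j) <= K * (i.+1%:R^-1 + j.+1%:R^-1).
  have [->|n0] := eqVneq (hnorm (w i - w j)) 0.
    by rewrite mulr_ge0 // addr_ge0 // ltW.
  have np : 0 < hnorm (w i - w j) by rewrite lt_neqAle eq_sym n0 hnorm_ge0.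
  rewrite -(ler_pM2r np) -expr2 hnorm_sqr {1}(ipBl mO) !wE.
  rewrite -spectral_formB //; apply: le_trans (ler_norm _) _.
  apply: le_trans (@spectral_form_bound _ _ _ (i.+1%:R^-1 + j.+1%:R^-1) _ _ _) _.
  - by rewrite addr_ge0 // ltW.
  - exact: bm_sub.
  - move=> z; have -> : s i z - s j z = (h z - s j z) - (h z - s i z) by ring.
    rewrite [leRHS]addrC; apply: le_trans (ler_normB _ _) _.
    by rewrite lerD //; [case: (hq j) | case: (hq i)].
  - by rewrite /K le_eqVlt; apply/orP; left; apply/eqP; ring.
have [|l hl] := hilbert_complete (w := w).
  move=> e ee; have K1 : 0 < K + 1 by rewrite ltr_wpDl.
  pose N := Num.truncn (2 * (K + 1) / e).
  exists N => i j Ni Nj; apply: le_lt_trans (cauchy i j) _.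
  have hN (l : nat) : (N <= l)%N -> l.+1%:R^-1 < e / (2 * (K + 1)).
    move=> Nl; rewrite invf_plt ?posrE ?divr_gt0 ?mulr_gt0 // invf_div.
    by rewrite -truncn_lt_nat ?ltnS // divr_ge0 ?mulr_ge0 // ltW.
  have h1 := hN i Ni; have h2 := hN j Nj.
  apply: (@le_lt_trans _ _ (K * (e / (K + 1)))).
    rewrite ler_wpM2l //; have -> : e / (K + 1) = e / (2 * (K + 1)) + e / (2 * (K + 1)).
      by field; rewrite gt_eqF.
    by rewrite lerD // ltW.
  by rewrite mulrCA gtr_pMr // ltr_pdivrMr // mul1r ltrDl.
exists l => v; apply/eqP; rewrite -subr_eq0 -normr_le0.
apply/ler_addgt0Pr => e ee; rewrite add0r.
have V1 : 0 < (K + 1) * (hnorm v + 1) by rewrite mulr_gt0 // ltr_wpDl ?hnorm_ge0.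
pose e' := e / (2 * ((K + 1) * (hnorm v + 1))).
have e'0 : 0 < e' by rewrite divr_gt0 // mulr_gt0.
have [N hN] := hl e' e'0.
pose i := maxn N (Num.truncn (e'^-1)).
have hi : i.+1%:R^-1 < e'.
  rewrite invf_plt ?posrE // -truncn_lt_nat ?ltnS ?leq_maxr //.
  by rewrite invr_ge0 ltW.
have -> : ip l v - spectral_form u v h =
    ip (w i - l) (- v) - (spectral_form u v h - spectral_form u v (s i)).
  by rewrite (ipNr mO) (ipBl mO) wE; ring.
apply: le_trans (ler_normB _ _) _.
rewrite -spectral_formB //.
have b1 : `|ip (w i - l) (- v)| <= e' * hnorm v.
  apply: le_trans (cauchy_schwarz mO _ _) _.
  by rewrite (hnormN mO) ler_wpM2r ?hnorm_ge0 // ltW // hN // leq_maxl.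
have b2 : `|spectral_form u v (fun z => h z - s i z)| <= K * e' * hnorm v.
  apply: le_trans (@spectral_form_bound _ _ _ e' (ltW e'0) _ _) _.
  - exact: bm_sub.
  - by move=> z; apply: le_trans (ltW hi); case: (hq i).
  - by rewrite /K le_eqVlt; apply/orP; left; apply/eqP; ring.
apply: le_trans (lerD b1 b2) _.
have -> : e = e' * (2 * ((K + 1) * (hnorm v + 1))).
  by rewrite /e' divfK // gt_eqF // mulr_gt0.
have v0 := hnorm_ge0 v.
have e'1 : 0 <= e' := ltW e'0.
have h1 : 0 <= e' * K by exact: mulr_ge0.
have h2 : 0 <= e' * K * hnorm v by exact: mulr_ge0.
have h3 : 0 <= e' * hnorm v by exact: mulr_ge0.
lra.
Qed.

Local Notation sform := spectral_form.
Local Notation Phi := (functional_calculus P).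

Lemma spectral_integralP h u w : bm h ->
  spectral_integral P h u w <-> forall v, ip w v = sform u v h.
Proof.
by move=> hh; split=> hw v; apply/(signed_integral_form u v _ hh).
Qed.

Lemma calcE h u v : bm h -> ip (Phi h u) v = sform u v h.
Proof.
move=> hh; rewrite /functional_calculus /=; case: xgetP.
  by move=> w -> /(spectral_integralP _ _ hh).
have [w hw] := spectral_form_represented u hh.
by move=> /(_ w); case; apply/(spectral_integralP _ _ hh).
Qed.

Local Opaque functional_calculus.

Lemma calc_bound h (c : R) u : 0 <= c -> bm h -> (forall z, `|h z| <= c) ->
  hnorm (Phi h u) <= 2 * M * c * hnorm u.
Proof.
move=> c0 hh hc; have [->|n0] := eqVneq (hnorm (Phi h u)) 0.
  by rewrite !mulr_ge0 ?hnorm_ge0.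
have np : 0 < hnorm (Phi h u) by rewrite lt_neqAle eq_sym n0 hnorm_ge0.
rewrite -(ler_pM2r np) -expr2 hnorm_sqr {1}calcE //.
apply: le_trans (ler_norm _) _; exact: spectral_form_bound.
Qed.

Lemma calcD h k u : bm h -> bm k ->
  Phi (fun z => h z + k z) u = Phi h u + Phi k u.
Proof.
move=> hh hk; apply: (ip_inj mO) => v.
rewrite (ipDl mO) !calcE //; last exact: bm_add.
exact: spectral_formD.
Qed.

Lemma calcZ a h u : bm h -> Phi (fun z => a * h z) u = a *: Phi h u.
Proof.
move=> hh; apply: (ip_inj mO) => v.
rewrite (ipZl mO) !calcE //; last exact: bm_scale.
exact: spectral_formZ.
Qed.

Let Phi' (h : measurableTypeR R -> R) (u : H) : H := Phi h u.
Let PhiD h k u : bm h -> bm k ->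
  Phi' (fun z => h z + k z) u = Phi' h u + Phi' k u.
Proof. exact: calcD. Qed.
Let PhiZ a h u : bm h -> Phi' (fun z => a * h z) u = a *: Phi' h u.
Proof. exact: calcZ. Qed.

Lemma calcB h k u : bm h -> bm k ->
  Phi (fun z => h z - k z) u = Phi h u - Phi k u.
Proof. exact: (@calculus_sub _ _ _ _ Phi' PhiD PhiZ). Qed.

Lemma calc_indic B u : measurable B -> Phi (\1_B) u = P B u.
Proof.
move=> mB; apply: (ip_inj mO) => v; rewrite calcE; last exact: bm_indic.
exact: spectral_form_indic.
Qed.

Lemma calc_simple n (t : nat -> R) (C : nat -> set (measurableTypeR R)) u :
  (forall j, measurable (C j)) ->
  Phi (fun z => \sum_(j < n) t j * \1_(C j) z) u =
  \sum_(j < n) t j *: P (C j) u.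
Proof.
move=> mC; apply: (ip_inj mO) => v; rewrite calcE; last exact: bm_simple.
exact: spectral_form_sum.
Qed.

Lemma calc0 u : Phi (fun=> 0) u = 0.
Proof. exact: (@calculus_zero _ _ _ _ Phi' PhiZ). Qed.

Lemma calc_sum n (F : 'I_n -> R -> R) u : (forall i, bm (F i)) ->
  Phi (fun z => \sum_(i < n) F i z) u = \sum_(i < n) Phi (F i) u.
Proof. exact: (@calculus_sum _ _ _ _ Phi' PhiD PhiZ). Qed.

Lemma proj_linear B : measurable B -> forall a u v,
  P B (a *: u + v) = a *: P B u + P B v.
Proof. by move=> mB; case: hP => /(_ B mB) h _ _ _ _ a u v; exact: h. Qed.

Lemma projD B u v : measurable B -> P B (u + v) = P B u + P B v.
Proof. by move=> mB; have := proj_linear mB 1 u v; rewrite !scale1r. Qed.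

Lemma proj0 B : measurable B -> P B 0 = 0.
Proof.
move=> mB; have := projD 0 0 mB; rewrite addr0 -{1}[P B 0]addr0.
by move/addrI.
Qed.

Lemma projZ B a u : measurable B -> P B (a *: u) = a *: P B u.
Proof.
by move=> mB; have := proj_linear mB a u 0; rewrite !addr0 proj0 // addr0.
Qed.

Lemma projB B u v : measurable B -> P B (u - v) = P B u - P B v.
Proof. by move=> mB; rewrite projD // -scaleN1r projZ // scaleN1r. Qed.

Lemma proj_sum B n (F : 'I_n -> H) : measurable B ->
  P B (\sum_(i < n) F i) = \sum_(i < n) P B (F i).
Proof.
move=> mB; apply: (big_morph (P B)) => [x y|]; first exact: projD.
exact: proj0.
Qed.

Lemma projI B C u : measurable B -> measurable C ->
  P (B `&` C) u = P B (P C u).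
Proof. by move=> mB mC; case: hP => _ _ _ + _; apply. Qed.

Lemma projT u : P setT u = u. Proof. by case: hP. Qed.

Lemma proj_disjoint_union B C u : measurable B -> measurable C ->
  B `&` C = set0 -> P (B `|` C) u = P B u + P C u.
Proof.
move=> mB mC BC; rewrite -!calc_indic //; last exact: measurableU.
rewrite -calcD; [|exact: bm_indic|exact: bm_indic].
congr (Phi _ u); apply/funext => z; rewrite !indicE in_setU.
case: (boolP (z \in B)); rewrite ?inE => zB /=; last by rewrite add0r.
by rewrite memNset ?addr0 // => zC; have : (B `&` C) z by []; rewrite BC.
Qed.

Lemma proj_setC B u : measurable B -> P (~` B) u = u - P B u.
Proof.
move=> mB; apply/eqP; rewrite eq_sym subr_eq; apply/eqP.
rewrite addrC -proj_disjoint_union ?setUv ?projT ?setICr //.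
exact: measurableC.
Qed.

(** Every identity of the calculus that is continuous for the uniform norm is
    inherited from simple functions through this estimate. *)
Lemma calc_simple_close h (e : R) n (t : nat -> R)
    (C : nat -> set (measurableTypeR R)) u :
  bm h -> 0 <= e -> (forall j, measurable (C j)) ->
  (forall z, `|h z - \sum_(j < n) t j * \1_(C j) z| <= e) ->
  hnorm (Phi h u - \sum_(j < n) t j *: P (C j) u) <= 2 * M * e * hnorm u.
Proof.
move=> hh e0 mC he; rewrite -calc_simple // -calcB //; last exact: bm_simple.
by apply: calc_bound => //; apply: bm_sub => //; exact: bm_simple.
Qed.

Lemma calc_proj C h u : measurable C -> bm h ->
  P C (Phi h u) = Phi (fun z => \1_C z * h z) u.
Proof.
move=> mC hh.
apply: (hnorm_eps_eq mO (C := M * (2 * M * hnorm u) + 2 * M * hnorm u)) => e e0.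
have [n [t [D [mD hD]]]] := @simple_approx _ (measurableTypeR R) R _ _ hh e0.
apply: le_trans (hnorm_triangle mO (P C (\sum_(j < n) t j *: P (D j) u)) _ _) _.
have b1 := calc_simple_close u hh (ltW e0) mD hD.
rewrite mulrDl lerD //.
  rewrite -projB //; apply: le_trans (hM mC _) _.
  rewrite -mulrA ler_wpM2l //; apply: le_trans b1 _.
  by rewrite mulrAC.
rewrite (hnorm_distC mO) proj_sum //.
under eq_bigr do rewrite projZ // -projI //.
have -> : 2 * M * hnorm u * e = 2 * M * e * hnorm u by ring.
apply: (@calc_simple_close _ _ n t (fun j => C `&` D j)).
- exact: bm_indicM.
- exact: ltW.
- by move=> j; exact: measurableI.
- move=> z; have -> : \sum_(j < n) t j * \1_(C `&` D j) z =
      \1_C z * \sum_(j < n) t j * \1_(D j) z.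
    rewrite mulr_sumr; apply: eq_bigr => j _.
    by rewrite !indicE in_setI; case: (_ \in C); case: (_ \in D j) => /=; ring.
  rewrite -mulrBr normrM; apply: le_trans (hD z).
  rewrite ler_piMl // indicE.
  by case: (_ \in C); rewrite ?normr1 ?normr0.
Qed.

(** The calculus is multiplicative: for the indicators it is the product rule
    of the projections, and both sides are uniformly continuous in [k]. *)
Lemma calcM h k u : bm h -> bm k -> Phi k (Phi h u) = Phi (fun z => k z * h z) u.
Proof.
move=> hh hk; have [c hc] := proj2 hh.
have c0 : 0 <= c by apply: le_trans (hc 0).
apply: (hnorm_eps_eq mO (C := 2 * M * hnorm (Phi h u) + 2 * M * c * hnorm u)) => e e0.
have [n [t [D [mD hD]]]] := @simple_approx _ (measurableTypeR R) R _ _ hk e0.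
apply: le_trans (hnorm_triangle mO (\sum_(j < n) t j *: P (D j) (Phi h u)) _ _) _.
have b1 := calc_simple_close (Phi h u) hk (ltW e0) mD hD.
rewrite mulrDl lerD //; first by rewrite mulrAC.
have -> : \sum_(j < n) t j *: P (D j) (Phi h u) =
    Phi (fun z => (\sum_(j < n) t j * \1_(D j) z) * h z) u.
  have -> : (fun z => (\sum_(j < n) t j * \1_(D j) z) * h z) =
      (fun z => \sum_(j < n) t j * (\1_(D j) z * h z)).
    by apply/funext => z; rewrite mulr_suml; under eq_bigr do rewrite -mulrA.
  rewrite (@calc_sum n (fun (j : 'I_n) z => t j * (\1_(D j) z * h z))); last first.
    by move=> j; apply: bm_scale; exact: bm_indicM.
  apply: eq_bigr => j _; rewrite calcZ ?calc_proj //; exact: bm_indicM.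
have bs : bm (fun z => \sum_(j < n) t j * \1_(D j) z) by exact: bm_simple.
rewrite (hnorm_distC mO) -calcB; [|exact: bm_mul|exact: bm_mul].
have -> : 2 * M * c * hnorm u * e = 2 * M * (e * c) * hnorm u by ring.
apply: calc_bound.
- by rewrite mulr_ge0 // ltW.
- by apply: bm_sub; exact: bm_mul.
- by move=> z; rewrite -mulrBl normrM ler_pM.
Qed.

Lemma calc_linear h a u v : bm h ->
  Phi h (a *: u + v) = a *: Phi h u + Phi h v.
Proof.
move=> hh.
apply: (hnorm_eps_eq mO (C := 2 * M * hnorm (a *: u + v) +
  (2 * M * hnorm v + `|a| * (2 * M * hnorm u)))) => e e0.
have [n [t [D [mD hD]]]] := @simple_approx _ (measurableTypeR R) R _ _ hh e0.
have S x : hnorm (Phi h x - \sum_(j < n) t j *: P (D j) x) <= 2 * M * hnorm x * e.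
  rewrite mulrAC; apply: calc_simple_close => //; exact: ltW.
apply: le_trans (hnorm_triangle mO (\sum_(j < n) t j *: P (D j) (a *: u + v)) _ _) _.
rewrite mulrDl lerD //.
have -> : \sum_(j < n) t j *: P (D j) (a *: u + v) =
    a *: (\sum_(j < n) t j *: P (D j) u) + \sum_(j < n) t j *: P (D j) v.
  rewrite scaler_sumr -big_split; apply: eq_bigr => j _ /=.
  by rewrite proj_linear // scalerDr !scalerA mulrC.
set su := \sum_(j < n) t j *: P (D j) u; set sv := \sum_(j < n) t j *: P (D j) v.
rewrite (hnorm_distC mO).
have -> : a *: Phi h u + Phi h v - (a *: su + sv) =
    (Phi h v - sv) + a *: (Phi h u - su).
  by rewrite scalerBr opprD addrACA addrC.
apply: le_trans (hnormD mO _ _) _; rewrite mulrDl lerD // hnormZ //.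
by rewrite -[leRHS]mulrA ler_wpM2l.
Qed.

Let PhiLin h a u v : bm h -> Phi' h (a *: u + v) = a *: Phi' h u + Phi' h v.
Proof. exact: calc_linear. Qed.

Lemma calc_scaler h a u : bm h -> Phi h (a *: u) = a *: Phi h u.
Proof. exact: (@calculus_scaler _ _ _ _ Phi' PhiLin). Qed.

Lemma calc_subr h u v : bm h -> Phi h (u - v) = Phi h u - Phi h v.
Proof. exact: (@calculus_subr _ _ _ _ Phi' PhiLin). Qed.

(** Continuity from below of the two finite measures whose difference is
    [B |-> (P B u, v)]. *)
Lemma proj_cvg (F : nat -> set (measurableTypeR R)) u v :
  (forall i, measurable (F i)) -> nondecreasing_seq F ->
  (fun i => ip (P (F i) u) v) @ \oo --> ip (P (\bigcup_i F i) u) v.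
Proof.
move=> mF ndF; have [m1 [m2 dm]] := spectral_dec u v.
have mU : measurable (\bigcup_i F i) by exact: bigcup_measurable.
rewrite (decomposes_val dm mU).
have -> : (fun i => ip (P (F i) u) v) =
    (fun i => fine (m1 (F i)) - fine (m2 (F i))).
  by apply/funext => i; rewrite (decomposes_val dm).
have fcvg (m : {finite_measure set (measurableTypeR R) -> \bar R}) :
    (fun i => fine (m (F i))) @ \oo --> fine (m (\bigcup_i F i)).
  apply: fine_cvg; rewrite fineK ?fin_num_measure //.
  exact: nondecreasing_cvg_mu.
by apply: cvgB; exact: fcvg.
Qed.

(** * Symmetry of the spectral projections *)

Context (K : H -> H) (CK : R) (CK0 : 0 <= CK)
  (Ksym : forall x y, ip (K x) y = ip x (K y))
  (Kpos : forall x, x <> 0 -> 0 < ip (K x) x)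
  (Kbd : forall x, hnorm (K x) <= CK * hnorm x).
Context (A : operator H)
  (hA : forall u w, (dom A u /\ A u = w) <-> spectral_integral P id u w)
  (Asym : forall x y, dom A x -> dom A y -> ip (K (A x)) y = ip (K x) (A y))
  (Aneg : forall x, dom A x -> x <> 0 -> ip (K (A x)) x < 0).

Lemma bm_indic_id B (N : R) : measurable B -> (forall z, B z -> `|z| <= N) ->
  bm (fun z => \1_B z * z).
Proof.
move=> mB hB; apply: (@bm_indic_bounded _ _ _ B id `|N|) => //.
by move=> z /hB zN; exact: le_trans zN (ler_norm _).
Qed.

(** Restricted to a bounded Borel set the spectral measure has moments, so its
    range lies in the domain of the operator. *)
Lemma app_proj B (N : R) x : measurable B -> (forall z, B z -> `|z| <= N) ->
  dom A (P B x) /\ A (P B x) = Phi (fun z => \1_B z * z) x.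
Proof.
move=> mB hB; apply/hA => v.
have bz := bm_indic_id mB hB.
have [m1 [m2 dm]] := spectral_dec x v.
have fin (m : {finite_measure set (measurableTypeR R) -> \bar R}) :
    (m B < +oo)%E by rewrite -ge0_fin_numE // fin_num_measure.
pose n (m : {finite_measure set (measurableTypeR R) -> \bar R}) :
  {finite_measure set (measurableTypeR R) -> \bar R} := mfrestr mB (fin m).
have nE (m : {finite_measure set (measurableTypeR R) -> \bar R}) f :
    measurable_fun setT f ->
    (\int[n m]_z (f z)%:E = \int[m]_(z in B) (f z)%:E)%E.
  by move=> mf; rewrite -(integral_mrestr m mB mf).
have mid : measurable_fun setT (fun z : measurableTypeR R => z : R).
  exact: measurable_id.
have ni m : (n m).-integrable setT (EFin \o id).
  apply/integrableP; split; first by apply/measurable_EFinP; exact: mid.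
  have mabs : measurable_fun setT (fun z : measurableTypeR R => `|z : R|).
    exact: measurableT_comp.
  apply: (@le_lt_trans _ _ (\int[m]_(z in B) (cst N%:E) z)%E); last first.
    have NB : (N%:E * m B < +oo)%E.
      by rewrite -(fineK (fin_num_measure m B mB)) -EFinM ltry.
    by rewrite integral_cst //; exact: NB.
  rewrite (nE m _ mabs); apply: ge0_le_integral => //.
  by apply/measurable_EFinP; exact: measurable_funS mabs.
exists (n m1), (n m2); split => //.
  move=> C mC; rewrite -projI //.
  by rewrite (dm (C `&` B)) //; exact: measurableI.
rewrite calcE // (spectral_formE bz dm) /dint.
have iE m : \int[n m]_z z = \int[m]_z (\1_B z * z).
  rewrite /Rintegral (nE m _ mid); congr fine.
  rewrite [LHS]integral_mkcond; apply: eq_integral => z _.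
  by rewrite /patch indicE; case: (_ \in B); rewrite ?mul1r ?mul0r.
by rewrite !iE.
Qed.

Lemma Asym_shift (m : R) x y : dom A x -> dom A y ->
  ip (K (A x - m *: x)) y = ip (K x) (A y - m *: y).
Proof.
by move=> dx dy; rewrite (KBl mO Ksym) (KZl mO Ksym) (ipBr mO) (ipZr mO) Asym.
Qed.

Lemma pairing_shift (m : R) (xn yn : nat -> H) :
  (forall n, dom A (xn n) /\ A (xn n) - m *: xn n = xn n.+1) ->
  (forall n, dom A (yn n.+1) /\ A (yn n.+1) - m *: yn n.+1 = yn n) ->
  forall n, ip (K (xn n)) (yn n) = ip (K (xn 0)) (yn 0).
Proof.
move=> xS yS; elim=> [//|n ih]; have [dx ex] := xS n; have [dy ey] := yS n.
by rewrite -[in RHS]ih -ex -[in RHS]ey Asym_shift.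
Qed.

(** Elements of the range of [P I], for [I] the interval of radius [r] about
    [m], can be hit [n] times by [A - m] at the cost of a factor [r ^ n], and
    elements of the range of [P J] are [n]-fold images under [A - m] of elements
    smaller by a factor [delta ^ n]. As [A] is symmetric for the form given by
    [K], the form between the two ranges is bounded by [(r / delta) ^ n] for
    every [n]. *)
Lemma proj_separated_orthogonal (m r delta N : R) x y :
  0 <= r -> r < delta ->
  ip (K (P [set z | `|z - m| <= r] x))
     (P [set z | delta <= `|z - m| /\ `|z| <= N] y) = 0.
Proof.
move=> r0 rd.
have d0 : 0 < delta by exact: le_lt_trans rd.
set I : set (measurableTypeR R) := [set z | `|z - m| <= r].
set J : set (measurableTypeR R) := [set z | _ /\ _].
have mid : measurable_fun setT (fun z : measurableTypeR R => z : R).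
  exact: measurable_id.
have mdist : measurable_fun setT (fun z : measurableTypeR R => `|z - m|).
  by apply: measurableT_comp => //; apply: measurable_funB.
have mI : measurable I.
  rewrite -[I]setTI.
  have -> : I = (fun z => `|z - m|) @^-1` `]-oo, r].
    by apply/seteqP; split=> z /=; rewrite in_itv.
  exact: mdist.
have mJ : measurable J.
  rewrite -[J]setTI.
  have -> : J = ((fun z => `|z - m|) @^-1` `[delta, +oo[) `&`
                ((fun z => `|z|) @^-1` `]-oo, N]).
    by apply/seteqP; split=> z /=; rewrite !in_itv /= andbT.
  rewrite setIIr; apply: measurableI; first exact: mdist.
  by apply: measurableT_comp.
have IB z : I z -> `|z| <= r + `|m|.
  move=> Iz; rewrite -[z](subrK m); apply: le_trans (ler_normD _ _) _.
  by rewrite lerD2r.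
have JB z : J z -> `|z| <= N by case.
have mpow n : measurable_fun setT (fun z : measurableTypeR R => (z - m) ^+ n).
  by apply: measurable_funX; apply: measurable_funB.
have bI n : bm (fun z => \1_I z * (z - m) ^+ n).
  apply: (@bm_indic_bounded _ _ _ _ _ (r ^+ n)) => //; first exact: exprn_ge0.
  by move=> z Iz; rewrite normrX lerXn2r.
have bJ n : bm (fun z => \1_J z * ((z - m) ^+ n)^-1).
  apply: (@bm_indic_bounded _ _ _ _ _ (delta ^+ n)^-1) => //.
  - exact: measurableT_comp (@measurable_invr R) (mpow n).
  - by rewrite invr_ge0 exprn_ge0 // ltW.
  - move=> z [Jz _]; have pz : 0 < `|z - m| by exact: lt_le_trans Jz.
    rewrite normfV normrX lef_pV2 ?posrE ?exprn_gt0 //.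
    by rewrite lerXn2r ?nnegrE // ltW.
pose xn n := Phi (fun z => \1_I z * (z - m) ^+ n) x.
pose yn n := Phi (fun z => \1_J z * ((z - m) ^+ n)^-1) y.
have shift B (b : R) h u : measurable B -> (forall z, B z -> `|z| <= b) ->
    bm (fun z => \1_B z * h z) ->
    forall w, w = Phi (fun z => \1_B z * h z) u ->
    dom A w /\ A w - m *: w = Phi (fun z => \1_B z * ((z - m) * h z)) u.
  move=> mB hB bh w wE.
  have bz := bm_indic_id mB hB.
  have wB : w = P B w.
    rewrite wE calc_proj //; congr (Phi _ u); apply/funext => z.
    by rewrite indicE; case: (_ \in B); rewrite ?mul1r ?mul0r.
  have [dw Aw] := app_proj w mB hB; rewrite -wB in dw Aw; split => //.
  rewrite Aw wE calcM // -calcZ // -calcB; [|exact: bm_mul|exact: bm_scale].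
  congr (Phi _ u); apply/funext => z.
  by rewrite indicE; case: (_ \in B); rewrite ?mul1r ?mul0r ?mulr0 ?subr0 //; ring.
have xS n : dom A (xn n) /\ A (xn n) - m *: xn n = xn n.+1.
  have [dx ->] := shift I _ _ x mI IB (bI n) _ erefl; split => //.
  by rewrite /xn; congr (Phi _ x); apply/funext => z; rewrite exprS.
have yS n : dom A (yn n.+1) /\ A (yn n.+1) - m *: yn n.+1 = yn n.
  have [dy ->] := shift J _ _ y mJ JB (bJ n.+1) _ erefl; split => //.
  rewrite /yn; congr (Phi _ y); apply/funext => z; rewrite indicE.
  case: (boolP (z \in J)); rewrite ?inE => Jz; rewrite ?mul1r ?mul0r //.
  have z0 : z - m != 0.
    by rewrite -normr_gt0; apply: lt_le_trans d0 _; case: Jz.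
  by rewrite exprS invfM mulrA divff // mul1r.
have const := pairing_shift xS yS.
have x0E : xn 0 = P I x.
  rewrite -calc_indic // /xn; congr (Phi _ x); apply/funext => z.
  by rewrite expr0 mulr1.
have y0E : yn 0 = P J y.
  rewrite -calc_indic // /yn; congr (Phi _ y); apply/funext => z.
  by rewrite expr0 invr1 mulr1.
rewrite -x0E -y0E.
pose D := CK * (2 * M * hnorm x) * (2 * M * hnorm y).
have D0 : 0 <= D by rewrite /D !mulr_ge0 ?hnorm_ge0.
have bound n : `|ip (K (xn 0)) (yn 0)| <= D * (r / delta) ^+ n.
  have := const n; move: (ip (K (xn 0)) (yn 0)) => c <-.
  apply: le_trans (K_cauchy mO Kbd _ _) _.
  have bx : hnorm (xn n) <= 2 * M * r ^+ n * hnorm x.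
    apply: calc_bound => //; first exact: exprn_ge0.
    move=> z; rewrite indicE; case: (boolP (z \in I)); rewrite ?inE => Iz.
      by rewrite mul1r normrX lerXn2r.
    by rewrite mul0r normr0 exprn_ge0.
  have by_ : hnorm (yn n) <= 2 * M * (delta ^+ n)^-1 * hnorm y.
    apply: calc_bound => //; first by rewrite invr_ge0 exprn_ge0 // ltW.
    move=> z; rewrite indicE; case: (boolP (z \in J)); rewrite ?inE => Jz.
      have [Jz1 _] := Jz; have pz : 0 < `|z - m| by exact: lt_le_trans Jz1.
      rewrite mul1r normfV normrX lef_pV2 ?posrE ?exprn_gt0 //.
      by rewrite lerXn2r ?nnegrE // ltW.
    by rewrite mul0r normr0 invr_ge0 exprn_ge0 // ltW.
  have -> : D * (r / delta) ^+ n =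
      CK * (2 * M * r ^+ n * hnorm x) * (2 * M * (delta ^+ n)^-1 * hnorm y).
    by rewrite /D expr_div_n; ring.
  by apply: ler_pM; rewrite ?mulr_ge0 ?hnorm_ge0 // ler_wpM2l.
apply: geometric_bound_eq0 bound; first by rewrite divr_ge0 // ltW.
by rewrite ltr_pdivrMr // mul1r.
Qed.

Definition proj_symmetric B : Prop :=
  forall x y, ip (K (P B x)) y = ip (K x) (P B y).

(** The complement of the interval is the increasing union of bounded sets at a
    positive distance from it, so its range is orthogonal to that of the interval
    in the limit; a projection whose range is orthogonal to that of its
    complement is symmetric. *)
Lemma interval_proj_symmetric (m r : R) : 0 <= r ->
  proj_symmetric [set z | `|z - m| <= r].
Proof.
move=> r0.
set I : set (measurableTypeR R) := [set z | _].
have mdist : measurable_fun setT (fun z : measurableTypeR R => `|z - m|).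
  by apply: measurableT_comp => //; apply: measurable_funB.
have mI : measurable I.
  rewrite -[I]setTI.
  have -> : I = (fun z => `|z - m|) @^-1` `]-oo, r].
    by apply/seteqP; split=> z /=; rewrite in_itv.
  exact: mdist.
pose J (i : nat) : set (measurableTypeR R) :=
  [set z | r + i.+1%:R^-1 <= `|z - m| /\ `|z| <= i%:R].
have mJ i : measurable (J i).
  rewrite -[J i]setTI.
  have -> : J i = ((fun z => `|z - m|) @^-1` `[r + i.+1%:R^-1, +oo[) `&`
                ((fun z => `|z|) @^-1` `]-oo, i%:R]).
    by apply/seteqP; split=> z /=; rewrite !in_itv /= andbT.
  rewrite setIIr; apply: measurableI; first exact: mdist.
  by apply: measurableT_comp.
have ndJ : nondecreasing_seq J.
  move=> i j ij; apply/subsetPset => z [z1 z2]; split.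
    apply: le_trans z1; rewrite lerD2l lef_pV2 ?posrE // ler_nat.
    by rewrite ltnS.
  by apply: le_trans z2 _; rewrite ler_nat.
have UJ : \bigcup_i J i = ~` I.
  apply/seteqP; split=> z /=.
    move=> [i _ [z1 _]] zI; have : r < `|z - m|.
      by apply: lt_le_trans z1; rewrite ltrDl invr_gt0.
    by rewrite ltNge zI.
  move=> /negP; rewrite -ltNge => rz.
  pose e := `|z - m| - r; have e0 : 0 < e by rewrite subr_gt0.
  exists (maxn (Num.truncn e^-1) (Num.truncn `|z|).+1) => //; split.
    rewrite -lerBrDl -/e; apply: ltW; rewrite invf_plt ?posrE //.
    rewrite -truncn_lt_nat ?ltnS ?leq_maxl //.
    by rewrite invr_ge0 ltW.
  by apply: ltW; rewrite -truncn_lt_nat // leq_max ltnSn orbT.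
have mU : measurable (~` I) by exact: measurableC.
have orth x y : ip (K (P I x)) (P (~` I) y) = 0.
  rewrite ipC -UJ.
  have c := @proj_cvg _ y (K (P I x)) mJ ndJ.
  have c0 : (fun i => ip (P (J i) y) (K (P I x))) @ \oo --> (0 : R).
    have -> : (fun i => ip (P (J i) y) (K (P I x))) = cst 0.
      apply/funext => i; rewrite ipC.
      apply: proj_separated_orthogonal => //.
      by rewrite ltrDl invr_gt0.
    exact: cvg_cst.
  exact: cvg_unique c c0.
have half x y : ip (K (P I x)) y = ip (K (P I x)) (P I y).
  have := orth x y; rewrite proj_setC // (ipBr mO) => /eqP.
  by rewrite subr_eq0 => /eqP.
by move=> x y; rewrite half (KC Ksym) -half (KC Ksym).
Qed.

Lemma proj_symmetric_cvg (F : nat -> set (measurableTypeR R)) :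
  (forall i, measurable (F i)) -> nondecreasing_seq F ->
  (forall i, proj_symmetric (F i)) -> proj_symmetric (\bigcup_i F i).
Proof.
move=> mF ndF sF x y.
have c1 := @proj_cvg _ x (K y) mF ndF; have c2 := @proj_cvg _ y (K x) mF ndF.
rewrite Ksym [RHS]ipC.
apply: (cvg_unique (@norm_hausdorff _ _) c1).
suff -> : (fun i => ip (P (F i) x) (K y)) = (fun i => ip (P (F i) y) (K x)).
  exact: c2.
by apply/funext => i; rewrite -Ksym sF ipC.
Qed.

Lemma proj_symmetric_set0 : proj_symmetric set0.
Proof.
move=> x y; have -> : set0 = ~` setT :> set (measurableTypeR R) by rewrite setCT.
by rewrite !proj_setC // !projT !subrr (ip0r mO) Ksym (ip0l mO).
Qed.

(** Bounded closed intervals give symmetric projections, half-open intervals are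
    increasing unions of these, and the Borel sets with a symmetric projection
    form a lambda-system. *)
Lemma all_proj_symmetric B : measurable B -> proj_symmetric B.
Proof.
move=> mB.
suff : [set C : set (measurableTypeR R) | measurable C /\ proj_symmetric C] B.
  by case.
move: B mB; apply: (@lambda_system_subset _ R.-ocitv.-measurable _ setT).
- exact: measurableI.
- split=> //.
  + split; first exact: measurableT.
    by move=> x y; rewrite !projT.
  + move=> B C CB [mB sB] [mC sC]; have mD : measurable (B `\` C : set (measurableTypeR R)).
      exact: (@measurableD _ (measurableTypeR R)).
    have E x : P (B `\` C) x = P B x - P C x.
      have D0 : C `&` (B `\` C) = set0 by rewrite setDE setICA setICr setI0.
      have := @proj_disjoint_union _ _ x mC mD D0.
      by rewrite setDUK // => ->; rewrite addrC addKr.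
    split => // x y; rewrite !E Ksym (ipBl mO) (ipBr mO).
    by rewrite -!Ksym sB sC.
  + move=> F ndF hF; split; first by apply: bigcup_measurable => i _; case: (hF i).
    by apply: proj_symmetric_cvg => // i; case: (hF i).
- move=> C mC; split; first exact: sub_sigma_algebra.
  case: mC => -[a b] _ <- /=.
  have [ba|ab] := leP b a.
    rewrite set_itv_ge ?bnd_simp -?leNgt //; exact: proj_symmetric_set0.
  pose a' (i : nat) := a + (b - a) * i.+1%:R^-1.
  pose F (i : nat) : set (measurableTypeR R) :=
    [set z | `|z - (a' i + b) / 2| <= (b - a' i) / 2].
  have FE i z : F i z <-> a' i <= z <= b.
    rewrite /F /= ler_norml; split=> /andP[? ?]; apply/andP; split; lra.
  have ba0 : 0 < b - a by rewrite subr_gt0.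
  have a'b i : a' i <= b.
    rewrite /a' -lerBrDl ler_piMr ?(ltW ba0) // invf_le1 ?posrE //.
    by rewrite ler1n.
  have -> : [set` `]a, b]] = \bigcup_i F i.
    apply/seteqP; split=> z /=.
      rewrite in_itv /= => /andP[az zb].
      have e0 : 0 < (z - a) / (b - a) by rewrite divr_gt0 // subr_gt0.
      exists (Num.truncn ((z - a) / (b - a))^-1) => //; apply/FE.
      rewrite zb andbT /a' -lerBrDl mulrC -ler_pdivlMr //.
      apply: ltW; rewrite invf_plt ?posrE //.
      by rewrite -truncn_lt_nat ?ltnSn // invr_ge0 ltW.
    move=> [i _ /FE /andP[az zb]]; rewrite in_itv /= zb andbT.
    apply: lt_le_trans az; rewrite /a' ltrDl mulr_gt0 //.
  apply: proj_symmetric_cvg.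
  + move=> i; have -> : F i = `[a' i, b]%classic.
      by apply/seteqP; split=> z /=; rewrite in_itv /= => /FE.
    exact: measurable_itv.
  + move=> i j ij; apply/subsetPset => z /FE /andP[h1 h2]; apply/FE.
    rewrite h2 andbT; apply: le_trans h1; rewrite lerD2l ler_wpM2l ?(ltW ba0) //.
    by rewrite lef_pV2 ?posrE // ler_nat ltnS.
  + move=> i; apply: interval_proj_symmetric.
    by rewrite divr_ge0 // subr_ge0.
- by [].
Qed.

Lemma calc_symmetric h x y : bm h -> ip (K (Phi h x)) y = ip (K x) (Phi h y).
Proof.
move=> hh; apply/eqP; rewrite -subr_eq0 -normr_le0; apply/ler_addgt0Pr => e e0.
pose D := 2 * (CK * (2 * M) * hnorm x * hnorm y) + 1.
have c0 : 0 <= CK * (2 * M) * hnorm x * hnorm y by rewrite !mulr_ge0 ?hnorm_ge0.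
have D0 : 0 < D by rewrite /D; lra.
have e'0 : 0 < e / D by rewrite divr_gt0.
have [n [t [C [mC hC]]]] := @simple_approx _ (measurableTypeR R) R _ _ hh e'0.
have cl u := calc_simple_close u hh (ltW e'0) mC hC.
set S := fun u => \sum_(j < n) t j *: P (C j) u.
have SS : ip (K (S x)) y = ip (K x) (S y).
  rewrite Ksym /S (ip_suml mO) (K_sumr mO); apply: eq_bigr => j _.
  by rewrite (ipZl mO) (ipZr mO) -Ksym all_proj_symmetric.
have -> : ip (K (Phi h x)) y - ip (K x) (Phi h y) =
    ip (K (Phi h x - S x)) y - ip (K x) (Phi h y - S y).
  by rewrite (KBl mO Ksym) (ipBr mO) SS; ring.
have b1 : `|ip (K (Phi h x - S x)) y| <= CK * (2 * M * (e / D) * hnorm x) * hnorm y.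
  apply: le_trans (K_cauchy mO Kbd _ _) _.
  by rewrite ler_wpM2r ?hnorm_ge0 // ler_wpM2l.
have b2 : `|ip (K x) (Phi h y - S y)| <= CK * hnorm x * (2 * M * (e / D) * hnorm y).
  apply: le_trans (K_cauchy mO Kbd _ _) _.
  by rewrite ler_wpM2l ?mulr_ge0 ?hnorm_ge0.
apply: le_trans (ler_normB _ _) _; apply: le_trans (lerD b1 b2) _.
rewrite add0r.
have -> : CK * (2 * M * (e / D) * hnorm x) * hnorm y +
  CK * hnorm x * (2 * M * (e / D) * hnorm y) = (D - 1) * (e / D).
  by rewrite /D; ring.
rewrite mulrCA ler_piMr ?(ltW e0) // ler_pdivrMr // mul1r.
by rewrite lerBlDr lerDl.
Qed.

Lemma calc_ge0 h x : bm h -> (forall z, 0 <= h z) -> 0 <= ip (K (Phi h x)) x.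
Proof.
move=> hh h0.
have bs : bm (fun z => Num.sqrt (h z)).
  have [mh [c hc]] := hh; split.
    by apply: measurableT_comp => //; apply: continuous_measurable_fun; exact: sqrt_continuous.
  exists (Num.sqrt c) => z; rewrite ger0_norm ?sqrtr_ge0 // ler_wsqrtr //.
  exact: le_trans (ler_norm _) (hc z).
have -> : Phi h x = Phi (fun z => Num.sqrt (h z)) (Phi (fun z => Num.sqrt (h z)) x).
  rewrite calcM //; congr (Phi _ x); apply/funext => z.
  by rewrite -expr2 sqr_sqrtr.
rewrite calc_symmetric //.
set w := Phi _ x; have [->|/eqP w0] := eqVneq w 0; first by rewrite (ip0r mO).
exact: ltW (Kpos w0).
Qed.

(** On the range of a spectral projection of a bounded part of the nonnegative
    axis the operator is both nonnegative and negative definite. *)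
Lemma proj_nonneg_eq0 (N : R) x :
  P (`[0, N]%classic : set (measurableTypeR R)) x = 0.
Proof.
set B : set (measurableTypeR R) := `[0, N]%classic.
have mB : measurable B by exact: measurable_itv.
have hB z : B z -> `|z| <= N.
  by rewrite /B /= in_itv /= => /andP[z0 zN]; rewrite ger0_norm.
have [->//|/eqP w0] := eqVneq (P B x) 0.
have [dw Aw] := app_proj x mB hB.
have := Aneg dw w0; rewrite Aw ltNge => /negP; case.
have bz : bm (fun z => \1_B z * z) by exact: bm_indic_id hB.
rewrite -all_proj_symmetric // calc_proj //.
have -> : (fun z => \1_B z * (\1_B z * z)) = (fun z => \1_B z * z).
  by apply/funext => z; rewrite indicE; case: (_ \in B); rewrite ?mul1r ?mul0r.
apply: calc_ge0 => // z; rewrite indicE; case: (boolP (z \in B)); last first.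
  by rewrite mul0r.
by rewrite inE /B /= in_itv /= mul1r => /andP[].
Qed.

(** Testing against vectors [K (P B y)] localizes the signed measure to [B], where
    the possibly unbounded [h] may be replaced by [h] cut off to [B]. *)
Lemma proj_spectral_integral B h x w : measurable B ->
  bm (fun z => \1_B z * h z) -> spectral_integral P h x w ->
  P B w = Phi (fun z => \1_B z * h z) x.
Proof.
move=> mB hh hw; apply: (K_inj mO Ksym Kpos) => y.
rewrite all_proj_symmetric // Ksym ipC.
have [m1 [m2 [dm i1 i2 E]]] := hw (K (P B y)).
have -> : ip (K (P B y)) w = ip w (K (P B y)) by exact: ipC.
rewrite E -/(dint m1 m2 h) (@dint_restrict _ _ _ m1 m2 B) //; last first.
  move=> C mC CB; have := dm C mC.
  have -> : ip (P C x) (K (P B y)) = 0.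
    rewrite -Ksym -all_proj_symmetric // -projI //.
    have -> : B `&` C = set0 by rewrite setIC; exact/disjoints_subset.
    by rewrite -[set0]setCT proj_setC // projT subrr Ksym (ip0l mO).
  have f1 := fin_num_measure m1 C mC; have f2 := fin_num_measure m2 C mC.
  move=> e; have fK (a b : \bar R) : a \is a fin_num -> b \is a fin_num ->
      0%:E = (a - b)%E -> a = b.
    move=> /fineK <- /fineK <-; rewrite -EFinB => -[] /esym/eqP.
    by rewrite subr_eq0 => /eqP ->.
  exact: fK.
pose g (z : R) : R := \1_B z * h z.
have bg : bm g by [].
have gB : (fun z => \1_B z * g z) = g.
  apply/funext => z; rewrite /g indicE.
  by case: (_ \in B); rewrite ?mul1r ?mul0r.
transitivity (ip (Phi g x) (K (P B y))).
  by rewrite (calcE _ _ bg); exact: esym (spectral_formE bg dm).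
rewrite -Ksym; transitivity (ip (K (P B (Phi g x))) y).
  exact: esym (all_proj_symmetric mB _ _).
by rewrite (calc_proj x mB bg) gB.
Qed.

(** * The scheme on a bounded part of the spectrum *)

Section TruncatedStages.
Context (B : set (measurableTypeR R)) (mB : measurable B) (N : R)
  (Bneg : forall z, B z -> z < 0) (BN : forall z, B z -> `|z| <= N) (N0 : 0 <= N).

Local Notation zz := (fun z : R => \1_B z * z).

Let bzz : bm zz. Proof. exact: bm_indic_id BN. Qed.
Let bB : bm (\1_B : R -> R). Proof. exact: bm_indic. Qed.

Lemma indic_idem (z : R) : \1_B z * \1_B z = \1_B z :> R.
Proof. by rewrite indicE; case: (_ \in B); rewrite ?mul1r ?mul0r. Qed.

Lemma bm_cutoff h x : dom (Phi h) x -> (forall z, B z -> `|h z| <= N) ->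
  bm (fun z => \1_B z * h z).
Proof.
move=> dx hN; apply: bm_indic_bounded hN => //.
exact: spectral_integral_measurable (spectral_integral_dom dx).
Qed.

Lemma proj_calc h x : dom (Phi h) x -> (forall z, B z -> `|h z| <= N) ->
  P B (Phi h x) = Phi (fun z => \1_B z * h z) x.
Proof.
move=> dx hN.
apply: (proj_spectral_integral mB).
  exact: bm_cutoff dx hN.
exact: spectral_integral_dom.
Qed.

(** The consistency condition on the coefficients turns a stage into its
    increment: [chi(z) - 1] is [z] times the sum of the coefficients, so that
    only the combinations [tau G (L u - g (v_j))] of the initial value and of
    the nonlinear terms enter. *)
Lemma stage_increment (m : nat) (chi : R -> R) (al : nat -> R -> R) (u0 x : H)
    (r : nat -> H) (tau : R) :
  dom (Phi chi) u0 -> (forall j, (j < m)%N -> dom (Phi (al j)) (r j)) ->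
  (forall z, B z -> `|chi z| <= N) ->
  (forall j z, (j < m)%N -> B z -> `|al j z| <= N) ->
  (forall z, z < 0 -> \sum_(j < m) al j z = (chi z - 1) / z) ->
  x = Phi chi u0 - tau *: \sum_(j < m) Phi (al j) (r j) ->
  P B x - P B u0 = \sum_(j < m) Phi (fun z => \1_B z * al j z)
                          (Phi zz u0 - tau *: Phi (\1_B) (r j)).
Proof.
move=> dchi dal chiN alN sumal ->.
have bal (j : 'I_m) : bm (fun z => \1_B z * al j z).
  by apply: (bm_cutoff (dal j (ltn_ord j))) => z; exact: alN.
have bchi := bm_cutoff dchi chiN.
rewrite (projB _ _ mB) (projZ _ _ mB) (proj_sum _ mB).
rewrite (proj_calc dchi chiN).
have E1 : \sum_(j < m) P B (Phi (al j) (r j)) =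
    \sum_(j < m) Phi (fun z => \1_B z * al j z) (r j).
  apply: eq_bigr => j _; apply: proj_calc; first exact: dal.
  by move=> z; exact: alN.
have E2 : Phi (fun z => \1_B z * chi z) u0 - P B u0 =
    \sum_(j < m) Phi (fun z => \1_B z * al j z) (Phi zz u0).
  rewrite -(calc_indic u0 mB) -(calcB u0 bchi bB).
  transitivity (Phi (fun z => \sum_(j < m) (\1_B z * al j z) * (\1_B z * z)) u0).
    have -> // : (fun z => \1_B z * chi z - \1_B z) =
      (fun z => \sum_(j < m) (\1_B z * al j z) * (\1_B z * z)).
    apply/funext => z; rewrite indicE; case: (boolP (z \in B)).
      rewrite inE => Bz; have z0 := Bneg Bz.
      under eq_bigr do rewrite !mul1r.
      by rewrite -mulr_suml sumal // !mul1r divfK // lt_eqF.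
    by move=> _; rewrite big1 ?mul0r ?subr0 // => j _; rewrite !mul0r.
  rewrite (@calc_sum m
    (fun (j : 'I_m) z => (\1_B z * al j z) * (\1_B z * z)) u0); last first.
    by move=> j; apply: bm_mul.
  by apply: eq_bigr => j _; rewrite (calcM _ bzz (bal j)).
rewrite E1 addrAC E2 scaler_sumr -sumrB; apply: eq_bigr => j _.
have bj := bal j.
rewrite (calc_subr _ _ bj) (calc_scaler _ _ bj).
rewrite (calcM _ bB bj).
have -> // : (fun z => \1_B z * al j z * \1_B z) = (fun z => \1_B z * al j z).
by apply/funext => z; rewrite mulrAC indic_idem.
Qed.

(** The part of the energy balance that is carried by the bounded part [B] of
    the spectrum. *)
Lemma truncated_stages_ge0 (s : nat) (a : nat -> nat -> R -> R) (b : nat -> R -> R)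
    (chi : nat -> R -> R) (w r : nat -> H) (tau : R) :
  (forall z, z < 0 ->
     Pmx s a b z \in unitmx /\ positive_definite_mx (Deltamx s a b z)) ->
  (forall i, (0 < i <= s)%N -> dom (Phi (chi i)) (w 0)) ->
  (forall i j, (0 < i <= s)%N -> (j < i)%N ->
     dom (Phi (stage_coef s a b i j)) (r j)) ->
  (forall i z, (0 < i <= s)%N -> B z -> `|chi i z| <= N) ->
  (forall i j z, (0 < i <= s)%N -> (j < i)%N -> B z ->
     `|stage_coef s a b i j z| <= N) ->
  (forall i z, (0 < i <= s)%N -> z < 0 ->
     \sum_(j < i) stage_coef s a b i j z = (chi i z - 1) / z) ->
  (forall i, (0 < i <= s)%N -> w i = Phi (chi i) (w 0) -
     tau *: \sum_(j < i) Phi (stage_coef s a b i j) (r j)) ->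
  0 <= \sum_(i < s)
    (ip (K (A (P B (w i.+1)))) (w i.+1 - w i)
     - 2^-1 * ip (K (A (P B (w i.+1 - w i)))) (w i.+1 - w i)
     - tau * ip (K (P B (r i))) (w i.+1 - w i)).
Proof.
move=> hD dchi dal chiN alN sumal wE.
pose sc := stage_coef s a b.
pose p (i j : nat) : R -> R :=
  if (0 < i <= s)%N && (j < i)%N then (fun z => \1_B z * sc i j z) else fun=> 0.
have bp i j : bm (p i j).
  rewrite /p; case: ifP => [/andP[i1 ji]|_]; last exact: bm_cst.
  by apply: (bm_cutoff (dal i j i1 ji)) => z; exact: alN.
have pE i j z : (i <= s)%N -> (j < s)%N -> p i j z = \1_B z * sc i j z.
  move=> si sj; rewrite /p si andbT /sc /stage_coef.
  have [->|i0] := posnP i; first by rewrite mulr0.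
  have [ji|ij] := ltnP j i => //=.
  case: eqP ij => [->|_ _]; first by rewrite leqNgt sj.
  by rewrite mulr0.
have Azz x : A (P B x) = Phi zz x.
  by have [] := app_proj x mB BN.
have Pe x : P B x = Phi (\1_B) x by rewrite calc_indic.
have inc i : (i <= s)%N -> Phi (\1_B) (w i) - Phi (\1_B) (w 0) =
    \sum_(j < s) Phi (p i j) (Phi zz (w 0) - tau *: Phi (\1_B) (r j)).
  move=> si; have [->|i0] := posnP i.
    rewrite subrr big1 // => j _; exact: calc0.
  have i1 : (0 < i <= s)%N by rewrite i0.
  rewrite -!Pe (stage_increment (dchi i i1) (fun j => dal i j i1) _ _ _ (wE i i1)).
  - rewrite (big_ord_widen _ (fun j => Phi (fun z => \1_B z * sc i j z)
      (Phi zz (w 0) - tau *: Phi (\1_B) (r j))) si) big_mkcond.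
    apply: eq_bigr => j _; rewrite /p i1 /=.
    by case: ifP => // _; rewrite calc0.
  - by move=> z; exact: chiN.
  - by move=> j z; exact: alN.
  - by move=> z; exact: sumal.
have Csym h x y : bm h -> ip (K (Phi h x)) y = ip (K x) (Phi h y).
  exact: calc_symmetric.
have CM h k u : bm h -> bm k -> Phi k (Phi h u) = Phi (fun z => k z * h z) u.
  exact: calcM.
have CD h k u : bm h -> bm k -> Phi (fun z => h z + k z) u = Phi h u + Phi k u.
  exact: calcD.
have CZ l h u : bm h -> Phi (fun z => l * h z) u = l *: Phi h u.
  exact: calcZ.
have Clin h l u v : bm h -> Phi h (l *: u + v) = l *: Phi h u + Phi h v.
  exact: calc_linear.
have := @stage_form_ge0 _ _ _ _ mO _ _ Ksym Kpos (fun h x => Phi h x)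
  Csym CM CD CZ Clin s (\1_B) zz p tau w r bB bzz bp indic_idem.
have zzB z : \1_B z * z * \1_B z = \1_B z * z by rewrite mulrAC indic_idem.
move=> /(_ zzB inc) h.
under eq_bigr do rewrite !Azz Pe.
apply: h => z t /=.
have E i : (i <= s)%N ->
    \sum_(j < s) p i j z * t j = \1_B z * \sum_(j < s) sc i j z * t j.
  by move=> si; rewrite mulr_sumr; apply: eq_bigr => j _; rewrite pE // mulrA.
have Ei (i : 'I_s) := E i (ltnW (ltn_ord i)).
have Ei1 (i : 'I_s) := E i.+1 (ltn_ord i).
under eq_bigr do rewrite Ei Ei1.
rewrite indicE; case: (boolP (z \in B)); last first.
  by move=> _; rewrite big1 // => i _; rewrite !mul0r subrr mulr0.
rewrite inE => Bz; have [Pu pD] := hD z (Bneg Bz).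
under eq_bigr do rewrite !mul1r.
exact: (stage_pointwise_ge0 t Pu pD).
Qed.

End TruncatedStages.

Section SpectralExhaustion.
Context (phi : measurableTypeR R -> R) (mphi : measurable_fun setT phi)
  (phi_ge : forall z, `|z| <= phi z).

(** The parts of the negative axis on which the function [phi] is bounded; it
    will dominate all the coefficients of the scheme. *)
Definition sublevel (k : nat) : set (measurableTypeR R) :=
  [set z | z < 0 /\ phi z <= k%:R].

Lemma measurable_sublevel n : measurable (sublevel n).
Proof.
have -> : sublevel n = `]-oo, 0[%classic `&` (phi @^-1` `]-oo, n%:R]).
  by apply/seteqP; split=> z /=; rewrite !in_itv.
apply: measurableI; first exact: measurable_itv.
by rewrite -[X in measurable X]setTI; exact: mphi.
Qed.

(** Nothing is lost by leaving out the nonnegative axis, which carries no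
    spectrum. *)
Lemma sublevel_cvg x y : (fun n => ip (P (sublevel n) x) y) @ \oo --> ip x y.
Proof.
pose D n : set (measurableTypeR R) := sublevel n `|` `[0, n%:R]%classic.
have mI n : measurable (`[0, n%:R]%classic : set (measurableTypeR R)).
  exact: measurable_itv.
have mD n : measurable (D n).
  by apply: measurableU => //; exact: measurable_sublevel.
have -> : (fun n => ip (P (sublevel n) x) y) = (fun n => ip (P (D n) x) y).
  apply/funext => n; rewrite proj_disjoint_union //.
  - rewrite proj_nonneg_eq0.
    by rewrite addr0.
  - exact: measurable_sublevel.
  - apply/disjoints_subset => z [z0 _] /=; rewrite in_itv /= => /andP[z0' _].
    by move: z0; rewrite ltNge z0'.
have UD : \bigcup_n D n = setT.
  apply/seteqP; split=> // z _; have [z0|z0] := leP 0 z.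
    exists (Num.truncn z).+1 => //; right; rewrite /= in_itv /= z0 /=.
    by apply: ltW; rewrite -truncn_lt_nat.
  exists (Num.truncn (phi z)).+1 => //; left; split => //.
  apply: ltW; rewrite -truncn_lt_nat //.
  exact: le_trans (phi_ge z).
have ndD : nondecreasing_seq D.
  move=> n l nl; have nl' : (n%:R : R) <= l%:R by rewrite ler_nat.
  apply/subsetPset => z [[z0 zn]|]; first by left; split=> //; exact: le_trans nl'.
  by rewrite /= in_itv /= => /andP[z0 zn]; right; rewrite /= in_itv /= z0 (le_trans zn).
rewrite -[X in _ --> ip X y]projT -UD.
exact: (@proj_cvg D x y mD ndD).
Qed.

Lemma sublevel_bound n z : sublevel n z -> `|z| <= n%:R.
Proof. by move=> [_]; exact: le_trans. Qed.

Lemma app_sublevel n x : dom A (P (sublevel n) x) /\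
  forall t, ip (K (A (P (sublevel n) x))) t =
            ip (K (A (P (sublevel n) x))) (P (sublevel n) t).
Proof.
have mB := measurable_sublevel n.
have [dA ->] := app_proj x mB (@sublevel_bound n).
split => // t.
have bz := bm_indic_id mB (@sublevel_bound n).
rewrite -(all_proj_symmetric mB).
rewrite (calc_proj x mB bz).
have -> // : (fun z => \1_(sublevel n) z * (\1_(sublevel n) z * z)) =
  (fun z => \1_(sublevel n) z * z).
by apply/funext => z; rewrite mulrA indic_idem.
Qed.

End SpectralExhaustion.

End SpectralCalculus.

(** * The generator and the energy form *)

Section SelfAdjoint.
Context (R : realType) (d : nat)
  (lam : {measure set (borel_space R d) -> \bar R}) (Omega : set 'rV[R]_d)
  (mO : measurable (Omega : set (borel_space R d)))
  (H : function_space lam Omega).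
Implicit Types (x y : H) (A : operator H).

Local Notation ip := (@ip R d lam Omega H).
Local Notation hnorm := (@hnorm R d lam Omega H).

Lemma self_adjoint_sym A x y : self_adjoint A -> dom A x -> dom A y ->
  ip (A x) y = ip x (A y).
Proof. by move=> [_ _ sA] dx dy; apply: (proj2 (sA y (A y))). Qed.

Lemma linear_operatorB A x y : linear_operator A -> dom A x -> dom A y ->
  dom A (x - y) /\ A (x - y) = A x - A y.
Proof.
move=> [_ lA] dx dy; have [d1 e1] := lA (-1) y x dy dx.
by rewrite !scaleN1r addrC in d1 e1; rewrite e1 [- A y + _]addrC.
Qed.

Lemma linear_operator0 A : linear_operator A -> A 0 = 0.
Proof.
move=> lA; have d0 := proj1 lA.
by have [_] := linear_operatorB lA d0 d0; rewrite !subrr.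
Qed.

(** The inverse of [- G] is a bounded operator defined everywhere, and makes the
    duality pairing an inner product; [G L] is symmetric for it. *)
Lemma negative_inverse (G : operator H) : negative_definite G ->
  exists (K : H -> H) (CK : R),
    [/\ 0 <= CK, forall x y, ip (K x) y = ip x (K y),
        forall x, x <> 0 -> 0 < ip (K x) x,
        forall x, hnorm (K x) <= CK * hnorm x &
        forall x, dom G x -> K (G x) = - x].
Proof.
move=> [saG negG [surjG [C hC]]].
have linG : linear_operator G by case: saG.
have ex w : exists u, dom G u /\ G u = w.
  by have [u du Gu] := surjG w; exists u.
have [k hk] := choice ex.
have kb x : hnorm (k x) <= `|C| * hnorm x.
  have [dk Gk] := hk x; apply: le_trans (hC _ dk) _; rewrite Gk.
  by rewrite ler_wpM2r ?hnorm_ge0 // ler_norm.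
have ksym x y : ip (k x) y = ip x (k y).
  have [dx Gx] := hk x; have [dy Gy] := hk y.
  by rewrite -{1}Gy -(self_adjoint_sym saG) // Gx.
exists (fun x => - k x), `|C|; split => //.
- by move=> x y; rewrite (ipNl mO) (ipNr mO) ksym.
- move=> x x0; have [dx Gx] := hk x.
  have kx0 : k x <> 0.
    by move=> kx0; apply: x0; rewrite -Gx kx0 linear_operator0.
  by have := negG _ dx kx0; rewrite Gx (ipNl mO) oppr_gt0 ksym.
- by move=> x; rewrite (hnormN mO).
- move=> x dx; congr (- _); have [dk Gk] := hk (G x).
  have [dB GB] := linear_operatorB linG dk dx.
  have := hC _ dB; rewrite GB Gk subrr (hnorm0 mO) mulr0 => h.
  apply/eqP; rewrite -subr_eq0; apply/eqP/(hnorm_eq0 mO).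
  by apply/eqP; rewrite eq_le h hnorm_ge0.
Qed.

End SelfAdjoint.

Section Generator.
Context (R : realType) (d : nat)
  (lam : {measure set (borel_space R d) -> \bar R}) (Omega : set 'rV[R]_d)
  (mO : measurable (Omega : set (borel_space R d)))
  (H : function_space lam Omega).
Implicit Types (x y : H).

Local Notation ip := (@ip R d lam Omega H).
Local Notation hnorm := (@hnorm R d lam Omega H).

Context (G LL S : operator H) (hLL : positive_definite LL)
  (hS : is_sqrt_of S LL) (beta tau : R) (beta0 : 0 <= beta) (tau0 : 0 < tau).
Context (K : H -> H)
  (Ksym : forall x y, ip (K x) y = ip x (K y))
  (KG : forall x, dom G x -> K (G x) = - x).

Local Notation A := (op_scale tau (op_comp G (op_shift beta LL))).

Definition energy_form x y : R := beta * ip x y + ip (S x) (S y).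

Local Notation q := energy_form.

Lemma sqrt_dom x : dom LL x ->
  dom S x /\ forall y, dom S y -> ip (LL x) y = ip (S x) (S y).
Proof.
move=> dx; have [saS _ sq] := hS; have [d1 d2 e] := proj2 (sq x (LL x)) (conj dx erefl).
by split => // y dy; rewrite -e (self_adjoint_sym saS).
Qed.

Lemma generator_sqrt_dom x : dom A x -> dom S x.
Proof. by move=> [dx _]; case: (sqrt_dom dx). Qed.

(** The factor [G] of the generator is cancelled by [K], which leaves the form of
    [L]; it extends from the domain of [LL] to that of its square root. *)
Lemma generator_form x y : dom A x -> dom S y ->
  ip (K (A x)) y = - tau * q x y.
Proof.
move=> [dx dG] dy; have [_ e] := sqrt_dom dx.
have -> : A x = tau *: G (beta *: x + LL x) by [].
rewrite (KZl mO Ksym) KG // (ipNl mO) (ipDl mO) (ipZl mO) e //.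
by rewrite /energy_form mulrN mulNr.
Qed.

Lemma energy_formC x y : q x y = q y x.
Proof. by rewrite /energy_form ipC [ip (S x) _]ipC. Qed.

Lemma generator_sym x y : dom A x -> dom A y -> ip (K (A x)) y = ip (K x) (A y).
Proof.
move=> dx dy; have sx := generator_sqrt_dom dx; have sy := generator_sqrt_dom dy.
by rewrite generator_form // energy_formC -generator_form // Ksym [RHS]ipC.
Qed.

Lemma generator_neg x : dom A x -> x <> 0 -> ip (K (A x)) x < 0.
Proof.
move=> dx x0; have ds := generator_sqrt_dom dx.
rewrite generator_form // mulNr oppr_lt0 mulr_gt0 //.
have [dL _] := dx; have [_ e] := sqrt_dom dL.
have := proj2 hLL x dL x0; rewrite e // => p.
by apply: ltr_wpDl => //; rewrite mulr_ge0 // ip_ge0.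
Qed.

Lemma energy_formBl x y t : dom S x -> dom S y ->
  q (x - y) t = q x t - q y t.
Proof.
move=> dx dy; have linS : linear_operator S by case: hS => -[].
have [_ e] := linear_operatorB linS dx dy.
by rewrite /energy_form e !(ipBl mO); ring.
Qed.

Lemma energy_form_ge0 x : 0 <= q x x.
Proof. by rewrite addr_ge0 ?mulr_ge0 // ip_ge0. Qed.

Context (P : set (measurableTypeR R) -> H -> H) (hP : projection_measure P)
  (Psym : forall B x y, measurable B -> ip (K (P B x)) y = ip (K x) (P B y)).
Context (B : nat -> set (measurableTypeR R)) (mB : forall i, measurable (B i))
  (hB : forall i x, dom A (P (B i) x) /\
     forall t, ip (K (A (P (B i) x))) t = ip (K (A (P (B i) x))) (P (B i) t))
  (cB : forall x y, (fun i => ip (P (B i) x) y) @ \oo --> ip x y).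

(** The spectral projections are orthogonal for the energy form, hence bounded
    for it; weak convergence in the energy norm then needs to be tested on the
    dense domain of the square root only. *)
Lemma energy_form_proj_bound i x : dom S x ->
  hnorm (S (P (B i) x)) ^+ 2 <= q x x.
Proof.
move=> dx; have [dA e] := hB i x; have dP := generator_sqrt_dom dA.
have qP y : dom S y -> q (P (B i) x) y = q (P (B i) x) (P (B i) y).
  move=> dy; have [dAy _] := hB i y; have dPy := generator_sqrt_dom dAy.
  have := e y; rewrite !generator_form // => /mulfI; apply.
  by rewrite oppr_eq0 gt_eqF.
have linS : linear_operator S by case: hS => -[].
have [dD _] := linear_operatorB linS dx dP.
have := energy_form_ge0 (x - P (B i) x).
rewrite energy_formBl // ![q _ (x - _)]energy_formC !energy_formBl //.
rewrite (energy_formC x (P (B i) x)) (qP x dx) subrr subr0 subr_ge0.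
apply: le_trans.
rewrite hnorm_sqr /energy_form lerDr mulr_ge0 // ip_ge0 //.
Qed.

Lemma sqrt_proj_cvg x v : dom S x ->
  (fun i => ip (S (P (B i) x)) v) @ \oo --> ip (S x) v.
Proof.
move=> dx; have [saS _ _] := hS; have [linS denS _] := saS.
apply/cvgrPdist_le => e e0.
pose c := Num.sqrt (q x x).
have c0 : 0 <= c by exact: sqrtr_ge0.
have bS i : hnorm (S (P (B i) x)) <= c.
  rewrite -(@ler_pXn2r _ 2) ?nnegrE ?hnorm_ge0 //.
  by rewrite [c ^+ 2]sqr_sqrtr ?energy_form_ge0 // energy_form_proj_bound.
have bx : hnorm (S x) <= c.
  rewrite -(@ler_pXn2r _ 2) ?nnegrE ?hnorm_ge0 //.
  rewrite [c ^+ 2]sqr_sqrtr ?energy_form_ge0 // hnorm_sqr /energy_form lerDr.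
  by rewrite mulr_ge0 // ip_ge0.
have e'0 : 0 < e / (2 * (c + c + 1)).
  by rewrite divr_gt0 // mulr_gt0 // ltr_wpDl // addr_ge0.
have [y dy vy] := denS v _ e'0.
have cy : (fun i => ip (P (B i) x) (S y)) @ \oo --> ip x (S y) by exact: cB.
have e2 : 0 < e / 2 by rewrite divr_gt0.
move/cvgrPdist_le/(_ _ e2) : cy; apply: filterS => i hi.
have [dA _] := hB i x; have dP := generator_sqrt_dom dA.
rewrite -!(self_adjoint_sym saS) // in hi.
have -> : ip (S x) v - ip (S (P (B i) x)) v =
    (ip (S x) y - ip (S (P (B i) x)) y) + ip (S x - S (P (B i) x)) (v - y).
  by rewrite !(ipBl mO) !(ipBr mO); ring.
apply: le_trans (ler_normD _ _) _.
have -> : e = e / 2 + e / 2 by field.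
apply: lerD => //; apply: le_trans (cauchy_schwarz mO _ _) _.
have h1 : hnorm (S x - S (P (B i) x)) <= c + c.
  by apply: le_trans (hnormB mO _ _) _; rewrite lerD.
apply: le_trans (ler_pM (hnorm_ge0 _) (hnorm_ge0 _) h1 (ltW vy)) _.
have -> : e / 2 = (c + c + 1) * (e / (2 * (c + c + 1))).
  by field; rewrite gt_eqF // ltr_wpDl // addr_ge0.
by rewrite ler_wpM2r ?(ltW e'0) // lerDl.
Qed.

(** The limit along which the truncated inequality is transported to the full
    one. *)
Lemma energy_form_cvg x y : dom S x ->
  (fun i => q (P (B i) x) y) @ \oo --> q x y.
Proof.
move=> dx; apply: cvgD; last exact: sqrt_proj_cvg.
by apply: cvgM; [exact: cvg_cst | exact: cB].
Qed.

End Generator.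

(** * Growth of the potential energy *)

Lemma integral01_derive (R : realType) (Q q : R -> R) :
  (forall t : R, is_derive t 1 Q (q t)) -> continuous q ->
  (\int[lebesgue_measure]_(t in `[0%R, 1%R]) (q t)%:E = (Q 1 - Q 0)%:E)%E.
Proof.
move=> dQ cq; rewrite EFinB; apply: continuous_FTC2.
- exact: ltr01.
- exact: continuous_subspaceT.
- have cQ t : {for t, continuous Q}.
    apply: differentiable_continuous; apply/derivable1_diffP.
    exact: @ex_derive _ _ _ _ _ _ _ (dQ t).
  split; first by move=> t _; exact: @ex_derive _ _ _ _ _ _ _ (dQ t).
  + by apply: cvg_at_right_filter; exact: cQ.
  + by apply: cvg_at_left_filter; exact: cQ.
- by move=> t _; rewrite derive1E; exact: @derive_val _ _ _ _ _ _ _ (dQ t).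
Qed.

Lemma bounded_domain_finite (R : realType) (d : nat)
    (lam : {measure set (borel_space R d) -> \bar R}) (Omega : set 'rV[R]_d) :
  is_lebesgue lam -> measurable (Omega : set (borel_space R d)) ->
  bounded_set Omega -> (lam Omega < +oo)%E.
Proof.
move=> hlam mO [N [_ hN]].
pose c := `|N| + 1.
have c0 : 0 <= c by rewrite /c addr_ge0.
pose box : set 'rV[R]_d := [set x | forall i, (const_mx (- c) : 'rV[R]_d) 0 i <= x 0 i <=
                          (const_mx c : 'rV[R]_d) 0 i].
have hbox : (lam box < +oo)%E.
  rewrite /box hlam ?ltry // => i; rewrite !mxE.
  by rewrite -subr_ge0 opprK addr_ge0.
have sub : Omega `<=` box.
  move=> x Ox i; rewrite !mxE -ler_norml.
  have : `|x| <= c by apply: hN => //; rewrite /c ltr_pwDr // ler_norm.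
  apply: le_trans; rewrite [leRHS]/Num.norm /= mx_normrE.
  by apply: (le_trans _ (le_bigmax _ _ (0, i))).
have mbox : measurable (box : set (borel_space R d)).
  rewrite -[box]setCK; apply: measurableC; apply: open_borel.
  rewrite openC.
  have -> : box = \bigcap_(i in [set: 'I_d])
      ((fun x : 'rV[R]_d => x 0 i) @^-1` `[- c, c]%classic).
    apply/seteqP; split=> x /=.
      by move=> h i _ /=; have := h i; rewrite !mxE in_itv.
    by move=> h i; have := h i I; rewrite /= !mxE in_itv.
  apply: closed_bigI => i _; apply: closed_comp; last exact: itv_closed.
  by move=> x _; exact: coord_continuous.
by apply: le_lt_trans hbox; apply: le_measure => //; rewrite inE.
Qed.

Section PotentialEnergy.
Context (R : realType) (d : nat)
  (lam : {measure set (borel_space R d) -> \bar R}) (Omega : set 'rV[R]_d)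
  (mO : measurable (Omega : set (borel_space R d)))
  (Ofin : (lam Omega < +oo)%E)
  (H : function_space lam Omega).
Context (F f : R -> R) (hF : forall x : R, is_derive x 1 F (f x))
  (hcont : continuous f)
  (Nf : H -> H) (hNf : acts_pointwise f Nf)
  (CL : R) (hLip : forall u v : H, hnorm (Nf u - Nf v) <= CL * hnorm (u - v)).
Implicit Types (u v w : H).

Local Notation ip := (@ip R d lam Omega H).
Local Notation hnorm := (@hnorm R d lam Omega H).
Local Notation S := (borel_space R d).

Let T01 : set (measurableTypeR R) := `[0%R, 1%R]%classic.
Let mT01 : measurable T01. Proof. exact: measurable_itv. Qed.
Let T01fin : (@lebesgue_measure R T01 < +oo)%E.
Proof. by rewrite /T01 lebesgue_measure_itv /= lte_fin ltr01 -EFinB ltry. Qed.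

Let m1 : {finite_measure set S -> \bar R} :=
  mfrestr (mO : measurable (Omega : set S)) Ofin.
Let m2 : {finite_measure set (measurableTypeR R) -> \bar R} := mfrestr mT01 T01fin.

Let F_cont : continuous F.
Proof.
move=> x; apply: differentiable_continuous; apply/derivable1_diffP.
exact: @ex_derive _ _ _ _ _ _ _ (hF x).
Qed.

Let clamp (t : R) : R := Num.max 0 (Num.min 1 t).

Let clamp01 t : 0 <= clamp t <= 1.
Proof. by rewrite /clamp le_max lexx /= ge_max ler01 ge_min lexx. Qed.

Let clampK t : 0 <= t <= 1 -> clamp t = t.
Proof. by move=> /andP[t0 t1]; rewrite /clamp min_r // max_r. Qed.

Let eOm u : S -> R := (fun x => ev u x) \_ Omega.

Let meOm u : measurable_fun setT (eOm u).
Proof.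
by apply/(measurable_restrictT _ mO); exact: ev_measurable.
Qed.

(** The derivative of [F] along the segment from [v] to [u]. Clamping the
    parameter, and extending [u] and [v] by zero off [Omega], makes it defined and
    measurable on the whole product space. *)
Let kern u v (p : S * measurableTypeR R) : R :=
  f (eOm v p.1 + clamp p.2 * (eOm u p.1 - eOm v p.1)) * (eOm u p.1 - eOm v p.1).

Let mkern u v : measurable_fun setT (kern u v).
Proof.
have mu w : measurable_fun setT (fun p : S * measurableTypeR R => eOm w p.1).
  exact: measurableT_comp (meOm w) (measurable_fst).
have mc : measurable_fun setT (fun p : S * measurableTypeR R => clamp p.2).
  apply: measurableT_comp measurable_snd.
  by apply: measurable_maxr => //; apply: measurable_minr.
apply: measurable_funM; last exact: measurable_funB.
apply: measurableT_comp; first exact: continuous_measurable_fun.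
apply: measurable_funD => //; apply: measurable_funM => //.
exact: measurable_funB.
Qed.

Let segm u v t : H := v + t *: (u - v).

Let kern_ae u v (t : R) :
  {ae lam, forall x, Omega x ->
     kern u v (x, t) = ev (Nf (segm u v (clamp t))) x * ev (u - v) x}.
Proof.
have h1 := hNf (segm u v (clamp t)).
have h2 := ev_linear (clamp t) (u - v) v.
have h3 := ev_linear (-1) v u.
apply: (ae_mono (mu := lam) _ (ae_and (mu := lam) h1 (ae_and (mu := lam) h2 h3))).
move=> x [e1 [e2 e3]] Ox.
rewrite e1 // /segm addrC e2 //.
have -> : u - v = -1 *: v + u by rewrite scaleN1r addrC.
rewrite e3 // /kern /eOm /= !patchE mem_set //.
by congr (f _ * _); ring.
Qed.

Let int_m1 (g : S -> R) : measurable_fun setT g ->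
  (\int[m1]_x (g x)%:E = \int[lam]_(x in Omega) (g x)%:E)%E.
Proof. by move=> mg; exact: (integral_mrestr lam (mO : measurable (Omega : set S)) mg). Qed.

Let int_m2 (g : measurableTypeR R -> R) : measurable_fun setT g ->
  (\int[m2]_t (g t)%:E = \int[lebesgue_measure]_(t in T01) (g t)%:E)%E.
Proof. by move=> mg; exact: (integral_mrestr lebesgue_measure mT01 mg). Qed.

Let mkern1 u v t : measurable_fun setT (fun x => kern u v (x, t)).
Proof. exact: measurableT_comp (mkern u v) (measurable_pair2 t). Qed.

Let bnd u v := (hnorm (Nf v) + `|CL| * hnorm (u - v)) ^+ 2 + hnorm (u - v) ^+ 2.

Let hnorm_Nf_segm u v t :
  hnorm (Nf (segm u v (clamp t))) <= hnorm (Nf v) + `|CL| * hnorm (u - v).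
Proof.
set w := segm u v _.
have -> : Nf w = Nf v + (Nf w - Nf v) by rewrite addrC subrK.
apply: le_trans (hnormD mO _ _) _; rewrite lerD2l.
apply: le_trans (hLip _ _) _.
have -> : w - v = clamp t *: (u - v) by rewrite /w /segm addrC addKr.
have /andP[c0 c1] := clamp01 t.
rewrite (hnormZ mO) (ger0_norm c0).
have h0 : 0 <= clamp t * hnorm (u - v) by rewrite mulr_ge0 ?hnorm_ge0.
apply: le_trans (ler_wpM2r h0 (ler_norm CL)) _.
by rewrite ler_wpM2l // ler_piMl ?hnorm_ge0.
Qed.

Let kern_bound u v t : (\int[m1]_x `|(kern u v (x, t))%:E| <= (bnd u v)%:E)%E.
Proof.
set w := segm u v (clamp t); set h := u - v.
have mk := mkern1 u v t.
have mnk : measurable_fun setT (fun x => `|kern u v (x, t)|).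
  exact: measurableT_comp.
under eq_integral do rewrite abse_EFin.
rewrite int_m1 //.
have iN := ip_integrable mO (Nf w) (Nf w); have ih := ip_integrable mO h h.
have -> : (\int[lam]_(x in Omega) `|kern u v (x, t)|%:E =
    \int[lam]_(x in Omega) `|ev (Nf w) x * ev h x|%:E)%E.
  apply: ae_eq_integral => //.
  - by apply/measurable_EFinP; apply: measurable_funS mnk.
  - apply/measurable_EFinP; apply: measurableT_comp => //.
    by apply: measurable_funM; exact: ev_measurable.
  - apply: (ae_mono (mu := lam) _ (kern_ae u v t)) => x e Ox.
    by rewrite e.
apply: (@le_trans _ _ (\int[lam]_(x in Omega)
    (ev (Nf w) x * ev (Nf w) x + ev h x * ev h x)%:E)%E).
  apply: ge0_le_integral => //.
  - apply/measurable_EFinP; apply: measurableT_comp => //.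
    by apply: measurable_funM; exact: ev_measurable.
  - apply/measurable_EFinP; apply: measurable_funD;
      by apply: measurable_funM; exact: ev_measurable.
  - move=> x _; rewrite lee_fin ler_norml.
    by apply/andP; split; nra.
have -> : (\int[lam]_(x in Omega)
    (ev (Nf w) x * ev (Nf w) x + ev h x * ev h x)%:E =
    (ip (Nf w) (Nf w) + ip h h)%:E)%E.
  have iS := rintegrableD mO iN ih.
  rewrite -[LHS]fineK; last exact: integrable_fin_num iS.
  by congr EFin; exact: (RintegralD mO iN ih).
rewrite lee_fin -!hnorm_sqr /bnd lerD2r lerXn2r ?nnegrE ?hnorm_ge0 //.
  by rewrite addr_ge0 ?hnorm_ge0 // mulr_ge0 ?hnorm_ge0.
exact: hnorm_Nf_segm.
Qed.

Let kern_integrable u v :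
  (product_measure1 m1 m2).-integrable setT (EFin \o kern u v).
Proof.
have mk : measurable_fun setT (EFin \o kern u v).
  by apply/measurable_EFinP; exact: mkern.
apply/(integrable21ltyP m1 m2 mk).
apply: (@le_lt_trans _ _ (\int[m2]_t (cst (bnd u v)%:E) t)%E).
  apply: ge0_le_integral => //.
  - by move=> t _; exact: integral_ge0.
  - apply: (measurable_fun_fubini_tonelli_G (abse \o (EFin \o kern u v))).
      exact: measurableT_comp.
    by move=> p; exact: abse_ge0.
  - by move=> t _; exact: kern_bound.
have m2T : m2 setT \is a fin_num := fin_num_measure m2 setT measurableT.
have bT : ((bnd u v)%:E * m2 setT < +oo)%E by rewrite -(fineK m2T) -EFinM ltry.
by rewrite integral_cst //; exact: bT.
Qed.

Let kern_ftc u v x :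
  (\int[m2]_t (kern u v (x, t))%:E = (F (eOm u x) - F (eOm v x))%:E)%E.
Proof.
rewrite int_m2; last exact: measurableT_comp (mkern u v) (measurable_pair1 x).
set a := eOm v x; set b := eOm u x.
have E : {in T01, (fun t => (kern u v (x, t))%:E) =1
                  (fun t => (f (a + t * (b - a)) * (b - a))%:E)}.
  move=> t; rewrite inE /T01 /= in_itv /= => t01.
  by rewrite /kern /= clampK.
rewrite (eq_integral _ _ E).
have dQ (t : R) : is_derive t 1 (fun t : R => F (a + t * (b - a)))
    (f (a + t * (b - a)) * (b - a)).
  have d1 : is_derive t 1 (fun t : R => a + t * (b - a)) (b - a).
    apply: is_derive_eq; rewrite !(scaler0, scale0r, addr0, add0r).
    by rewrite mul1r /GRing.scale /= mulr1.
  exact: (@is_derive1_comp _ F (fun t : R => a + t * (b - a)) t _ _ (hF _) d1).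
have cq : continuous (fun t : R => f (a + t * (b - a)) * (b - a)).
  have c1 t : {for t, continuous (fun t : R => a + t * (b - a))}.
    exact: (cvgD (cvg_cst a) (cvgM cvg_id (cvg_cst (b - a)))).
  move=> t; apply: (cvgM _ (cvg_cst (b - a))).
  apply: (@continuous_comp _ _ _ (fun t : R => a + t * (b - a)) f).
    exact: c1.
  exact: hcont.
rewrite (integral01_derive dQ cq).
by rewrite mul1r mul0r addr0 [a + _]addrC subrK.
Qed.

Lemma potential_integrable u :
  lam.-integrable Omega (EFin \o (fun x => F (ev u x))).
Proof.
have mFu w : measurable_fun (Omega : set S) (fun x => F (ev w x)).
  apply: measurableT_comp; first exact: continuous_measurable_fun.
  exact: ev_measurable.
have i1 := integrable_fubini_F (kern_integrable u 0).
have i2 : lam.-integrable Omega (EFin \o (fun x => F (ev u x) - F (ev (0 : H) x))).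
  have mF' : measurable_fun setT (fun x => F (eOm u x) - F (eOm 0 x)).
    have cF := continuous_measurable_fun F_cont.
    by apply: measurable_funB; apply: measurableT_comp.
  apply/(@integrableP _ S R lam Omega); split.
    by apply/measurable_EFinP; apply: measurable_funB.
  have /integrableP[_] := i1; apply: le_lt_trans.
  rewrite le_eqVlt; apply/orP; left; apply/eqP.
  transitivity (\int[m1]_x `|F (eOm u x) - F (eOm 0 x)|%:E)%E.
    rewrite int_m1; last exact: measurableT_comp.
    by apply: eq_integral => x; rewrite inE => Ox; rewrite /eOm !patchE mem_set.
  by apply: eq_integral => x _; rewrite /fubini_F kern_ftc.
have i3 : lam.-integrable Omega (EFin \o (fun x => F (ev (0 : H) x))).
  apply: (ae_eq_rintegrable mO (f := fun=> F 0)) => //.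
    have h := ev_linear (-1) (0 : H) 0.
    apply: (ae_mono (mu := lam) _ h) => x e Ox.
    by have := e Ox; rewrite scaler0 addr0 mulN1r addNr => ->.
  apply: measurable_bounded_integrable => //.
  exists `|F 0|; split; first exact: num_real.
  by move=> r Fr x _; exact: ltW.
have := rintegrableD mO i2 i3; congr integrable.
by apply/funext => x /=; rewrite subrK.
Qed.

Let kern_m1 u v t : (\int[m1]_x (kern u v (x, t))%:E =
  (ip (Nf (segm u v (clamp t))) (u - v))%:E)%E.
Proof.
rewrite int_m1 //; set w := segm u v _; set h := u - v.
have iN := ip_integrable mO (Nf w) h.
have hf := fineK (integrable_fin_num mO iN).
transitivity (\int[lam]_(x in Omega) (ev (Nf w) x * ev h x)%:E)%E;
  last exact: esym hf.
apply: ae_eq_integral => //.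
- by apply/measurable_EFinP; apply: measurable_funS (mkern1 u v t).
- by apply/measurable_EFinP; apply: measurable_funM; exact: ev_measurable.
- by apply: (ae_mono (mu := lam) _ (kern_ae u v t)) => x e Ox; rewrite e.
Qed.

Let segm_slope u v t : ip (Nf (segm u v (clamp t))) (u - v) <=
  ip (Nf v) (u - v) + CL * hnorm (u - v) ^+ 2 * clamp t.
Proof.
set w := segm u v _; set h := u - v.
have /andP[c0 c1] := clamp01 t.
rewrite -lerBlDl -(ipBl mO); apply: le_trans (ip_le mO _ _) _.
have wv : hnorm (w - v) = clamp t * hnorm h.
  have -> : w - v = clamp t *: h by rewrite /w /segm addrC addKr.
  by rewrite (hnormZ mO) (ger0_norm c0).
have := ler_wpM2r (hnorm_ge0 h) (hLip w v); rewrite wv.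
move=> slope; apply: le_trans slope _.
by rewrite le_eqVlt; apply/orP; left; apply/eqP; ring.
Qed.

(** The potential energy grows along the segment from [v] to [u] at the rate
    [(f(v + t (u - v)), u - v)], which the Lipschitz bound in the norm controls.
    The function [f] being Lipschitz for the norm only, the integrand is
    dominated not pointwise but after integration over the domain, uniformly
    along the segment; this is what Fubini's theorem asks for. *)
Lemma potential_difference u v :
  \int[lam]_(x in Omega) F (ev u x) - \int[lam]_(x in Omega) F (ev v x) <=
  ip (Nf v) (u - v) + CL / 2 * hnorm (u - v) ^+ 2.
Proof.
rewrite -RintegralB //; [|exact: potential_integrable|exact: potential_integrable].
set h := u - v; set A := ip (Nf v) h; set B := CL * hnorm h ^+ 2.
have mc : measurable_fun setT (fun t : measurableTypeR R => A + B * clamp t).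
  apply: measurable_funD => //; apply: measurable_funM => //.
  by apply: measurable_maxr => //; apply: measurable_minr.
have E1 : (\int[lam]_(x in Omega) (F (ev u x) - F (ev v x))%:E =
    \int[m2]_t (ip (Nf (segm u v (clamp t))) h)%:E)%E.
  transitivity (\int[m1]_x (F (eOm u x) - F (eOm v x))%:E)%E.
    rewrite int_m1.
      by apply: eq_integral => x; rewrite inE => Ox; rewrite /eOm !patchE mem_set.
    have cF := continuous_measurable_fun F_cont.
    by apply: measurable_funB; apply: measurableT_comp.
  transitivity (\int[m1]_x \int[m2]_t (EFin \o kern u v) (x, t))%E.
    by apply: eq_integral => x _; rewrite kern_ftc.
  rewrite (Fubini (kern_integrable u v)).
  by apply: eq_integral => t _; rewrite kern_m1.
have iG : m2.-integrable setT
    (EFin \o (fun t => ip (Nf (segm u v (clamp t))) h)).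
  apply: bm_integrable; split.
    apply/measurable_EFinP.
    have := measurable_fubini_G (kern_integrable u v); congr measurable_fun.
    by apply/funext => t; rewrite /fubini_G kern_m1.
  exists ((hnorm (Nf v) + `|CL| * hnorm h) * hnorm h) => t.
  apply: le_trans (cauchy_schwarz mO _ _) _.
  by rewrite ler_wpM2r ?hnorm_ge0 // hnorm_Nf_segm.
have iB : m2.-integrable setT (EFin \o (fun t => A + B * clamp t)).
  apply: bm_integrable; split; first exact: mc.
  exists (`|A| + `|B|) => t; apply: le_trans (ler_normD _ _) _.
  have /andP[c0 c1] := clamp01 t.
  by rewrite lerD2l normrM (ger0_norm c0) ler_piMr.
have E2 : (\int[m2]_t (A + B * clamp t)%:E = (A + B / 2)%:E)%E.
  rewrite int_m2 //.
  have E : {in T01, (fun t => (A + B * clamp t)%:E) =1 (fun t => (A + B * t)%:E)}.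
    by move=> t; rewrite inE /T01 /= in_itv /= => t01; rewrite clampK.
  rewrite (eq_integral _ _ E).
  have dQ (t : R) : is_derive t 1 (fun t : R => A * t + (B / 2) * t ^+ 2) (A + B * t).
    apply: is_derive_eq.
    by rewrite /GRing.scale /=; field.
  have cq : continuous (fun t : R => A + B * t).
    by move=> z; exact: (cvgD (cvg_cst A) (cvgM (cvg_cst B) cvg_id)).
  rewrite (integral01_derive dQ cq); congr EFin.
  by rewrite expr1n expr0n /=; ring.
rewrite /Rintegral E1.
apply: (@le_trans _ _ (fine (\int[m2]_t (A + B * clamp t)%:E)%E)).
  apply: le_Rintegral => // t _; exact: segm_slope.
by rewrite E2 /= lerD2l /B; lra.
Qed.

Lemma energyE (S : operator H) u :
  energy S F u = 2^-1 * ip (S u) (S u) + \int[lam]_(x in Omega) F (ev u x).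
Proof.
have i1 := ip_integrable mO (S u) (S u).
rewrite /energy -RintegralZl // -RintegralD //.
- exact: rintegrableZ.
- exact: potential_integrable.
Qed.

End PotentialEnergy.

Section EnergyIncrement.
Context (R : realType) (d : nat)
  (lam : {measure set (borel_space R d) -> \bar R}) (Omega : set 'rV[R]_d)
  (mO : measurable (Omega : set (borel_space R d)))
  (Ofin : (lam Omega < +oo)%E)
  (H : function_space lam Omega).
Context (F f : R -> R) (hF : forall x : R, is_derive x 1 F (f x))
  (hcont : continuous f)
  (Nf : H -> H) (hNf : acts_pointwise f Nf)
  (CL : R) (hLip : forall u v : H, hnorm (Nf u - Nf v) <= CL * hnorm (u - v)).

Local Notation ip := (@ip R d lam Omega H).

(** The quadratic part of the energy is expanded exactly; the stabilizer absorbs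
    the quadratic error of the potential part. *)
Lemma energy_increment (S : operator H) (beta : R) (x y : H) :
  linear_operator S -> CL <= beta -> dom S x -> dom S y ->
  energy S F x - energy S F y <=
    energy_form S beta x (x - y) - 2^-1 * energy_form S beta (x - y) (x - y)
    - ip (beta *: y - Nf y) (x - y).
Proof.
move=> linS CLb dx dy.
rewrite !(energyE mO Ofin hF hcont hNf hLip).
have hp := potential_difference mO Ofin hF hcont hNf hLip x y.
have [_ SB] := linear_operatorB linS dx dy.
have e0 := ip_ge0 (x - y).
have hn : CL / 2 * hnorm (x - y) ^+ 2 <= beta / 2 * ip (x - y) (x - y).
  by rewrite hnorm_sqr ler_wpM2r // ler_pM2r.
rewrite /energy_form SB.
have -> : ip (beta *: y - Nf y) (x - y) =
    beta * ip y (x - y) - ip (Nf y) (x - y).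
  by rewrite (ipBl mO) (ipZl mO).
have sq : ip (S x) (S x - S y) - 2^-1 * ip (S x - S y) (S x - S y) =
    2^-1 * ip (S x) (S x) - 2^-1 * ip (S y) (S y).
  by rewrite !(ipBl mO) !(ipBr mO) (ipC (S y) (S x)); field.
have sq2 : ip x (x - y) = ip y (x - y) + ip (x - y) (x - y).
  by rewrite -(ipDl mO) [y + _]addrC subrK.
move: hp hn sq e0; rewrite sq2.
set I1 := \int[lam]_(t in Omega) F (ev x t).
set I2 := \int[lam]_(t in Omega) F (ev y t).
move: (ip (S x) (S x - S y)) (ip (S x - S y) (S x - S y)) => s1 s2.
move: (ip (S x) (S x)) (ip (S y) (S y)) => s3 s4.
move: (ip y (x - y)) (ip (x - y) (x - y)) (ip (Nf y) (x - y)) => s5 s6 s7.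
move: (hnorm (x - y)) => s8.
clearbody I1 I2; lra.
Qed.

Lemma lipschitz_const_ge0 (x : H) : x <> 0 -> 0 <= CL.
Proof.
move=> x0; have hx : 0 < hnorm x.
  rewrite lt_neqAle hnorm_ge0 andbT eq_sym; apply/eqP => e.
  exact: x0 (hnorm_eq0 mO e).
have := hLip x 0; rewrite subr0 => h.
by rewrite -(pmulr_lge0 _ hx); apply: le_trans h; exact: hnorm_ge0.
Qed.

End EnergyIncrement.

(** * Energy decay *)

Lemma cvg_ord_sum (R : realType) n (F : nat -> 'I_n -> R) (l : 'I_n -> R) :
  (forall i, (fun k => F k i) @ \oo --> l i) ->
  (fun k => \sum_(i < n) F k i) @ \oo --> \sum_(i < n) l i.
Proof.
elim: n F l => [|n ih] F l Fl.
  have -> : (fun k => \sum_(i < 0) F k i) = cst 0.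
    by apply/funext => k; rewrite big_ord0.
  by rewrite big_ord0; exact: cvg_cst.
have -> : (fun k => \sum_(i < n.+1) F k i) =
    (fun k => \sum_(i < n) F k (widen_ord (leqnSn n) i) + F k ord_max).
  by apply/funext => k; rewrite big_ord_recr.
by rewrite big_ord_recr; apply: cvgD => //; apply: ih => i.
Qed.

Lemma cvg_le0 (R : realType) (F : nat -> R) (l : R) :
  F @ \oo --> l -> (forall k, F k <= 0) -> l <= 0.
Proof.
move=> Fl F0; rewrite -(cvg_lim _ Fl) //.
apply: limr_le; first by apply/cvg_ex; exists l.
by near=> k; exact: F0.
Unshelve. all: by end_near.
Qed.

Local Opaque functional_calculus.

Theorem theorem2p1 (R : realType) (d : nat) (hd : (1 <= d <= 3)%N)
    (lam : {measure set (borel_space R d) -> \bar R}) (hlam : is_lebesgue lam)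
    (Omega : set 'rV[R]_d) (hOmega : bounded_domain Omega)
    (H : function_space lam Omega)
    (* the gradient flow u_t = G (LL u + f u) and its energy *)
    (G LL sqrtLL : operator H)
    (hG : negative_definite G)
    (hLL : positive_definite LL) (hsect : sectorial LL)
    (hsqrt : is_sqrt_of sqrtLL LL)
    (F f : R -> R) (hF : forall x : R, is_derive x 1 F (f x))
    (hcont : continuous f)
    (Nf : H -> H) (hNf : acts_pointwise f Nf)
    (CL : R) (hLip : forall u v : H, hnorm (Nf u - Nf v) <= CL * hnorm (u - v))
    (* the stabilizer *)
    (beta : R) (hbeta : CL <= beta)
    (* the ETDRK coefficients *)
    (s : nat) (hs : (0 < s)%N)
    (c : nat -> R) (hc : c 1%N = 0)
    (a : nat -> nat -> R -> R) (b : nat -> R -> R)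
    (heq : preserves_equilibria s c a b)
    (hDelta : forall z : R, z < 0 ->
       Pmx s a b z \in unitmx /\ positive_definite_mx (Deltamx s a b z))
    (* the time step *)
    (tau : R) (htau : 0 < tau)
    (P : set (measurableTypeR R) -> H -> H)
    (hP : spectral_resolution (op_scale tau (op_comp G (op_shift beta LL))) P)
    (* the numerical solution u n, with stages v n 1, ..., v n s *)
    (u : nat -> H) (v : nat -> nat -> H) (n : nat)
    (hdef : etdrk_well_defined G sqrtLL (fun w => beta *: w - Nf w)
              s c a b P (u n) (v n) (u n.+1))
    (hstep : etdrk_step G (fun w => beta *: w - Nf w) tau
               s c a b P (u n) (v n) (u n.+1)) :
  energy sqrtLL F (u n.+1) <= energy sqrtLL F (u n).
Proof.
have [_ openO _ bO] := hOmega.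
have mO : measurable (Omega : set (borel_space R d)) by exact: open_borel.
have Ofin := bounded_domain_finite hlam mO bO.
(* When the space is trivial the step does not move; otherwise the Lipschitz
   constant, hence the stabilizer, is nonnegative. *)
have [triv|] := pselect (forall x : H, x = 0).
  by rewrite (triv (u n.+1)) (triv (u n)).
move=> /existsNP[x0 /(lipschitz_const_ge0 mO hLip) CL0].
have beta0 : 0 <= beta by exact: le_trans CL0 hbeta.
have [K [CK [CK0 Ksym Kpos Kbd KG]]] := negative_inverse mO hG.
have [hPm hA] := hP.
have [M0 hM0] : exists M : R, forall B, measurable B ->
    forall x, hnorm (P B x) <= M * hnorm x by case: hPm.
have hM B : measurable B -> forall x, hnorm (P B x) <= `|M0| * hnorm x.
  move=> mB x; apply: le_trans (hM0 B mB x) _.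
  by rewrite ler_wpM2r ?hnorm_ge0 // ler_norm.
have M0' : 0 <= `|M0| by [].
pose A := op_scale tau (op_comp G (op_shift beta LL)).
have Asym x y : dom A x -> dom A y -> ip (K (A x)) y = ip (K x) (A y).
  exact: (generator_sym mO hsqrt Ksym KG).
have Aneg := generator_neg mO hLL hsqrt beta0 htau Ksym KG.
(* The step appended to the stages, all counted from zero. *)
pose w i := if (i < s)%N then v n i.+1 else u n.+1.
pose r i := G (beta *: w i - Nf (w i)).
pose sc := stage_coef s a b.
pose chi i (z : R) := if (i < s)%N then expR (c i.+1 * z) else expR z.
have [domG domst domu domb [Su Sv Su1]] := hdef.
have [v1 vE uE] := hstep.
have wlt i : (i < s)%N -> w i = v n i.+1 by rewrite /w => ->.
have ws : w s = u n.+1 by rewrite /w ltnn.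
have w0 : w 0 = u n by rewrite wlt.
have scl i : (i < s)%N -> forall j, (j < i)%N -> sc i j = a i.+1 j.+1.
  move=> si j ji; apply/funext => z; rewrite /sc /stage_coef ji.
  by rewrite (ltn_eqF si); case: i ji {si}.
have scs j : sc s j = b j.+1.
  by apply/funext => z; rewrite /sc /stage_coef eqxx gtn_eqF.
have domS i : (i <= s)%N -> dom sqrtLL (w i).
  rewrite leq_eqVlt => /predU1P[->|si]; first by rewrite ws.
  by rewrite wlt //; apply: Sv.
have dchi i : (0 < i <= s)%N -> dom (functional_calculus P (chi i)) (w 0).
  move=> /andP[i0]; rewrite w0 leq_eqVlt => /predU1P[->|si].
    have -> : chi s = expR by apply/funext => z; rewrite /chi ltnn.
    exact: domu.
  have -> : chi i = (fun z => expR (c i.+1 * z)).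
    by apply/funext => z; rewrite /chi si.
  by case: (domst i.+1); rewrite ?ltnS ?i0.
have dal i j : (0 < i <= s)%N -> (j < i)%N ->
    dom (functional_calculus P (sc i j)) (r j).
  move=> /andP[i0]; rewrite leq_eqVlt => /predU1P[->|si] ji.
    by rewrite scs /r wlt //; apply: domb.
  rewrite scl // /r wlt; last exact: ltn_trans si.
  by case: (domst i.+1); rewrite ?ltnS ?i0 // => _; apply.
have sumsc i z : (0 < i <= s)%N -> z < 0 ->
    \sum_(j < i) sc i j z = (chi i z - 1) / z.
  move=> /andP[i0 si] z0; have [hb ha] := heq z z0.
  move: si; rewrite leq_eqVlt => /predU1P[is_|si].
    rewrite is_ /chi ltnn -hb big_add1 big_mkord.
    by apply: eq_bigr => j _; rewrite scs.
  rewrite /chi si -ha ?ltnS ?i0 // big_add1 big_mkord.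
  by apply: eq_bigr => j _; rewrite scl.
have wE i : (0 < i <= s)%N -> w i = functional_calculus P (chi i) (w 0) -
    tau *: \sum_(j < i) functional_calculus P (sc i j) (r j).
  move=> /andP[i0]; rewrite w0 leq_eqVlt => /predU1P[->|si].
    have -> : chi s = expR by apply/funext => z; rewrite /chi ltnn.
    rewrite ws uE big_add1 big_mkord; congr (_ - _ *: _).
    by apply: eq_bigr => j _; rewrite scs /r wlt.
  have -> : chi i = (fun z => expR (c i.+1 * z)).
    by apply/funext => z; rewrite /chi si.
  rewrite wlt // vE ?ltnS ?i0 // big_add1 big_mkord; congr (_ - _ *: _).
  apply: eq_bigr => j _; rewrite scl // /r wlt //.
  exact: ltn_trans (ltn_ord j) si.
(* One measurable function that dominates [z] and all the coefficients: on each
   of its sublevel sets every function of the scheme is bounded. *)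
pose sc' i j (z : R) := if (0 < i <= s)%N && (j < i)%N then sc i j z else 0.
pose phi (z : measurableTypeR R) : R := `|z| +
  (\sum_(i < s.+1) `|chi i z| + \sum_(i < s.+1) \sum_(j < s) `|sc' i j z|).
have chi_ge0 z : 0 <= \sum_(i < s.+1) `|chi i z| by exact: sumr_ge0.
have sc_ge0 z : 0 <= \sum_(i < s.+1) \sum_(j < s) `|sc' i j z|.
  by apply: sumr_ge0 => i _; exact: sumr_ge0.
have phi_id (z : R) : `|z| <= phi z by rewrite /phi lerDl addr_ge0.
have phi_chi i z : (0 < i <= s)%N -> `|chi i z| <= phi z.
  move=> /andP[_ si]; rewrite /phi; have h : `|chi i z| <= \sum_(i < s.+1) `|chi i z|.
    have si' : (i < s.+1)%N by rewrite ltnS.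
    by rewrite (bigD1 (Ordinal si')) //= lerDl sumr_ge0.
  by have := sc_ge0 z; have := normr_ge0 z; lra.
have phi_sc i j z : (0 < i <= s)%N -> (j < i)%N -> `|sc i j z| <= phi z.
  move=> i1 ji; have /andP[_ si] := i1.
  have h : `|sc' i j z| <= \sum_(i < s.+1) \sum_(j < s) `|sc' i j z|.
    have si' : (i < s.+1)%N by rewrite ltnS.
    have sj' : (j < s)%N by exact: leq_trans si.
    rewrite (bigD1 (Ordinal si')) //= (bigD1 (Ordinal sj')) //=.
    by rewrite -addrA lerDl addr_ge0 ?sumr_ge0 // => k _; exact: sumr_ge0.
  move: h; rewrite {1}/sc' i1 ji /= => h.
  by have := chi_ge0 z; have := normr_ge0 z; rewrite /phi; lra.
have mphi : measurable_fun setT phi.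
  have m0 : measurable_fun setT (fun z : measurableTypeR R => `|z : R|).
    exact: measurableT_comp.
  have m1 : measurable_fun setT
      (fun z : measurableTypeR R => \sum_(i < s.+1) `|chi i z|).
    apply: measurable_sum => i; apply: measurableT_comp => //.
    rewrite /chi; case: (i < s)%N; last exact: measurable_expR.
    by apply: measurableT_comp => //; apply: measurable_funM.
  have m2 : measurable_fun setT
      (fun z : measurableTypeR R => \sum_(i < s.+1) \sum_(j < s) `|sc' i j z|).
    apply: measurable_sum => i; apply: measurable_sum => j.
    apply: measurableT_comp => //; rewrite /sc'.
    case E : ((0 < i <= s)%N && (j < i)%N) => //; have /andP[i1 ji] := E.
    exact: spectral_integral_measurable (spectral_integral_dom (dal i j i1 ji)).
  exact: measurable_funD m0 (measurable_funD m1 m2).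
pose B := sublevel phi; pose q := energy_form sqrtLL beta.
pose delta i := w i.+1 - w i.
have cB x y : (fun k => ip (P (B k) x) y) @ \oo --> ip x y.
  exact: (sublevel_cvg mO hPm M0' hM CK0 Ksym Kpos Kbd hA Asym Aneg mphi phi_id).
have hB k x := app_sublevel mO hPm M0' hM CK0 Ksym Kbd hA Asym mphi phi_id k x.
have linS : linear_operator sqrtLL by case: hsqrt => -[].
have dS i : (i < s)%N -> dom sqrtLL (delta i).
  by move=> si; case: (linear_operatorB linS (domS _ si) (domS _ (ltnW si))).
(* The bound on the energy change, cut off to the part [B k] of the spectrum. *)
pose T k := \sum_(i < s) (q (P (B k) (w i.+1)) (delta i)
  - 2^-1 * q (P (B k) (delta i)) (delta i) + ip (P (B k) (r i)) (K (delta i))).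
have T_le0 k : T k <= 0.
  have Bneg z : B k z -> z < 0 by case.
  have BN z : B k z -> `|z| <= k%:R by exact: sublevel_bound.
  have chiN i z : (0 < i <= s)%N -> B k z -> `|chi i z| <= k%:R.
    by move=> i1 [_]; apply: le_trans; exact: phi_chi.
  have scN i j z : (0 < i <= s)%N -> (j < i)%N -> B k z -> `|sc i j z| <= k%:R.
    by move=> i1 ji [_]; apply: le_trans; exact: phi_sc.
  have := @truncated_stages_ge0 _ _ _ _ mO _ _ hPm _ M0' hM _ _ CK0 Ksym Kpos Kbd
    _ hA Asym (B k) (measurable_sublevel mphi k) k%:R Bneg BN (ler0n _ _)
    s a b chi w r tau hDelta dchi dal chiN scN sumsc wE.
  have -> : \sum_(i < s) (ip (K (A (P (B k) (w i.+1)))) (w i.+1 - w i)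
      - 2^-1 * ip (K (A (P (B k) (w i.+1 - w i)))) (w i.+1 - w i)
      - tau * ip (K (P (B k) (r i))) (w i.+1 - w i)) = - tau * T k.
    rewrite /T mulr_sumr; apply: eq_bigr => i _.
    have di := dS i (ltn_ord i).
    rewrite !(generator_form mO hsqrt Ksym KG (proj1 (hB k _)) di) Ksym.
    by rewrite /q /delta; ring.
  by rewrite mulNr oppr_ge0 pmulr_rle0.
have T_cvg : T @ \oo --> \sum_(i < s) (q (w i.+1) (delta i)
    - 2^-1 * q (delta i) (delta i) + ip (r i) (K (delta i))).
  apply: cvg_ord_sum => i; apply: cvgD; last exact: cB.
  have qc x y : dom sqrtLL x -> (fun k => q (P (B k) x) y) @ \oo --> q x y.
    exact: (energy_form_cvg mO hsqrt beta0 htau Ksym KG hB cB).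
  apply: cvgB; first by apply: qc; exact: domS.
  apply: cvgM; first exact: cvg_cst.
  by apply: qc; exact: dS.
have T_lim := cvg_le0 T_cvg T_le0.
rewrite -subr_le0 -ws -w0 -(telescope_sumr (fun i => energy sqrtLL F (w i))) //.
rewrite big_mkord; apply: le_trans T_lim; apply: ler_sum => i _.
have di := domS i (ltnW (ltn_ord i)); have di1 := domS i.+1 (ltn_ord i).
apply: le_trans (energy_increment mO Ofin hF hcont hNf hLip linS hbeta di1 di) _.
have dG : dom G (beta *: w i - Nf (w i)).
  by rewrite wlt //; apply: domG; rewrite /= ltn_ord.
by rewrite -Ksym (KG _ dG) (ipNl mO).
Qed.
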